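(* Let $H\in(1/2,1)$, $\alpha\in(1-H,1/2)$, $\beta\in(1/2,H)$, let $B^H$ be a fractional Brownian motion with Hurst parameter $H$, let $a,b:\mathbb{R}\to\mathbb{R}$ satisfy assumptions (A), (B), (C) listed in the context, and let $X$ be the solution of $$X_t=X_0+\int_0^t a(X_s)\,ds+\int_0^t b(X_s)\,dB^H_s,\quad t\ge 0,$$ with non-random $X_0$. For any $\gamma>1/2$, there exist random variables $\xi$ and $\zeta$ such that, almost surely, for all $t_1\ge0$ and $t_2\in(t_1,t_1+1]$, $$ |X_{t_2}-X_{t_1}|\le\zeta\,(t_2-t_1)^{\beta}\left(\log(t_2+2)\right)^{\kappa},\qquad \Lambda_\beta(t_1,t_2)\le\xi\left(\log(t_2+2)\right)^{\kappa\beta}, $$ where $\kappa=\gamma/\beta$. Moreover, there exists some $c>0$ such that $\mathsf{E}[\exp\{x\xi^{2}\}]<\infty$ and $\mathsf{E}[\exp\{x\zeta^{2\beta}\}]<\infty$ for $x<c$. In particular, all moments of $\xi$ and $\zeta$ are finite.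
   Context: A fractional Brownian motion with Hurst parameter $H$ is a centered Gaussian process $\{B^H_t,t\ge0\}$ with covariance $\mathsf{E}[B^H_tB^H_s]=\frac12(s^{2H}+t^{2H}-|t-s|^{2H})$, with (locally Hölder) continuous paths, on a complete probability space. Assumptions on coefficients: there exist constants $\delta\in(1/H-1,1]$, $K>0$, $L>0$ and for every $N\ge1$ a constant $R_N>0$ such that (A) $|a(x)|+|b(x)|\le K$ for all $x\in\mathbb{R}$; (B) $|a(x)-a(y)|+|b(x)-b(y)|\le L|x-y|$ for all $x,y\in\mathbb{R}$; (C) $b$ is differentiable and $|b'(x)-b'(y)|\le R_N|x-y|^{\delta}$ for all $x,y\in[-N,N]$. Under these assumptions the equation is known to have a unique solution; its paths are almost surely locally Hölder continuous of every order less than $H$. Integrals with respect to $B^H$ are generalized Lebesgue–Stieltjes integrals: for $a_0<b_0$, $$\int_{a_0}^{b_0} f(x)\,dg(x)=e^{i\pi\alpha}\int_{a_0}^{b_0}\big(D^{\alpha}_{a_0+}f\big)(x)\big(D^{1-\alpha}_{b_0-}g_{b_0-}\big)(x)\,dx,\qquad g_{b_0-}(x)=g(x)-g(b_0),$$ provided $D^\alpha_{a_0+}f\in L_1[a_0,b_0]$ and $D^{1-\alpha}_{b_0-}g_{b_0-}\in L_\infty[a_0,b_0]$, where $$\big(D_{a_0+}^{\alpha}f\big)(x)=\frac{1}{\Gamma(1-\alpha)}\bigg(\frac{f(x)}{(x-a_0)^\alpha}+\alpha\int_{a_0}^x\frac{f(x)-f(u)}{(x-u)^{1+\alpha}}du\bigg),$$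 $$\big(D_{b_0-}^{1-\alpha}g\big)(x)=\frac{e^{-i\pi\alpha}}{\Gamma(\alpha)}\bigg(\frac{g(x)}{(b_0-x)^{1-\alpha}}+(1-\alpha)\int_{x}^{b_0}\frac{g(x)-g(u)}{(u-x)^{2-\alpha}}du\bigg).$$ For $u<v$ put $Z(u,v)=\left(D^{1-\alpha}_{v-}B^H_{v-}\right)(u)$ (with $B^H_{v-}(x)=B^H_x-B^H_v$), and for $t_1<t_2$ $$\Lambda_\beta(t_1,t_2)=1\vee\sup_{t_1\le u<v\le t_2}\frac{|Z(u,v)|}{(v-u)^{\beta+\alpha-1}}.$$ *)

(* Defs.v *)
From HB Require Import structures.
From mathcomp Require Import all_boot all_order all_algebra.
From mathcomp Require Import all_classical all_reals all_analysis.
From mathcomp Require Import complex.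

Set Implicit Arguments.
Unset Strict Implicit.
Unset Printing Implicit Defensive.

Import Order.TTheory GRing.Theory Num.Theory.
Import numFieldNormedType.Exports.

Local Open Scope classical_set_scope.
Local Open Scope ring_scope.
Local Open Scope complex_scope.

Definition Gamma {R : realType} (s : R) : R :=
  \int[lebesgue_measure]_(x in `]0, +oo[) (x `^ (s - 1) * expR (- x)).

(** [expi theta] is [e^{i theta}]. *)
Definition expi {R : realType} (theta : R) : R[i] := cos theta +i* sin theta.

(** Integral of a complex-valued function of a real variable. *)
Definition cintegral {R : realType} (D : set R) (h : R -> R[i]) : R[i] :=
  (\int[lebesgue_measure]_(x in D) complex.Re (h x)) +i*
  (\int[lebesgue_measure]_(x in D) complex.Im (h x)).

Section FractionalDerivatives.
Context {R : realType}.

(** [D^{alpha}_{a0+} f] at [x], for [a0 < x]. *)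
Definition frac_left (alpha a0 : R) (f : R -> R) (x : R) : R :=
  (Gamma (1 - alpha))^-1 *
  (f x / (x - a0) `^ alpha +
   alpha * \int[lebesgue_measure]_(u in `]a0, x[)
             ((f x - f u) / (x - u) `^ (1 + alpha))).

(** [D^{1 - alpha}_{b0-} g] at [x], for [x < b0]; note that the argument
    [alpha] stands for the derivative of order [1 - alpha].  The value is
    complex because of the factor [e^{- i pi alpha}]. *)
Definition frac_right (alpha b0 : R) (g : R -> R) (x : R) : R[i] :=
  expi (- (pi * alpha)) *
  ((Gamma alpha)^-1 *
   (g x / (b0 - x) `^ (1 - alpha) +
    (1 - alpha) * \int[lebesgue_measure]_(u in `]x, b0[)
                    ((g x - g u) / (u - x) `^ (2 - alpha))))%:C.

(** [g_{b0-}]. *)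
Definition shift_end (b0 : R) (g : R -> R) : R -> R := fun x => g x - g b0.

(** The left derivative of [f] is in [L_1] and the right derivative of
    [g_{b0-}] is in [L_oo].  Since [\int] is total (with a default value for
    divergent integrals), convergence of the inner integrals is required
    explicitly; membership in [L_oo] is measurability together with an
    almost-everywhere bound. *)
Definition gls_integrable (alpha a0 b0 : R) (f g : R -> R) : Prop :=
  [/\ (\forall x \ae lebesgue_measure, x \in `]a0, b0[ ->
        lebesgue_measure.-integrable `]a0, x[
          (fun u => ((f x - f u) / (x - u) `^ (1 + alpha))%:E)),
      lebesgue_measure.-integrable `[a0, b0] (EFin \o frac_left alpha a0 f),
      (\forall x \ae lebesgue_measure, x \in `]a0, b0[ ->
        lebesgue_measure.-integrable `]x, b0[
          (fun u => ((shift_end b0 g x - shift_end b0 g u)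
                       / (u - x) `^ (2 - alpha))%:E)),
      (measurable_fun `[a0, b0]
         (fun x => complex.Re (frac_right alpha b0 (shift_end b0 g) x)) /\
       measurable_fun `[a0, b0]
         (fun x => complex.Im (frac_right alpha b0 (shift_end b0 g) x)))
    & (exists M : R, \forall x \ae lebesgue_measure, x \in `[a0, b0] ->
         Normc.normc (frac_right alpha b0 (shift_end b0 g) x) <= M)].

(** Generalized Lebesgue-Stieltjes integral of [f] against [g] on
    [[a0, b0]]; it is [0] when [a0 = b0]. *)
Definition gls_integral (alpha a0 b0 : R) (f g : R -> R) : R[i] :=
  expi (pi * alpha) *
  cintegral `[a0, b0]
    (fun x => (frac_left alpha a0 f x)%:C *
              frac_right alpha b0 (shift_end b0 g) x).

End FractionalDerivatives.

(** Hoelder continuity of order [lambda] on every [[0, S]]. *)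
Definition loc_hoelder {R : realType} (lambda : R) (f : R -> R) : Prop :=
  forall S : R, 0 < S -> exists C : R, forall s t : R,
    0 <= s <= S -> 0 <= t <= S -> `|f t - f s| <= C * `|t - s| `^ lambda.

Section Processes.
Context {d : measure_display} {T : measurableType d} {R : realType}
        (P : probability T R).

(** Normal law, possibly degenerate.  [normal_prob m 0] is not the Dirac mass
    at [m], hence the disjunction. *)
Definition gaussian (Y : T -> R) : Prop :=
  (exists m s : R, 0 < s /\
     forall A : set R, measurable A -> pushforward P Y A = normal_prob m s A) \/
  (exists m : R,
     forall A : set R, measurable A -> pushforward P Y A = \d_m A).

(** A process indexed by [t >= 0] is a family over [R] whose values at
    negative times are irrelevant. *)
Definition gaussian_process (B : R -> {RV P >-> R}) : Prop :=
  forall (n : nat) (t c : 'I_n -> R), (forall i, 0 <= t i) ->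
    gaussian (fun w => \sum_(i < n) c i * B (t i) w).

Definition fBm (H : R) (B : R -> {RV P >-> R}) : Prop :=
  [/\ gaussian_process B,
      (forall t, 0 <= t -> ('E_P[B t] = 0)%E),
      (forall s t, 0 <= s -> 0 <= t ->
        ('E_P[B t \* B s] =
          (2^-1 * (s `^ (2 * H) + t `^ (2 * H) - `|t - s| `^ (2 * H)))%R%:E)%E)
    & (\forall w \ae P, forall lambda, 0 < lambda < H ->
         loc_hoelder lambda (fun t => B t w))].

(** Solution, with initial value [x0], of
    [X_t = x0 + \int_0^t a(X_s) ds + \int_0^t b(X_s) dB_s].  Uniqueness is
    understood in the class of processes with almost surely locally Hoelder
    paths of every order below [H], which is therefore part of the notion of
    solution. *)
Definition sde_solution (H alpha : R) (B : R -> {RV P >-> R}) (a b : R -> R)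
    (x0 : R) (X : R -> {RV P >-> R}) : Prop :=
  (\forall w \ae P, forall lambda, 0 < lambda < H ->
     loc_hoelder lambda (fun t => X t w)) /\
  (\forall w \ae P, forall t, 0 <= t ->
     gls_integrable alpha 0 t (fun s => b (X s w)) (fun s => B s w) /\
     (X t w)%:C =
       (x0 + \int[lebesgue_measure]_(s in `[0, t]) a (X s w))%:C +
       gls_integral alpha 0 t (fun s => b (X s w)) (fun s => B s w)).

End Processes.

Definition coef_assumptions {R : realType} (H : R) (a b : R -> R) : Prop :=
  exists (delta K L : R) (RN : nat -> R),
  [/\ H^-1 - 1 < delta <= 1, 0 < K, 0 < L
    & (forall N, (1 <= N)%N -> 0 < RN N)] /\
  [/\ (forall x, `|a x| + `|b x| <= K),
      (forall x y, `|a x - a y| + `|b x - b y| <= L * `|x - y|),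
      (forall x, derivable b x 1)
    & (forall N, (1 <= N)%N -> forall x y : R,
         - N%:R <= x <= N%:R -> - N%:R <= y <= N%:R ->
         `|derive1 b x - derive1 b y| <= RN N * `|x - y| `^ delta)].

(** [Z(u, v)] is the right derivative of order [1 - alpha] of [g_{v-}] at
    [u]. *)
Definition Zfun {R : realType} (alpha : R) (g : R -> R) (u v : R) : R[i] :=
  frac_right alpha v (shift_end v g) u.

(** Extended-real valued, so that an infinite supremum is not replaced by a
    default value. *)
Definition Lambda {R : realType} (alpha beta : R) (g : R -> R) (t1 t2 : R) :
    \bar R :=
  maxe 1%E (ereal_sup
    [set y : \bar R | exists u v : R, [/\ t1 <= u, u < v, v <= t2 &
       y = (Normc.normc (Zfun alpha g u v)
              / (v - u) `^ (beta + alpha - 1))%:E]]).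

(* Main.v *)
Require Import Defs.
From HB Require Import structures.
From mathcomp Require Import all_boot all_order all_algebra.
From mathcomp Require Import all_classical all_reals all_analysis.
From mathcomp Require Import measurable_realfun complex ring lra.

Set Implicit Arguments.
Unset Strict Implicit.
Unset Printing Implicit Defensive.

Import Order.TTheory GRing.Theory Num.Theory.
Import numFieldNormedType.Exports.

Local Open Scope classical_set_scope.
Local Open Scope ring_scope.

(** The proof combines a deterministic estimate for a single path with one
    Gaussian estimate.  Fix an exponent [mu] with
    [max beta (1 - alpha) < mu < H].

    Pathwise estimate.  Let [g] be a path of the fractional Brownian motion,
    [mu]-Hoelder on [[s, t]] with constant [G >= 1], where [t - s <= 1].  If [f]
    is bounded by [K] and [mu]-Hoelder with constant [A] on [[s, t]], the
    definition of the integral by fractional derivatives gives a bound of the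
    order [G (K h^mu + A h^(2 mu))], [h = t - s] ([gls_bound_on]).  Applied to
    [f = b(X)], this turns a Hoelder constant [A] of the solution on a short
    interval into the constant [C1 G + C2 G A h^mu].  On intervals with
    [C2 G h^mu <= 1/2] the map is a contraction, so that iterating it from the
    finite but uncontrolled Hoelder constant of the path gives the constant
    [2 C1 G] ([short_estimate]).  A unit interval contains about [G^(1/mu)]
    such steps, and adding the increments gives
    [|X_t - X_s| <= C G^(1/beta) (t - s)^beta] ([sde_path_increment]).  The
    bound for [Lambda] is the Hoelder bound of the right fractional derivative
    ([Lambda_bound]) and is linear in [G].

    Additivity.  The estimate of increments uses that
    [int_0^t f dg = int_0^s f dg + int_s^t f dg], which is not visible from the
    definition, since both fractional derivatives depend on the end points.
    For [f = 1] the integral is truncated at distance [e] from the singularity;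
    Fubini's theorem shows that it is [(g s - g t) * beta_trunc s t e] up to
    [o(1)], where [beta_trunc] is a truncated Beta integral that, up to [o(1)],
    is the same for all intervals ([gls1_add]).  For a Hoelder function [f], the
    difference of the integrals over [[s, r]] and [[s, t]] is a function of [s]
    with increments [O(|s' - s|^(1 + e))], hence is constant ([gls_add]).

    Gaussian estimate.  A weighted sum of [exp (c D^2 / E D^2)] over all dyadic
    increments [D] is integrable, so one random variable [Z] with
    [E exp (Z^2) < oo] dominates all of them, up to the logarithm of their
    index ([fBm_dyadic_control]).  Dyadic chaining transfers the bound to all
    pairs of times: almost surely
    [|B_t - B_s| <= C Z (ln (S + 2))^(1/2) (t - s)^mu] for
    [s <= t <= S], [t <= s + 1] ([fBm_path_hoelder]); the margin [mu < H]
    absorbs the logarithm of the dyadic scale.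

    With [G = C Z (ln (t2 + 2))^(1/2)], the two pathwise bounds are proportional
    to [Z^(1/beta) (ln (t2 + 2))^(1 / (2 beta))] and [Z (ln (t2 + 2))^(1/2)].
    As [gamma > 1/2], the powers of the logarithm are at most the announced
    ones, up to constants, and [zeta] and [xi] are multiples of [Z^(1/beta)] and
    [Z]. *)

(** * Integrals over open intervals *)

Section OpenIntegral.
Context {R : realType}.
Notation mu := (@lebesgue_measure R).
Implicit Types (a b c k : R) (f g : R -> R).

Definition oint (a b : R) (f : R -> R) : R := \int[mu]_(x in `]a, b[) f x.
Definition ointble (a b : R) (f : R -> R) : Prop :=
  mu.-integrable `]a, b[ (EFin \o f).

Lemma eq_oint a b f g : (forall x, a < x < b -> f x = g x) ->
  oint a b f = oint a b g.
Proof.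
by move=> fg; apply: eq_Rintegral => x; rewrite inE/= in_itv/= => /fg.
Qed.

Lemma eq_ointble a b f g : (forall x, a < x < b -> f x = g x) ->
  ointble a b f -> ointble a b g.
Proof.
move=> fg; apply: eq_integrable => // x.
by rewrite inE/= in_itv/= => /fg ->.
Qed.

Lemma ointble0 a b : ointble a b (fun=> 0).
Proof. exact: integrable0. Qed.

Lemma oint0 a b : oint a b (fun=> 0) = 0.
Proof. by rewrite /oint /Rintegral integral0. Qed.

Lemma ointbleD a b f g : ointble a b f -> ointble a b g ->
  ointble a b (fun x => f x + g x).
Proof. by move=> fi gi; exact: (integrableD _ fi gi). Qed.

Lemma ointbleN a b f : ointble a b f -> ointble a b (fun x => - f x).
Proof. by move=> fi; exact: (integrableN fi). Qed.

Lemma ointbleB a b f g : ointble a b f -> ointble a b g ->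
  ointble a b (fun x => f x - g x).
Proof. by move=> fi gi; apply: ointbleD => //; exact: ointbleN. Qed.

Lemma ointbleZ a b k f : ointble a b f -> ointble a b (fun x => k * f x).
Proof.
move=> fi; have : mu.-integrable `]a, b[ (fun x => k%:E * (EFin \o f) x)%E.
  by apply: integrableZl.
by apply: eq_integrable => // x _; rewrite /= EFinM.
Qed.

Lemma ointD a b f g : ointble a b f -> ointble a b g ->
  oint a b (fun x => f x + g x) = oint a b f + oint a b g.
Proof. by move=> fi gi; rewrite /oint RintegralD. Qed.

Lemma ointB a b f g : ointble a b f -> ointble a b g ->
  oint a b (fun x => f x - g x) = oint a b f - oint a b g.
Proof. by move=> fi gi; rewrite /oint RintegralB. Qed.

Lemma ointZ a b k f : ointble a b f ->
  oint a b (fun x => k * f x) = k * oint a b f.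
Proof. by move=> fi; rewrite /oint RintegralZl. Qed.

Lemma oint_ge0 a b f : (forall x, a < x < b -> 0 <= f x) -> 0 <= oint a b f.
Proof.
by move=> f0; apply: Rintegral_ge0 => x /=; rewrite in_itv/= => /f0.
Qed.

Lemma le_oint a b f g : ointble a b f -> ointble a b g ->
  (forall x, a < x < b -> f x <= g x) -> oint a b f <= oint a b g.
Proof.
by move=> fi gi fg; apply: le_Rintegral => // x /=.
Qed.

Lemma ointble_dom a b f g : measurable_fun setT f -> ointble a b g ->
  (forall x, a < x < b -> `|f x| <= g x) -> ointble a b f.
Proof.
move=> mf gi fg; apply: le_integrable gi => //.
  by apply/measurable_EFinP; exact: measurable_funTS.
move=> x /=; rewrite in_itv/= => xab; rewrite lee_fin.
by rewrite (le_trans (fg _ xab))// ler_norm.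
Qed.

Lemma oint_dom a b f g : measurable_fun setT f -> ointble a b g ->
  (forall x, a < x < b -> `|f x| <= g x) -> `|oint a b f| <= oint a b g.
Proof.
move=> mf gi fg; have fi := ointble_dom mf gi fg.
apply: le_trans (le_normr_Rintegral _ fi) _ => //.
by apply: le_oint => //; exact: integrable_norm.
Qed.

Lemma lebesgue_measure_oo a b :
  mu `]a, b[%classic = (if (a < b)%R then (b - a)%R%:E else 0)%E.
Proof. by rewrite lebesgue_measure_itv/= lte_fin -EFinD. Qed.

Lemma ointble_cst a b k : ointble a b (fun=> k).
Proof.
apply: measurable_bounded_integrable => //.
  apply: (@le_lt_trans _ _ (mu `]a, b[%classic)) => //.
  by rewrite lebesgue_measure_oo; case: ifP => // _; rewrite ltry.
exists `|k|; split; first exact: num_real.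
by move=> M kM x _ /=; exact: ltW.
Qed.

Lemma oint_cst a b k : a <= b -> oint a b (fun=> k) = k * (b - a).
Proof.
move=> ab; transitivity (k * fine (mu `]a, b[%classic)).
  by rewrite /oint Rintegral_cst.
rewrite lebesgue_measure_oo.
case: ltP => // ba; suff -> : a = b by rewrite subrr.
by apply/eqP; rewrite eq_le ab ba.
Qed.

Lemma ointbleS a b a' b' f : a <= a' -> b' <= b -> ointble a b f ->
  ointble a' b' f.
Proof.
move=> aa' bb'; apply: integrableS => // x /=; rewrite !in_itv/=.
by move=> /andP[ax xb]; rewrite (le_lt_trans aa' ax) (lt_le_trans xb bb').
Qed.

Lemma oint_nil a b f : b <= a -> oint a b f = 0.
Proof.
move=> ba; rewrite /oint set_itv_ge ?Rintegral_set0//.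
by rewrite -leNgt bnd_simp.
Qed.

Lemma oint_split a c b f : a <= c -> c <= b -> ointble a b f ->
  oint a b f = oint a c f + oint c b f.
Proof.
rewrite le_eqVlt => /predU1P[->|ac].
  by move=> _ _; rewrite (oint_nil _ (lexx c)) add0r.
rewrite le_eqVlt => /predU1P[->|cb].
  by move=> _; rewrite (oint_nil _ (lexx b)) addr0.
move=> fi; rewrite /oint.
have E : `]a, b[%classic = `]a, c[%classic `|` `[c, b[%classic :> set R.
  by rewrite -itv_bndbnd_setU// bnd_simp ltW.
rewrite E Rintegral_setU//.
- congr (_ + _); rewrite -Rintegral_itv_obnd_cbnd//.
  by apply: ointbleS fi => //; exact: ltW.
- by rewrite -E.
- rewrite disj_set2E; apply/eqP/seteqP; split => // x [] /=; rewrite !in_itv/=.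
  by move=> /andP[_ xc] /andP[cx _]; rewrite ltNge cx in xc.
Qed.

(** The end points are negligible, which identifies the integrals over closed
    intervals of the definitions with [oint]. *)
Lemma oint_closed a b f : ointble a b f ->
  \int[mu]_(x in `[a, b]) f x = oint a b f.
Proof.
have [ab fi|] := ltP a b; last first.
  rewrite le_eqVlt => /predU1P[->|ba] _.
    by rewrite oint_nil// set_itv1 Rintegral_set1.
  rewrite oint_nil ?ltW// set_itv_ge ?Rintegral_set0//.
  by rewrite bnd_simp -ltNge.
have mf : measurable_fun `]a, b] f.
  have -> : `]a, b]%classic = `]a, b[%classic `|` [set b] :> set R.
    by rewrite setUitv1// bnd_simp.
  apply/measurable_funU => //; split; last exact: measurable_fun_set1.
  by apply/measurable_EFinP; exact: measurable_int fi.
have fi2 : mu.-integrable `]a, b] (EFin \o f).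
  have mfE : measurable_fun `]a, b] (EFin \o f) by exact/measurable_EFinP.
  have m0 : mu [set b] = 0%E by exact: lebesgue_measure_set1.
  have [_] := @negligible_integrable _ _ _ mu `]a, b]%classic [set b] _
    (measurable_set1 b) (measurable_itv _) mfE m0; apply.
  apply: integrableS fi => //; first exact: measurableD.
  move=> x /= []; rewrite !in_itv/= => /andP[-> xb] /eqP xNb.
  by rewrite lt_neqAle xNb xb.
by rewrite -Rintegral_itv_obnd_cbnd// -Rintegral_itv_bndo_bndc.
Qed.

End OpenIntegral.

Section OpenIntegralTools.
Context {R : realType}.
Notation mu := (@lebesgue_measure R).
Implicit Types (a b c k : R) (f g F : R -> R).

(** The primitive is only assumed continuous at the end points, so that the
    integrand may be unbounded there: this is how the singular powers are
    integrated.  The nonnegative integrand makes the integrals over the exhausting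
    intervals [[a + d n, b - d n]] monotone. *)
Lemma oint_FTC a b F f : a < b -> measurable_fun setT f ->
  (forall x, a < x < b -> 0 <= f x) ->
  (forall x, a < x < b -> is_derive x 1 F (f x)) ->
  (forall x, a < x < b -> {for x, continuous f}) ->
  F x @[x --> a^'+] --> F a -> F x @[x --> b^'-] --> F b ->
  ointble a b f /\ oint a b f = F b - F a.
Proof.
move=> ab mf f0 dF cf Fa Fb.
pose d n : R := (b - a) / n.+3%:R.
have ba0 : 0 < b - a by rewrite subr_gt0.
have d0 n : 0 < d n by rewrite divr_gt0.
have dmid n : d n < (b - a) / 2.
  by rewrite ltr_pM2l// ltf_pV2 ?posrE// ltr_nat.
pose an n := a + d n; pose bn n := b - d n.
have aan n : a < an n by rewrite ltrDl.
have bbn n : bn n < b by rewrite gtrDl oppr_lt0.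
have abn n : an n < bn n by rewrite /an /bn; have := dmid n; lra.
have dcvg : d n @[n --> \oo] --> (0 : R).
  rewrite -[X in _ --> X](mulr0 (b - a)); apply: cvgMr.
  have h : ((k.+1%:R)^-1 : R) @[k --> \oo] --> (0 : R) by exact: cvg_harmonic.
  have := h; rewrite -(cvg_shiftn 2) => h2.
  by apply: cvg_trans h2; apply: near_eq_cvg; apply: nearW => n /=; rewrite addn2.
have acvg : an n @[n --> \oo] --> a.
  by rewrite -[X in _ --> X]addr0; apply: cvgD => //; exact: cvg_cst.
have bcvg : bn n @[n --> \oo] --> b.
  by rewrite -[X in _ --> X]subr0; apply: cvgB => //; exact: cvg_cst.
have Fan : F (an n) @[n --> \oo] --> F a by exact: ((cvg_at_rightP F a (F a)).1 Fa an (conj aan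
  acvg)).
have Fbn : F (bn n) @[n --> \oo] --> F b by exact: ((cvg_at_leftP F b (F b)).1 Fb bn (conj bbn
  bcvg)).
pose D n : set R := `[an n, bn n]%classic.
have DE : \bigcup_n D n = `]a, b[%classic.
  apply/seteqP; split=> [x [n _]|x] /=; rewrite /D /= !in_itv/=.
    by move=> /andP[ax xb]; rewrite (lt_le_trans (aan n) ax) (le_lt_trans xb (bbn n)).
  move=> /andP[ax xb].
  have e0 : 0 < Num.min (x - a) (b - x) by rewrite lt_min !subr_gt0 ax xb.
  have [n _ Hn] : \forall n \near \oo, `|0 - d n| < Num.min (x - a) (b - x).
    exact: (@cvgr_dist_lt _ _ _ _ _ _ _ dcvg).
  exists n => //; have := Hn n (leqnn n); rewrite sub0r normrN ger0_norm ?ltW//.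
  by rewrite lt_min /D/= in_itv/= /an /bn => /andP[h1 h2]; apply/andP; split; lra.
have dle m n : (m <= n)%N -> d n <= d m.
  by move=> mn; rewrite ler_pM2l// lef_pV2 ?posrE// ler_nat !ltnS.
have Dnd : nondecreasing_seq D.
  move=> m n mn; apply/subsetPset => x; rewrite /D /= !in_itv/= /an /bn.
  by have := dle _ _ mn => h /andP[h1 h2]; apply/andP; split; lra.
have Din n x : D n x -> a < x < b.
  rewrite /D/= in_itv/= => /andP[h1 h2].
  by rewrite (lt_le_trans (aan n) h1) (le_lt_trans h2 (bbn n)).
have dFc x : a < x < b -> {for x, continuous F}.
  by move=> xab; apply: differentiable_continuous; apply/derivable1_diffP; have [] := dF _ xab.
have anab n : a < an n < b by rewrite aan (lt_trans (abn n)).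
have bnab n : a < bn n < b by rewrite bbn (lt_trans _ (abn n)).
have DI n : (\int[mu]_(x in D n) (f x)%:E = (F (bn n))%:E - (F (an n))%:E)%E.
  apply: continuous_FTC2 => //.
  - by apply: continuous_in_subspaceT => x; rewrite inE => Dx; apply: cf; exact: Din Dx.
  - split.
    + move=> x; rewrite in_itv/= => /andP[h1 h2]; have [] // := dF x _.
      by rewrite (lt_trans (aan n) h1) (lt_trans h2 (bbn n)).
    + by apply: cvg_at_right_filter; apply: dFc.
    + by apply: cvg_at_left_filter; apply: dFc.
  - move=> x; rewrite in_itv/= => /andP[h1 h2].
    have xab : a < x < b by rewrite (lt_trans (aan n) h1) (lt_trans h2 (bbn n)).
    by rewrite derive1E; have [_ ->] := dF x xab.
have mfE A : measurable_fun A (EFin \o f).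
  by apply/measurable_EFinP; exact: measurable_funTS.
have I1 : (\int[mu]_(x in D i) (f x)%:E @[i --> \oo] --> \int[mu]_(x in `]a, b[) (f x)%:E)%E.
  rewrite -DE; apply: ge0_nondecreasing_set_cvg_integral => //.
    by move=> i; exact: measurable_itv.
    by move=> i; exact: mfE.
  by move=> i x Dx; rewrite lee_fin f0//; exact: Din Dx.
have I2 : (\int[mu]_(x in D i) (f x)%:E @[i --> \oo] --> (F b - F a)%:E)%E.
  under eq_fun do rewrite DI -EFinB.
  by apply: cvg_EFin; [exact: nearW|exact: cvgB].
have IE : (\int[mu]_(x in `]a, b[) (f x)%:E = (F b - F a)%:E)%E.
  exact: (cvg_unique _ I1 I2).
split; last by rewrite /oint /Rintegral IE.
apply/integrableP; split; first exact: mfE.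
apply: (@le_lt_trans _ _ (\int[mu]_(x in `]a, b[) (f x)%:E)%E); last first.
  by rewrite IE ltry.
rewrite le_eqVlt; apply/orP; left; apply/eqP; apply: eq_integral => x.
by rewrite inE/= in_itv/= => /f0 h; rewrite ger0_norm.
Qed.

Lemma measurable_shift c : measurable_fun setT (fun x : R => x + c).
Proof. by apply: measurable_funD. Qed.

Lemma lebesgue_measure_shift c (A : set R) : measurable A ->
  pushforward mu (fun x : measurableTypeR R => (x + c : measurableTypeR R)) A = mu A.
Proof.
move=> mA; apply/esym/lebesgue_measure_unique => //=; first exact: measurable_shift.
move=> _ _ [[x y] _ <-].
rewrite /pushforward.
have -> : (fun x => x + c) @^-1` `]x, y]%classic = `]x - c, y - c]%classic :> set R.
  by apply/seteqP; split=> z /=; rewrite !in_itv/= ltrBlDr lerBrDr.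
rewrite !lebesgue_measure_itv/= !lte_fin.
rewrite ltrD2r; case: ifP => // _; rewrite -!EFinD; congr (_%:E); ring.
Qed.

Lemma oint_shift a b c f : measurable_fun setT f ->
  ointble a b (fun x => f (x + c)) ->
  oint (a + c) (b + c) f = oint a b (fun x => f (x + c)).
Proof.
move=> mf fi.
have E : `]a, b[%classic = (fun x => x + c) @^-1` `]a + c, b + c[%classic :> set R.
  by apply/seteqP; split=> z /=; rewrite !in_itv/= !ltrD2r.
rewrite /oint /Rintegral; congr fine.
set I := `]a + c, b + c[%classic in E *.
have mI : measurable I by exact: measurable_itv.
transitivity (\int[pushforward mu (fun x : measurableTypeR R =>
  (x + c : measurableTypeR R)%R)]_(x in I) (f x)%:E)%E.
    apply: eq_measure_integral; first exact: measurable_shift.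
  by move=> mphi A mA _; apply/esym; exact: lebesgue_measure_shift.
rewrite integral_pushforward//; last 3 first.
- exact: measurable_shift.
- exact/measurable_EFinP.
- by rewrite -E.
by rewrite -E.
Qed.

End OpenIntegralTools.

Section ParametricIntegrals.
Context {R : realType}.
Notation mu := (@lebesgue_measure R).
Implicit Types (a b c k : R) (f g F : R -> R).

Lemma measurable_Rintegral_snd (F : R * R -> R) : measurable_fun setT F ->
  measurable_fun setT (fun x => \int[mu]_u F (x, u)).
Proof.
move=> mF; rewrite /Rintegral.
apply: measurableT_comp => //.
pose G (p : R * R) := (F p)%:E.
have mG : measurable_fun setT G by apply/measurable_EFinP.
have -> : (fun x : R => \int[mu]_u (F (x, u))%:E)%E =
    ((fun x : R => \int[mu]_u (G ^\+) (x, u)) \- (fun x : R => \int[mu]_u (G ^\-) (x, u)))%E.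
  apply/funext => x; rewrite [LHS]integralE.
  by congr (_ - _)%E; apply: eq_integral => u _; rewrite ?funeposE ?funenegE.
apply: emeasurable_funB.
- apply: (@measurable_fun_fubini_tonelli_F _ _ _ _ _ mu (G ^\+)%E) => //.
  exact: measurable_funepos.
- apply: (@measurable_fun_fubini_tonelli_F _ _ _ _ _ mu (G ^\-)%E) => //.
  exact: measurable_funeneg.
Qed.

(** Integrating over the whole line turns variable end points into a measurable
    condition on the integrand. *)
Lemma oint_setT a b f :
  oint a b f = \int[mu]_u (if a < u < b then f u else 0).
Proof.
rewrite /oint Rintegral_mkcond; apply: eq_Rintegral => u _.
rewrite patchE; case: ifPn; rewrite ?inE ?notin_setE/= in_itv/=.
  by move=> ->.
by move/negP/negbTE => ->.
Qed.

Lemma measurable_oint (lo hi : R -> R) (F : R * R -> R) :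
  measurable_fun setT lo -> measurable_fun setT hi -> measurable_fun setT F ->
  measurable_fun setT (fun x => oint (lo x) (hi x) (fun u => F (x, u))).
Proof.
move=> mlo mhi mF.
rewrite (_ : (fun x => _) = (fun x => \int[mu]_u
   (if (lo (x, u).1 < (x, u).2) && ((x, u).2 < hi (x, u).1) then F (x, u) else 0))); last first.
  by apply/funext => x; rewrite oint_setT.
apply: (@measurable_Rintegral_snd (fun p => if (lo p.1 < p.2) && (p.2 < hi p.1) then F p else 0)).
apply: measurable_fun_ifT => //.
by apply: measurable_and; apply: measurable_fun_ltr => //; exact: measurableT_comp.
Qed.

(** The bound by a product of two integrable functions of one variable replaces an
    integrability condition on the plane. *)
Lemma oint_fubini a b c d (K : R * R -> R) (phi psi : R -> R) :
  measurable_fun setT K -> ointble a b phi -> ointble c d psi ->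
  (forall x u, a < x < b -> c < u < d -> `|K (x, u)| <= phi x * psi u) ->
  oint a b (fun x => oint c d (fun u => K (x, u))) =
  oint c d (fun u => oint a b (fun x => K (x, u))).
Proof.
move=> mK phii psii Kle.
pose G p := if (a < p.1 < b) && (c < p.2 < d) then K p else 0.
have mG : measurable_fun setT G.
  apply: measurable_fun_ifT => //.
  apply: measurable_and; apply: measurable_and; apply: measurable_fun_ltr => //;
  (exact: measurable_cst) || (exact: measurable_fst) || (exact: measurable_snd).
have mGx x : measurable_fun setT (fun u => G (x, u)).
  exact: (measurable_fun_pair2 x mG).
have mGu u : measurable_fun setT (fun x => G (x, u)).
  exact: (measurable_fun_pair1 u mG).
pose ph (x : R) : R := if a < x < b then `|phi x| else 0.
pose ps (u : R) : R := if c < u < d then `|psi u| else 0.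
have Gle x u : `|G (x, u)| <= ph x * ps u.
  rewrite /G /ph /ps /=; case: ifP => /= [|]; rewrite ?normr0.
    move=> /andP[xab ucd]; rewrite xab ucd (le_trans (Kle _ _ xab ucd))//.
    by rewrite (le_trans (ler_norm _))// normrM.
  by move=> _; rewrite mulr_ge0//; case: ifP.
have setTi (e f : R) (h : R -> R) : ointble e f h ->
    mu.-integrable setT (fun x => (if e < x < f then `|h x| else 0)%:E).
  move=> hi.
  have : mu.-integrable `]e, f[ (EFin \o (Num.Def.normr \o h)) by exact: integrable_norm.
  move=> /(@integrable_mkcond _ _ _ mu _ _ (measurable_itv `]e, f[)).1.
  apply: eq_integrable => // x _; rewrite patchE.
  case: ifPn; rewrite ?inE ?notin_setE/= in_itv/=; first by move=> ->.
  by move/negP/negbTE => ->.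
have phT : mu.-integrable setT (EFin \o ph) by exact: setTi.
have psT : mu.-integrable setT (EFin \o ps) by exact: setTi.
have ph0 x : 0 <= ph x by rewrite /ph; case: ifP.
have ps0 x : 0 <= ps x by rewrite /ps; case: ifP.
have Gi : (mu \x mu)%E.-integrable setT (EFin \o G).
  apply/integrable12ltyP; first exact/measurable_EFinP.
  apply: (@le_lt_trans _ _ (\int[mu]_x ((ph x)%:E * (\int[mu]_u (ps u)%:E)))%E).
    apply: ge0_le_integral => //.
    - by move=> x _; exact: integral_ge0.
    - apply: (@measurable_fun_fubini_tonelli_F _ _ _ _ _ mu (fun p => `|(EFin \o G) p|%E)) => //=.
      by do 2 apply: measurableT_comp => //; exact/measurable_EFinP.
    - by apply: emeasurable_funM => //; exact: measurable_int phT.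
    - move=> x _; rewrite -ge0_integralZl//=; last 3 first.
      + exact: measurable_int psT.
      + by move=> u _; rewrite lee_fin.
      + by rewrite lee_fin.
      apply: ge0_le_integral => //.
      + by apply/measurable_EFinP; apply: measurableT_comp => //; exact: mGx.
      + by apply: emeasurable_funM => //; exact: measurable_int psT.
      + by move=> u _; rewrite -EFinM lee_fin.
  rewrite ge0_integralZr//; last 3 first.
  - exact: measurable_int phT.
  - by move=> x _; rewrite lee_fin.
  - by apply: integral_ge0 => u _; rewrite lee_fin.
  have I1 : (\int[mu]_x (ph x)%:E)%E \is a fin_num.
    by apply: integrable_fin_num => //; exact: phT.
  have I2 : (\int[mu]_x (ps x)%:E < +oo)%E.
    by apply: integrable_lty => //; exact: psT.
  apply: lte_mul_pinfty => //.
  by apply: integral_ge0 => u _; rewrite lee_fin.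
have GxI x : mu.-integrable setT (fun u => (G (x, u))%:E).
  apply: (le_integrable _ _ _ (integrableZl _ (ph x) psT)) => //.
    by apply/measurable_EFinP; exact: mGx.
  move=> u _; rewrite /= lee_fin (le_trans (Gle x u))//.
  by rewrite normrM !ger0_norm.
have GuI u : mu.-integrable setT (fun x => (G (x, u))%:E).
  apply: (le_integrable _ _ _ (integrableZr _ (ps u) phT)) => //.
    by apply/measurable_EFinP; exact: mGu.
  move=> x _; rewrite /= lee_fin (le_trans (Gle x u))//.
  by rewrite normrM !ger0_norm.
have FG := Fubini Gi; rewrite /= in FG.
transitivity (fine (\int[mu]_x \int[mu]_u (G (x, u))%:E)%E).
  rewrite oint_setT /Rintegral; congr fine; apply: eq_integral => x _.
  case: ifPn => [xab|/negbTE xab]; last first.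
    by rewrite integral0_eq// => u _; rewrite /G /= xab.
  rewrite oint_setT /Rintegral fineK.
    by apply: eq_integral => u _; rewrite /G /= xab.
  rewrite (_ : (\int[mu]_u _)%E = (\int[mu]_u (G (x, u))%:E)%E); first exact: integrable_fin_num.
  by apply: eq_integral => u _; rewrite /G /= xab.
rewrite FG [RHS]oint_setT /Rintegral; congr fine; apply: eq_integral => u _.
case: ifPn => [ucd|/negbTE ucd]; last first.
  by rewrite integral0_eq// => x _; rewrite /G /= ucd andbF.
rewrite oint_setT /Rintegral fineK.
  by apply: eq_integral => x _; rewrite /G /= ucd andbT.
rewrite (_ : (\int[mu]_x _)%E = (\int[mu]_x (G (x, u))%:E)%E); first exact: integrable_fin_num.
by apply: eq_integral => x _; rewrite /G /= ucd andbT.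
Qed.

End ParametricIntegrals.

(** * Integrals of powers *)

Section PowerIntegrals.
Context {R : realType}.
Notation mu := (@lebesgue_measure R).
Implicit Types (a b c k s t p q : R) (f g F : R -> R).

Lemma measurable_powl s p : measurable_fun setT (fun x : R => (x - s) `^ p).
Proof.
apply: (measurableT_comp (measurable_powR p)).
by apply: measurable_funB.
Qed.

Lemma measurable_powr t p : measurable_fun setT (fun x : R => (t - x) `^ p).
Proof.
apply: (measurableT_comp (measurable_powR p)).
by apply: measurable_funB.
Qed.

Lemma is_derive_powl s q x : s < x ->
  is_derive x 1 (fun y : R => (y - s) `^ q) (q * (x - s) `^ (q - 1)).
Proof.
move=> sx; have xs0 : 0 < x - s by rewrite subr_gt0.
have h1 : is_derive x 1 (fun y : R => y - s) 1.
  by apply: is_derive_eq; rewrite subr0.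
have := @is_derive1_comp _ (fun y : R => y `^ q) (fun y : R => y - s) x _ _
  (is_derive1_powR q xs0) h1.
by rewrite mulr1.
Qed.

Lemma is_derive_powr t q x : x < t ->
  is_derive x 1 (fun y : R => (t - y) `^ q) (- (q * (t - x) `^ (q - 1))).
Proof.
move=> xt; have tx0 : 0 < t - x by rewrite subr_gt0.
have h1 : is_derive x 1 (fun y : R => t - y) (-1).
  have := @is_deriveB _ _ _ (cst t) id x 1 _ _ (is_derive_cst t x 1) (is_derive_id x 1).
  by rewrite sub0r.
have := @is_derive1_comp _ (fun y : R => y `^ q) (fun y : R => t - y) x _ _
  (is_derive1_powR q tx0) h1.
by rewrite mulrN1.
Qed.

Lemma is_derive_continuous F (x l : R) : is_derive x 1 F l -> {for x, continuous F}.
Proof.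
move=> [dF _]; apply: differentiable_continuous; exact/derivable1_diffP.
Qed.

Lemma continuous_powl s q x : s < x -> {for x, continuous (fun y : R => (y - s) `^ q)}.
Proof. by move=> sx; apply: is_derive_continuous (is_derive_powl q sx). Qed.

Lemma continuous_powr t q x : x < t -> {for x, continuous (fun y : R => (t - y) `^ q)}.
Proof. by move=> sx; apply: is_derive_continuous (is_derive_powr q sx). Qed.

Lemma powl_cvg0 s q : 0 < q ->
  (x - s) `^ q @[x --> s^'+] --> ((s - s) `^ q : R).
Proof.
move=> q0; rewrite subrr powR0 ?gt_eqF//.
have := powR_cvg0 q0; move=> /cvgrPdist_lt h; apply/cvgrPdist_lt => e e0.
have [d /= d0 Hd] := h e e0.
exists d => // x /= xd sx.
have := Hd (x - s); apply => /=; last by rewrite subr_gt0.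
by rewrite sub0r opprB.
Qed.

Lemma powr_cvg0 t q : 0 < q ->
  (t - x) `^ q @[x --> t^'-] --> ((t - t) `^ q : R).
Proof.
move=> q0; rewrite subrr powR0 ?gt_eqF//.
have := powR_cvg0 q0; move=> /cvgrPdist_lt h; apply/cvgrPdist_lt => e e0.
have [d /= d0 Hd] := h e e0.
exists d => // x /= xd sx.
have := Hd (t - x); apply => /=; last by rewrite subr_gt0.
by rewrite sub0r normrN.
Qed.

Lemma oint_powl_gen s a b p : s <= a -> a <= b -> p + 1 != 0 -> (s < a) || (0 < p + 1) ->
  ointble a b (fun x => (x - s) `^ p) /\
  oint a b (fun x => (x - s) `^ p) = ((b - s) `^ (p + 1) - (a - s) `^ (p + 1)) / (p + 1).
Proof.
move=> sa; rewrite le_eqVlt => /predU1P[<-{b}|ab] p0 sap.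
  rewrite subrr mul0r oint_nil//; split => //.
  by apply: eq_ointble (ointble0 _ _) => x /andP[/lt_trans h /h]; rewrite ltxx.
pose F x : R := (p + 1)^-1 * (x - s) `^ (p + 1).
have dF x : s < x -> is_derive x 1 F ((x - s) `^ p).
  move=> sx; have := is_derive_powl (p + 1) sx; rewrite addrK => h.
  have := @is_deriveZ _ _ _ _ (p + 1)^-1 _ _ _ h.
  by rewrite /GRing.scale /= mulKf.
have Sa x : a < x < b -> s < x by move=> /andP[+ _]; apply: le_lt_trans.
have [] // := @oint_FTC R a b F (fun x => (x - s) `^ p).
- exact: measurable_powl.
- by move=> x _; exact: powR_ge0.
- by move=> x /Sa; exact: dF.
- by move=> x /Sa; exact: continuous_powl.
- case/orP : sap => [sa'|p1].
    by apply: cvg_at_right_filter; apply: is_derive_continuous (dF _ sa').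
  move: sa; rewrite le_eqVlt => /predU1P[<-|sa'].
    by apply: cvgMr; exact: powl_cvg0.
  by apply: cvg_at_right_filter; apply: is_derive_continuous (dF _ sa').
- have sb : s < b by rewrite (le_lt_trans sa).
  by apply: cvg_at_left_filter; apply: is_derive_continuous (dF _ sb).
- by move=> fi ->; split => //; rewrite /F; field.
Qed.

Lemma oint_powr_gen t a b p : b <= t -> a <= b -> p + 1 != 0 -> (b < t) || (0 < p + 1) ->
  ointble a b (fun x => (t - x) `^ p) /\
  oint a b (fun x => (t - x) `^ p) = ((t - a) `^ (p + 1) - (t - b) `^ (p + 1)) / (p + 1).
Proof.
move=> bt; rewrite le_eqVlt => /predU1P[<-{b bt}|ab] p0 sap.
  rewrite subrr mul0r oint_nil//; split => //.
  by apply: eq_ointble (ointble0 _ _) => x /andP[/lt_trans h /h]; rewrite ltxx.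
pose F x : R := - (p + 1)^-1 * (t - x) `^ (p + 1).
have dF x : x < t -> is_derive x 1 F ((t - x) `^ p).
  move=> sx; have := is_derive_powr (p + 1) sx; rewrite addrK => h.
  have := @is_deriveZ _ _ _ _ (- (p + 1)^-1) _ _ _ h.
  by rewrite /GRing.scale /= mulrNN mulKf.
have Sa x : a < x < b -> x < t by move=> /andP[_] /lt_le_trans; apply.
have [] // := @oint_FTC R a b F (fun x => (t - x) `^ p).
- exact: measurable_powr.
- by move=> x _; exact: powR_ge0.
- by move=> x /Sa; exact: dF.
- by move=> x /Sa; exact: continuous_powr.
- have sb : a < t by rewrite (lt_le_trans ab).
  by apply: cvg_at_right_filter; apply: is_derive_continuous (dF _ sb).
- case/orP : sap => [sa'|p1].
    by apply: cvg_at_left_filter; apply: is_derive_continuous (dF _ sa').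
  move: bt; rewrite le_eqVlt => /predU1P[->|sa'].
    by apply: cvgMr; exact: powr_cvg0.
  by apply: cvg_at_left_filter; apply: is_derive_continuous (dF _ sa').
- by move=> fi ->; split => //; rewrite /F; field.
Qed.

Lemma oint_powl s t p : s <= t -> -1 < p ->
  ointble s t (fun x => (x - s) `^ p) /\
  oint s t (fun x => (x - s) `^ p) = (t - s) `^ (p + 1) / (p + 1).
Proof.
move=> st p1; have p0 : 0 < p + 1 by lra.
have [] // := @oint_powl_gen s s t p.
- by rewrite gt_eqF.
- by rewrite p0 orbT.
by move=> fi ->; split => //; rewrite subrr [0 `^ _]powR0 ?gt_eqF// subr0.
Qed.

Lemma oint_powr s t p : s <= t -> -1 < p ->
  ointble s t (fun x => (t - x) `^ p) /\
  oint s t (fun x => (t - x) `^ p) = (t - s) `^ (p + 1) / (p + 1).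
Proof.
move=> st p1; have p0 : 0 < p + 1 by lra.
have [] // := @oint_powr_gen t s t p.
- by rewrite gt_eqF.
- by rewrite p0 orbT.
by move=> fi ->; split => //; rewrite subrr [0 `^ _]powR0 ?gt_eqF// subr0.
Qed.

(** The integrand has an elementary primitive, because the exponents [- al] and
    [al - 2] add up to [-2]: it is a multiple of
    [((x - s) / (u - x))^(1 - al)]. *)
Lemma oint_kernel al s u e : 0 < al < 1 -> 0 < e -> s + e < u ->
  ointble s (u - e) (fun x => (x - s) `^ (- al) * (u - x) `^ (al - 2)) /\
  (1 - al) * oint s (u - e) (fun x => (x - s) `^ (- al) * (u - x) `^ (al - 2)) =
  (u - e - s) `^ (1 - al) * e `^ (al - 1) / (u - s).
Proof.
move=> /andP[al0 al1] e0 seu.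
have us : u - s != 0 by rewrite subr_eq0 gt_eqF//; lra.
have al1' : 1 - al != 0 by rewrite subr_eq0 gt_eqF.
pose F x : R := ((1 - al) * (u - s))^-1 * ((x - s) `^ (1 - al) * (u - x) `^ (al - 1)).
have dF x : s < x < u -> is_derive x 1 F ((x - s) `^ (- al) * (u - x) `^ (al - 2)).
  move=> /andP[sx xu].
  have h1 := is_derive_powl (1 - al) sx; have h2 := is_derive_powr (al - 1) xu.
  have h3 := @is_deriveM _ _ _ _ _ _ _ _ h1 h2.
  have := @is_deriveZ _ _ _ _ ((1 - al) * (u - s))^-1 _ _ _ h3.
  move=> h; apply: (is_derive_eq h); rewrite /GRing.scale /=.
  rewrite (_ : 1 - al - 1 = - al); last by ring.
  rewrite (_ : al - 1 - 1 = al - 2); last by ring.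
  have -> : (x - s) `^ (1 - al) = (x - s) * (x - s) `^ (- al).
    by rewrite powRD ?powRr1 ?subr_ge0 ?ltW//; apply/implyP => _; rewrite subr_eq0 gt_eqF.
  have -> : (u - x) `^ (al - 1) = (u - x) * (u - x) `^ (al - 2).
    rewrite (_ : al - 1 = 1 + (al - 2)); last by ring.
    by rewrite powRD ?powRr1 ?subr_ge0 ?ltW//; apply/implyP => _; rewrite subr_eq0 gt_eqF.
  by field; rewrite us al1'.
have Sa x : s < x < u - e -> s < x < u by move=> /andP[-> h] /=; lra.
have [] // := @oint_FTC R s (u - e) F (fun x => (x - s) `^ (- al) * (u - x) `^ (al - 2)).
- lra.
- by apply: measurable_funM; [exact: measurable_powl|exact: measurable_powr].
- by move=> x _; rewrite mulr_ge0 ?powR_ge0.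
- by move=> x /Sa; exact: dF.
- move=> x /Sa /andP[sx xu]; apply: cvgM; first exact: continuous_powl.
  exact: continuous_powr.
- apply: cvgMr; apply: cvgM; first by apply: powl_cvg0; lra.
  by apply: cvg_at_right_filter; apply: continuous_powr; lra.
- have sb : s < u - e < u by lra.
  by apply: cvg_at_left_filter; apply: is_derive_continuous (dF _ sb).
move=> fi ->; split => //; rewrite /F subrr [0 `^ _]powR0// mul0r mulr0 subr0.
rewrite (_ : u - (u - e) = e); last by ring.
by field; rewrite us al1'.
Qed.

End PowerIntegrals.

(** * Hoelder functions and their fractional derivatives *)

Section Hoelder.
Context {R : realType}.
Implicit Types (a b c k s t x y p q M lam : R) (f g F : R -> R).

Lemma powRDp x p q : 0 < x -> x `^ (p + q) = x `^ p * x `^ q.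
Proof. by move=> x0; rewrite powRD//; apply/implyP => _; rewrite gt_eqF. Qed.

Lemma powR_le x y p : 0 <= x -> x <= y -> 0 <= p -> x `^ p <= y `^ p.
Proof.
by move=> x0 xy p0; apply: ge0_ler_powR; rewrite ?nnegrE// (le_trans x0).
Qed.

Lemma powRN_ge x y p : 0 < x -> x <= y -> 0 <= p -> y `^ (- p) <= x `^ (- p).
Proof.
move=> x0 xy p0; rewrite !powRN lef_pV2 ?posrE ?powR_gt0 ?(lt_le_trans x0 xy)//.
by rewrite powR_le// ltW.
Qed.

Lemma powR2N_itv mu : 0 < mu -> 0 <= (2 : R) `^ (- mu) < 1.
Proof.
move=> mu0; rewrite powR_ge0 /= powRN invf_lt1 ?powR_gt0//.
rewrite -[ltLHS](powRr0 2) /powR gt_eqF// ltr_expR ltr_pM2r// ln_gt0//.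
by rewrite ltr1n.
Qed.

(** Error terms of iterations and of dyadic approximations are removed by this
    passage to the limit. *)
Lemma le_of_geometric (A b0 D r : R) : 0 <= r -> r < 1 ->
  (forall n, A <= b0 + D * r ^+ n) -> A <= b0.
Proof.
move=> r0 r1 H.
have cv : (fun n => b0 + D * r ^+ n) @ \oo --> (b0 + D * 0 : R).
  apply: cvgD; first exact: cvg_cst.
  by apply: cvgMr; apply: cvg_expr; rewrite ger0_norm.
rewrite mulr0 addr0 in cv.
rewrite -(cvg_lim (@Rhausdorff R) cv).
by apply: limr_ge; [apply/cvg_ex; exists b0|exact: nearW].
Qed.

Definition is_hoelder M lam f := forall x y, `|f x - f y| <= M * `|x - y| `^ lam.

Lemma hoelder_ge0 M lam f : is_hoelder M lam f -> 0 <= M.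
Proof.
by move=> /(_ 1 0); rewrite subr0 normr1 powR1 mulr1; exact: le_trans.
Qed.

Lemma hoelder_continuous M lam f : 0 < lam -> is_hoelder M lam f -> continuous f.
Proof.
move=> lam0 fM x; apply/cvgrPdist_lt => e e0.
have M0 := hoelder_ge0 fM.
pose N := M + 1; have N0 : 0 < N by rewrite ltr_wpDl.
pose de := (e / N) `^ lam^-1.
have de0 : 0 < de by rewrite powR_gt0// divr_gt0.
exists de => // y /= xy.
apply: (le_lt_trans (fM x y)).
apply: (@le_lt_trans _ _ (M * (e / N))); last first.
  by rewrite mulrA ltr_pdivrMr// mulrC ltr_pM2l// /N ltrDl.
rewrite ler_wpM2l//.
have -> : e / N = de `^ lam.
  by rewrite /de -powRrM mulVf ?gt_eqF// powRr1// divr_ge0// ltW.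
by rewrite powR_le// ltW.
Qed.

Lemma measurable_hoelder M lam f : 0 < lam -> is_hoelder M lam f -> measurable_fun setT f.
Proof.
by move=> lam0 /(hoelder_continuous lam0); exact: continuous_measurable_fun.
Qed.

Lemma hoelder_le M lam f x y : is_hoelder M lam f -> x <= y -> `|f x - f y| <= M * (y - x) `^ lam.
Proof. by move=> /(_ x y) + xy; rewrite (distrC x) [`|y - x|]ger0_norm// subr_ge0. Qed.

Lemma hoelderBcst M lam f c : is_hoelder M lam f -> is_hoelder M lam (fun x => f x - c).
Proof. by move=> fM x y; rewrite opprB addrA subrK. Qed.

End Hoelder.

Section FracDerivatives.
Context {R : realType}.
Implicit Types (a b c k s t x y p q M lam : R) (f g F : R -> R).
Variable al : R.
Hypothesis al01 : 0 < al < 1.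

Let al0 : 0 < al. Proof. by case/andP : al01. Qed.
Let al1 : al < 1. Proof. by case/andP : al01. Qed.

(** The left fractional derivative of order [al], without the factor
    [1 / Gamma (1 - al)]. *)
Definition dleft s f x :=
  f x / (x - s) `^ al + al * oint s x (fun u => (f x - f u) / (x - u) `^ (1 + al)).

(** The right fractional derivative of order [1 - al] of [g - g t], without the
    factor [exp (- i pi al) / Gamma al]. *)
Definition dright t g x :=
  (g x - g t) / (t - x) `^ (1 - al) +
  (1 - al) * oint x t (fun u => (g x - g u) / (u - x) `^ (2 - al)).

(** The generalized integral up to the constant factor [gls_const]; the phases
    cancel, so that it is real. *)
Definition gls s t f g := oint s t (fun x => dleft s f x * dright t g x).

Lemma measurable_pow_fst_snd p : measurable_fun setT (fun z : R * R => (z.1 - z.2) `^ p).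
Proof.
apply: (measurableT_comp (measurable_powR p)).
by apply: measurable_funB.
Qed.

Lemma measurable_pow_snd_fst p : measurable_fun setT (fun z : R * R => (z.2 - z.1) `^ p).
Proof.
apply: (measurableT_comp (measurable_powR p)).
by apply: measurable_funB.
Qed.

Lemma measurable_dleft s f : measurable_fun setT f -> measurable_fun setT (dleft s f).
Proof.
move=> mf; apply: measurable_funD.
  rewrite (_ : (fun x => _) = (fun x => f x * (x - s) `^ (- al))); last first.
    by apply/funext => x; rewrite powRN.
  by apply: measurable_funM => //; exact: measurable_powl.
apply: measurable_funM => //.
apply: (@measurable_oint _ (fun=> s) id (fun z => (f z.1 - f z.2) / (z.1 - z.2) `^ (1 + al))) =>
  //.
rewrite (_ : (fun z : R * R => _) = (fun z => (f z.1 - f z.2) * (z.1 - z.2) `^ (- (1 + al))));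
  last first.
  by apply/funext => x; rewrite powRN.
apply: measurable_funM => //; last exact: measurable_pow_fst_snd.
by apply: measurable_funB; exact: measurableT_comp.
Qed.

Lemma measurable_dright t g : measurable_fun setT g -> measurable_fun setT (dright t g).
Proof.
move=> mf; apply: measurable_funD.
  rewrite (_ : (fun x => _) = (fun x => (g x - g t) * (t - x) `^ (- (1 - al)))); last first.
    by apply/funext => x; rewrite powRN.
  by apply: measurable_funM => //; [exact: measurable_funB|exact: measurable_powr].
apply: measurable_funM => //.
apply: (@measurable_oint _ id (fun=> t) (fun z => (g z.1 - g z.2) / (z.2 - z.1) `^ (2 - al))) =>
  //.
rewrite (_ : (fun z : R * R => _) = (fun z => (g z.1 - g z.2) * (z.2 - z.1) `^ (- (2 - al))));
  last first.
  by apply/funext => x; rewrite powRN.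
apply: measurable_funM => //; last exact: measurable_pow_snd_fst.
by apply: measurable_funB; exact: measurableT_comp.
Qed.

Section LeftHoelder.
Variables (M lam : R) (f : R -> R).
Hypotheses (al_lam : al < lam) (fM : is_hoelder M lam f).
Let mf : measurable_fun setT f.
Proof. by apply: (@measurable_hoelder _ M lam) => //; exact: lt_trans al_lam. Qed.
Let M0 : 0 <= M. Proof. exact: hoelder_ge0 fM. Qed.

(** By the Hoelder bound the integrand is at most [M (x - u)^(lam - al - 1)],
    whose exponent exceeds [-1] because [al < lam]. *)
Lemma inner_left s x : s <= x ->
  ointble s x (fun u => (f x - f u) / (x - u) `^ (1 + al)) /\
  `|oint s x (fun u => (f x - f u) / (x - u) `^ (1 + al))| <=
    M * ((x - s) `^ (lam - al) / (lam - al)).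
Proof.
move=> sx.
have p1 : -1 < lam - al - 1 by move: al_lam; lra.
have [i1 E1] := oint_powr sx p1.
have mk : measurable_fun setT (fun u => (f x - f u) / (x - u) `^ (1 + al)).
  rewrite (_ : (fun x => _) = (fun u => (f x - f u) * (x - u) `^ (- (1 + al)))); last first.
    by apply/funext => u; rewrite powRN.
  apply: measurable_funM => //; last exact: measurable_powr.
  by apply: measurable_funB.
have i2 := ointbleZ M i1.
have le u : s < u < x -> `|(f x - f u) / (x - u) `^ (1 + al)| <= M * (x - u) `^ (lam - al - 1).
  move=> /andP[su ux]; have xu0 : 0 < x - u by rewrite subr_gt0.
  rewrite normrM normfV (ger0_norm (powR_ge0 _ _)) ler_pdivrMr ?powR_gt0//.
  rewrite -mulrA -powRDp// (_ : lam - al - 1 + (1 + al) = lam); last by ring.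
  by rewrite distrC; apply: hoelder_le => //; exact: ltW.
split; first exact: ointble_dom mk i2 le.
apply: le_trans (oint_dom mk i2 le) _; rewrite ointZ// E1.
by rewrite (_ : lam - al - 1 + 1 = lam - al)//; ring.
Qed.

Lemma dleftB c s x : dleft s (fun y => f y - c) x = dleft s f x - c * (x - s) `^ (- al).
Proof.
rewrite /dleft mulrBl powRN [in RHS]addrAC; congr (_ + al * _).
by apply: eq_oint => u _; rewrite opprB addrA subrK.
Qed.

Lemma dleft_bound s x : s < x ->
  `|dleft s f x| <= `|f x| * (x - s) `^ (- al) + M * (al / (lam - al)) * (x - s) `^ (lam - al).
Proof.
move=> sx; have [_ le] := inner_left (ltW sx).
apply: le_trans (ler_normD _ _) _; apply: lerD.
  by rewrite normrM powRN normfV (ger0_norm (powR_ge0 _ _)).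
rewrite normrM gtr0_norm//.
apply: le_trans (ler_wpM2l (ltW al0) le) _.
by rewrite le_eqVlt; apply/orP; left; apply/eqP; ring.
Qed.

(** If [f] vanishes at [s], the boundary term of the derivative is not singular. *)
Lemma dleft_bound0 s x : f s = 0 -> s < x ->
  `|dleft s f x| <= M * (1 + al / (lam - al)) * (x - s) `^ (lam - al).
Proof.
move=> fs0 sx; apply: le_trans (dleft_bound sx) _.
rewrite mulrDr mulr1 mulrDl lerD2r.
rewrite (@powRDp _ (x - s) lam) ?subr_gt0// mulrA ler_wpM2r ?powR_ge0//.
have := hoelder_le fM (ltW sx); by rewrite fs0 sub0r normrN.
Qed.

End LeftHoelder.

Section RightHoelder.
Variables (G m : R) (g : R -> R).
Hypotheses (al_m : 1 - al < m) (gG : is_hoelder G m g).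
Let m0 : 0 < m. Proof. by move: al_m al1; lra. Qed.
Let mg : measurable_fun setT g.
Proof. exact: (@measurable_hoelder _ G m). Qed.
Let G0 : 0 <= G. Proof. exact: hoelder_ge0 gG. Qed.

Lemma measurable_inner_right x :
  measurable_fun setT (fun u => (g x - g u) / (u - x) `^ (2 - al)).
Proof.
rewrite (_ : (fun x => _) = (fun u => (g x - g u) * (u - x) `^ (- (2 - al)))); last first.
  by apply/funext => u; rewrite powRN.
apply: measurable_funM => //; last exact: measurable_powl.
by apply: measurable_funB.
Qed.

(** Same mechanism as [inner_left], for the order [1 - al] and [1 - al < m]. *)
Lemma inner_right x t : x <= t ->
  ointble x t (fun u => (g x - g u) / (u - x) `^ (2 - al)) /\
  `|oint x t (fun u => (g x - g u) / (u - x) `^ (2 - al))| <=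
     G * ((t - x) `^ (m + al - 1) / (m + al - 1)).
Proof.
move=> sx.
have p1 : -1 < m + al - 2 by move: al_m; lra.
have [i1 E1] := oint_powl sx p1.
have mk := measurable_inner_right x.
have i2 := ointbleZ G i1.
have le u : x < u < t -> `|(g x - g u) / (u - x) `^ (2 - al)| <= G * (u - x) `^ (m + al - 2).
  move=> /andP[xu ut]; have xu0 : 0 < u - x by rewrite subr_gt0.
  rewrite normrM normfV (ger0_norm (powR_ge0 _ _)) ler_pdivrMr ?powR_gt0//.
  rewrite -mulrA -powRDp// (_ : m + al - 2 + (2 - al) = m); last by ring.
  by apply: hoelder_le => //; exact: ltW.
split; first exact: ointble_dom mk i2 le.
apply: le_trans (oint_dom mk i2 le) _; rewrite ointZ// E1.
by rewrite (_ : m + al - 2 + 1 = m + al - 1)//; ring.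
Qed.

Definition right_cst : R := 1 + (1 - al) / (m + al - 1).

Lemma right_cst_ge0 : 0 <= right_cst.
Proof. by rewrite addr_ge0// divr_ge0//; move: al_m al1; lra. Qed.

Lemma dright_bound t x : x < t ->
  `|dright t g x| <= G * right_cst * (t - x) `^ (m + al - 1).
Proof.
move=> xt; have [_ le] := inner_right (ltW xt).
rewrite mulrDr mulr1 mulrDl.
apply: le_trans (ler_normD _ _) _; apply: lerD.
  rewrite normrM normfV (ger0_norm (powR_ge0 _ _)) ler_pdivrMr ?powR_gt0 ?subr_gt0//.
  rewrite -mulrA -powRDp ?subr_gt0// (_ : m + al - 1 + (1 - al) = m); last by ring.
  by apply: hoelder_le => //; exact: ltW.
have al1' : 0 <= 1 - al by rewrite subr_ge0 ltW.
rewrite normrM (ger0_norm al1').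
apply: le_trans (ler_wpM2l al1' le) _.
by rewrite le_eqVlt; apply/orP; left; apply/eqP; ring.
Qed.

Lemma dright_bound_unif s t x : s <= x -> x < t ->
  `|dright t g x| <= G * right_cst * (t - s) `^ (m + al - 1).
Proof.
move=> sx xt; apply: le_trans (dright_bound xt) _.
rewrite ler_wpM2l ?mulr_ge0 ?right_cst_ge0// powR_le//; first by rewrite subr_ge0 ltW.
  by rewrite lerB.
by move: al_m; lra.
Qed.

End RightHoelder.

Lemma eq_dleft s x f f1 : s <= x -> (forall y, s <= y <= x -> f y = f1 y) ->
  dleft s f x = dleft s f1 x.
Proof.
move=> sx ff; rewrite /dleft ff ?sx ?lexx//; congr (_ + al * _).
by apply: eq_oint => u /andP[su ux]; rewrite ff ?(ltW su) ?ltW.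
Qed.

Lemma eq_dright t x g g1 : x <= t -> (forall y, x <= y <= t -> g y = g1 y) ->
  dright t g x = dright t g1 x.
Proof.
move=> xt gg; rewrite /dright !gg ?xt ?lexx//; congr (_ + _ * _).
by apply: eq_oint => u /andP[xu ut]; rewrite !gg ?(ltW xu) ?xt ?lexx ?ltW.
Qed.

Lemma eq_gls s t f f1 g g1 : (forall y, s <= y <= t -> f y = f1 y) ->
  (forall y, s <= y <= t -> g y = g1 y) -> gls s t f g = gls s t f1 g1.
Proof.
move=> ff gg; apply: eq_oint => x /andP[sx xt]; congr (_ * _).
  apply: eq_dleft (ltW sx) _ => y /andP[sy yx].
  by rewrite ff// sy (le_trans yx)// ltW.
apply: eq_dright (ltW xt) _ => y /andP[sy yx].
by rewrite gg// yx (le_trans (ltW sx)).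
Qed.

End FracDerivatives.

(** * The generalized integral of a Hoelder function *)

Section GlsIncrement.
Context {R : realType}.
Implicit Types (a b c k s t x y p q M lam : R) (f g F : R -> R).
Variable al : R.
Hypothesis al01 : 0 < al < 1.
Let al0 : 0 < al. Proof. by case/andP : al01. Qed.
Let al1 : al < 1. Proof. by case/andP : al01. Qed.

Lemma dleft_cst s c x : dleft al s (fun=> c) x = c * (x - s) `^ (- al).
Proof.
rewrite /dleft powRN (_ : oint _ _ _ = 0) ?mulr0 ?addr0//.
rewrite -[RHS](@oint0 _ s x); apply: eq_oint => u _.
by rewrite subrr mul0r.
Qed.

(** Moving the base point from [s] to [s'] only removes the integral of
    [f u / (x - u)^(1 + al)] over [[s, s']], where [|f u| <= M (s' - s)^lam]. *)
Lemma dleft_diff M lam f s s' x : al < lam -> is_hoelder M lam f -> f s = 0 ->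
  s < s' -> s' < x ->
  `|dleft al s f x - dleft al s' f x| <=
  M * (s' - s) `^ lam * ((x - s') `^ (- al) - (x - s) `^ (- al)).
Proof.
move=> al_lam fM fs0 ss' s'x; have M0 := hoelder_ge0 fM.
have lam0 : 0 < lam by exact: lt_trans al_lam.
have mf := measurable_hoelder lam0 fM.
have sx : s < x by exact: lt_trans s'x.
pose k u := (f x - f u) / (x - u) `^ (1 + al).
have [ki _] := inner_left al01 al_lam fM (ltW sx).
have al1n : - (1 + al) + 1 != 0 by rewrite (_ : _ + _ = - al) ?oppr_eq0 ?gt_eqF//; ring.
have [I1 I1E] := oint_powr_gen (ltW s'x) (ltW ss') al1n (introT orP (or_introl s'x)).
have mh : measurable_fun setT (fun u => f u * (x - u) `^ (- (1 + al))).
  by apply: measurable_funM => //; exact: measurable_powr.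
have h0 u : s < u < s' -> `|f u * (x - u) `^ (- (1 + al))| <=
    M * (s' - s) `^ lam * (x - u) `^ (- (1 + al)).
  move=> /andP[su us']; rewrite normrM (ger0_norm (powR_ge0 _ _)) ler_wpM2r ?powR_ge0//.
  have := hoelder_le fM (ltW su); rewrite fs0 sub0r normrN => /le_trans; apply.
  by rewrite ler_wpM2l// powR_le ?subr_ge0 ?ltW// ltrD2r.
have gi := ointbleZ (M * (s' - s) `^ lam) I1.
have hi := ointble_dom mh gi h0.
have hle := oint_dom mh gi h0.
rewrite ointZ// in hle.
have kE : oint s s' k = f x * oint s s' (fun u => (x - u) `^ (- (1 + al))) -
    oint s s' (fun u => f u * (x - u) `^ (- (1 + al))).
  rewrite -ointZ// -ointB//; last exact: ointbleZ.
  by apply: eq_oint => u _; rewrite /k -powRN; ring.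
have E : dleft al s f x - dleft al s' f x =
    - (al * oint s s' (fun u => f u * (x - u) `^ (- (1 + al)))).
  rewrite /dleft (oint_split (ltW ss') (ltW s'x) ki) -/k kE I1E -!powRN.
  rewrite (_ : - (1 + al) + 1 = - al); last by ring.
  by field; rewrite gt_eqF.
rewrite E normrN normrM gtr0_norm//.
apply: le_trans (ler_wpM2l (ltW al0) hle) _.
rewrite I1E (_ : - (1 + al) + 1 = - al); last by ring.
by rewrite le_eqVlt; apply/orP; left; apply/eqP; field; rewrite gt_eqF.
Qed.

Variables (G m : R) (g : R -> R).
Hypotheses (al_m : 1 - al < m) (gG : is_hoelder G m g).
Let m0 : 0 < m. Proof. by move: al_m al1; lra. Qed.
Let mg : measurable_fun setT g.
Proof. exact: (@measurable_hoelder _ G m). Qed.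
Let G0 : 0 <= G. Proof. exact: hoelder_ge0 gG. Qed.

Definition dright_sup s t : R := G * right_cst al m * (t - s) `^ (m + al - 1).

Lemma dright_sup_ge0 s t : 0 <= dright_sup s t.
Proof. by rewrite !mulr_ge0 ?powR_ge0 ?right_cst_ge0. Qed.

(** Every estimate of the generalized integral bounds the right derivative by its
    supremum; the remaining integral contains the left derivative only. *)
Lemma oint_mul_dright s0 s s' t (phi psi : R -> R) : s0 <= s -> s' <= t ->
  measurable_fun setT phi -> ointble s s' psi ->
  (forall x, s < x < s' -> `|phi x| <= psi x) ->
  ointble s s' (fun x => phi x * dright al t g x) /\
  `|oint s s' (fun x => phi x * dright al t g x)| <= dright_sup s0 t * oint s s' psi.
Proof.
move=> s0s s't mphi psii le.
have mh : measurable_fun setT (fun x => phi x * dright al t g x).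
  by apply: measurable_funM => //; exact: measurable_dright.
have h0 x : s < x < s' -> `|phi x * dright al t g x| <= dright_sup s0 t * psi x.
  move=> sxs; have := le x sxs; move: sxs => /andP[sx xs'] lex.
  rewrite normrM mulrC ler_pM//.
  by apply: (dright_bound_unif al01 al_m gG); [rewrite ltW// (le_lt_trans s0s)|exact:
    lt_le_trans s't].
have gi := ointbleZ (dright_sup s0 t) psii.
split; first exact: ointble_dom mh gi h0.
by apply: le_trans (oint_dom mh gi h0) _; rewrite ointZ.
Qed.

(** The integral of the constant 1, a constant multiple of [g t - g s];
    [gls1_add] expresses this without the value of the constant. *)
Definition gls1 s t := gls al s t (fun=> 1) g.

Lemma gls1E s t : gls1 s t = oint s t (fun x => (x - s) `^ (- al) * dright al t g x).
Proof. by apply: eq_oint => x _; rewrite dleft_cst mul1r. Qed.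

Lemma gls1_bound s t : s <= t ->
  ointble s t (fun x => (x - s) `^ (- al) * dright al t g x) /\
  `|gls1 s t| <= dright_sup s t * ((t - s) `^ (1 - al) / (1 - al)).
Proof.
move=> st; have p1 : -1 < - al by rewrite ltrN2.
have [I1 I1E] := oint_powl st p1.
have h0 x : s < x < t -> `|(x - s) `^ (- al)| <= (x - s) `^ (- al).
  by rewrite ger0_norm ?powR_ge0.
have [i le] := oint_mul_dright (lexx s) (lexx t) (measurable_powl s (- al)) I1 h0.
by split => //; rewrite gls1E; move: le; rewrite I1E (addrC (- al)).
Qed.

Section Integrand.
Variables (M lam : R) (f : R -> R).
Hypotheses (al_lam : al < lam) (fM : is_hoelder M lam f).
Let lam0 : 0 < lam. Proof. exact: lt_trans al_lam. Qed.
Let mf : measurable_fun setT f. Proof. exact: measurable_hoelder fM. Qed.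
Let M0 : 0 <= M. Proof. exact: hoelder_ge0 fM. Qed.

Definition left_cst : R := 1 + al / (lam - al).

Lemma left_cst_ge0 : 0 <= left_cst.
Proof. by rewrite addr_ge0// divr_ge0// ?subr_ge0 ltW. Qed.

(** The integrand [f - c] vanishes at the lower end point, whence the additional
    power of the length. *)
Lemma gls_vanish_bound s0 s s' t c : s0 <= s -> s <= s' -> s' <= t -> f s = c ->
  ointble s s' (fun x => dleft al s (fun y => f y - c) x * dright al t g x) /\
  `|oint s s' (fun x => dleft al s (fun y => f y - c) x * dright al t g x)| <=
   dright_sup s0 t * (M * left_cst * ((s' - s) `^ (lam - al + 1) / (lam - al + 1))).
Proof.
move=> s0s ss' s't fsc.
have p1 : -1 < lam - al by move: al_lam; lra.
have [I1 I1E] := oint_powl ss' p1.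
rewrite -I1E -ointZ//; apply: oint_mul_dright => //.
- by apply: measurable_dleft; exact: measurable_funB.
- exact: ointbleZ.
- move=> x /andP[sx xs']; apply: (dleft_bound0 al01 al_lam) => //.
    exact: hoelderBcst.
  by rewrite fsc subrr.
Qed.

Lemma ointble_gls s t c : s <= t ->
  ointble s t (fun x => dleft al s (fun y => f y - c) x * dright al t g x).
Proof.
move=> st; have [i1 _] := gls_vanish_bound (lexx s) st (lexx t) erefl.
have [i2 _] := gls1_bound st.
have := ointbleD i1 (ointbleZ (f s - c) i2); apply: eq_ointble => x _.
rewrite mulrA -mulrDl; congr (_ * _).
by rewrite !dleftB; ring.
Qed.

(** Subtracting from [f] its value at [s] leaves an integrand to which
    [gls_vanish_bound] applies. *)
Lemma gls_cst s t c : s <= t -> gls al s t f g = c * gls1 s t + gls al s t (fun y => f y - c) g.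
Proof.
move=> st; have i1 := ointble_gls c st; have [i2 _] := gls1_bound st.
rewrite gls1E -ointZ// /gls -ointD//; last exact: ointbleZ.
by apply: eq_oint => x _; rewrite dleftB; ring.
Qed.

Lemma gls_bound s t : s <= t ->
  `|gls al s t f g| <= dright_sup s t * (`|f s| * ((t - s) `^ (1 - al) / (1 - al)) +
       M * left_cst * ((t - s) `^ (lam - al + 1) / (lam - al + 1))).
Proof.
move=> st; rewrite (gls_cst (f s) st).
have [_ h1] := gls_vanish_bound (lexx s) st (lexx t) erefl.
have [_ h2] := gls1_bound st.
apply: le_trans (ler_normD _ _) _; rewrite mulrDr; apply: lerD => //.
by rewrite normrM mulrCA ler_wpM2l.
Qed.

Definition step_cst : R := M * (left_cst / (lam - al + 1) + (1 - al)^-1).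

(** Changing the lower end point from [s] to [s'] has the same effect on the
    integral of [f] as on that of the constant [f s], up to an error whose exponent
    [lam - al + 1] exceeds 1.  Both the piece [[s, s']] and the change of the left
    derivative on [[s', t]] are of that size. *)
Lemma gls_step s s' t : s < s' -> s' <= t ->
  `|gls al s t f g - gls al s' t f g - f s * (gls1 s t - gls1 s' t)| <=
  dright_sup s t * (step_cst * (s' - s) `^ (lam - al + 1)).
Proof.
move=> ss' s't; have st : s <= t by exact: le_trans (ltW ss') s't.
pose r y := f y - f s.
have rM : is_hoelder M lam r by exact: hoelderBcst.
have rs0 : r s = 0 by rewrite /r subrr.
rewrite (gls_cst (f s) st) (gls_cst (f s) s't) -/r.
have i1 := ointble_gls (f s) st; have i2 := ointble_gls (f s) s't.
rewrite -/r in i1 i2.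
have i1' := ointbleS (ltW ss') (lexx t) i1.
have E (x1 x2 x3 x4 x5 : R) :
  x1 * x2 + x3 - (x1 * x4 + x5) - x1 * (x2 - x4) = x3 - x5 by ring.
rewrite E.
rewrite /gls (oint_split (ltW ss') s't i1) -addrA -ointB//.
have [_ h1] := gls_vanish_bound (lexx s) (ltW ss') s't erefl; rewrite -/r in h1.
apply: le_trans (ler_normD _ _) _.
rewrite /step_cst mulrDr mulrDl mulrDr; apply: lerD.
  by apply: (le_trans h1); rewrite le_eqVlt; apply/orP; left; apply/eqP; ring.
have p1 : -1 < - al by rewrite ltrN2.
have [J1 J1E] := oint_powl s't p1.
have al1n : - al + 1 != 0 by rewrite gt_eqF//; lra.
have [J2 J2E] := oint_powl_gen (ltW ss') s't al1n (introT orP (or_introl ss')).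
pose psi x := M * (s' - s) `^ lam * ((x - s') `^ (- al) - (x - s) `^ (- al)).
have psii : ointble s' t psi by apply: ointbleZ; apply: ointbleB.
have psiE : oint s' t psi = M * (s' - s) `^ lam *
   (((t - s') `^ (1 - al) - ((t - s) `^ (1 - al) - (s' - s) `^ (1 - al))) / (1 - al)).
  rewrite ointZ; last exact: ointbleB.
  by rewrite ointB// J1E J2E (addrC (- al)); congr (_ * _); rewrite -mulrBl.
have := @oint_mul_dright s s' t t (fun x => dleft al s r x - dleft al s' r x) psi (ltW ss')
  (lexx t).
case=> //.
- by apply: measurable_funB; apply: measurable_dleft; exact: measurable_funB.
- by move=> x /andP[s'x xt]; exact: (dleft_diff al_lam rM).
move=> _ h2.
rewrite (eq_oint (g := fun x => (dleft al s r x - dleft al s' r x) * dright al t g x));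
  last first.
  by move=> x _; rewrite mulrBl.
apply: (le_trans h2); rewrite ler_wpM2l ?dright_sup_ge0//.
rewrite psiE (_ : lam - al + 1 = lam + (1 - al)); last by ring.
rewrite powRDp ?subr_gt0//.
rewrite [leRHS](_ : _ = M * (s' - s) `^ lam * ((s' - s) `^ (1 - al) / (1 - al))); last by ring.
have al1' : al <= 1 by exact: ltW.
rewrite ler_wpM2l ?mulr_ge0 ?powR_ge0// ler_wpM2r ?invr_ge0 ?subr_ge0//.
have : (t - s') `^ (1 - al) <= (t - s) `^ (1 - al).
  by rewrite powR_le ?subr_ge0// ?lerB// ltW.
by lra.
Qed.

End Integrand.
End GlsIncrement.

Section SuperLinear.
Context {R : realType}.

(** Halving an interval divides the bound of the increment by [2^(1 + e)] while
    the number of pieces only doubles. *)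
Lemma superlinear_cst (D : R -> R) (a b C e : R) : 0 <= C -> 0 < e -> a <= b ->
  (forall s s', a <= s -> s < s' -> s' <= b -> `|D s - D s'| <= C * (s' - s) `^ (1 + e)) ->
  D a = D b.
Proof.
move=> C0 e0 ab HD.
pose q : R := 2 `^ (- e).
have /andP[q0 q1] : 0 <= q < 1 by exact: powR2N_itv.
have P n : forall s s', a <= s -> s < s' -> s' <= b ->
    `|D s - D s'| <= C * (s' - s) `^ (1 + e) * q ^+ n.
  elim: n => [|n IH] s s' as_ ss' s'b; first by rewrite expr0 mulr1; exact: HD.
  pose c := (s + s') / 2.
  have sc : s < c by rewrite /c; lra.
  have cs : c < s' by rewrite /c; lra.
  have := IH s c as_ sc (le_trans (ltW cs) s'b).
  have := IH c s' (le_trans as_ (ltW sc)) cs s'b.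
  have -> : s' - c = (s' - s) / 2 by rewrite /c; field.
  have -> : c - s = (s' - s) / 2 by rewrite /c; field.
  have -> : ((s' - s) / 2) `^ (1 + e) = (s' - s) `^ (1 + e) * (q / 2).
    rewrite powRM ?subr_ge0 ?(ltW ss')//; congr (_ * _).
    rewrite powRDp ?invr_gt0// powRr1 ?invr_ge0// mulrC; congr (_ * _).
    by rewrite /q -[X in X `^ e]powR_inv1// -powRrM mulN1r.
  move=> h1 h2; have -> : D s - D s' = (D s - D c) + (D c - D s') by ring.
  apply: le_trans (ler_normD _ _) _; apply: le_trans (lerD h2 h1) _.
  by rewrite exprS le_eqVlt; apply/orP; left; apply/eqP; field.
move: ab; rewrite le_eqVlt => /predU1P[->//|ab].
apply/eqP; rewrite -subr_eq0 -normr_le0.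
apply: (@le_of_geometric _ _ 0 (C * (b - a) `^ (1 + e)) q) => // n.
by rewrite add0r; exact: P.
Qed.

End SuperLinear.

(** * Additivity for a constant integrand *)

Section ConstantIntegrand.
Context {R : realType}.
Implicit Types (a b c k s t x y p q M lam : R) (f g F : R -> R).

Lemma measurable_invr : measurable_fun setT (fun x : R => x^-1).
Proof.
rewrite (_ : (fun x => _) = (fun x : R => if 0 <= x then x `^ (-1) else - ((- x) `^ (-1)))).
  apply: measurable_fun_ifT.
  - exact: measurable_fun_ler.
  - exact: measurable_powR.
  - by apply: measurableT_comp => //; apply: (measurableT_comp (measurable_powR (-1))).
apply/funext => x; case: leP => x0; first by rewrite powR_inv1.
by rewrite powR_inv1 ?oppr_ge0 ?ltW// invrN opprK.
Qed.

Lemma oint_if_gt a b c f : a <= c ->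
  oint a b (fun u => if c < u then f u else 0) = oint c b f.
Proof.
move=> ac; rewrite !oint_setT; apply: eq_Rintegral => u _.
case: (ltP c u) => cu /=; last by case: ifP.
by rewrite (le_lt_trans ac cu).
Qed.

Lemma oint_if_lt a b c f : c <= b ->
  oint a b (fun u => if u < c then f u else 0) = oint a c f.
Proof.
move=> cb; rewrite !oint_setT; apply: eq_Rintegral => u _.
case: (ltP u c) => cu /=; last by rewrite andbF; case: ifP.
by rewrite (lt_le_trans cu cb).
Qed.

Lemma le_sum3_mul (a b d x y : R) : 0 <= a -> 0 <= b -> 0 <= d -> 0 <= x -> 0 <= y ->
  a * x + (b * x + d * y) <= (a + b + d) * (x + y).
Proof. by move=> *; nra. Qed.

Lemma le0_of_powR_bound (A C e0 p q : R) : 0 < p -> 0 < q -> 0 < e0 ->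
  (forall e, 0 < e -> e < e0 -> A <= C * (e `^ p + e `^ q)) -> A <= 0.
Proof.
move=> p0 q0 e00 H.
have cv : C * (e `^ p + e `^ q) @[e --> 0^'+] --> (C * (0 + 0) : R).
  by apply: cvgMr; apply: cvgD; exact: powR_cvg0.
rewrite addr0 mulr0 in cv.
rewrite -(cvg_lim (@Rhausdorff R) cv).
apply: limr_ge; first by apply/cvg_ex; exists 0.
near=> e; apply: H; near: e; first exact: nbhs_right_gt.
exact: nbhs_right_lt.
Unshelve. all: by end_near.
Qed.

Variable al : R.
Hypothesis al01 : 0 < al < 1.
Let al0 : 0 < al. Proof. by case/andP : al01. Qed.
Let al1 : al < 1. Proof. by case/andP : al01. Qed.
Variables (G m : R) (g : R -> R).
Hypotheses (al_m : 1 - al < m) (al_m' : al < m) (m1 : m <= 1) (gG : is_hoelder G m g).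
Let m0 : 0 < m. Proof. by move: al_m al1; lra. Qed.
Let mg : measurable_fun setT g.
Proof. exact: (@measurable_hoelder _ G m). Qed.
Let G0 : 0 <= G. Proof. exact: hoelder_ge0 gG. Qed.
Let eta := m + al - 1.
Let eta0 : 0 < eta. Proof. by rewrite /eta; move: al_m; lra. Qed.

(** Without the part [u - x < e] of the integral, the right derivative is
    [(g x - g t) * e^(al - 1) - (1 - al) * tail_incr t e x], because the integral of
    the weight against the constant [g x] combines with the boundary term. *)
Definition tail_incr t e x := oint (x + e) t (fun u => (g u - g t) * (u - x) `^ (al - 2)).

Lemma ointble_tail_incr t e x c : 0 < e -> x < t - e ->
  ointble (x + e) t (fun u => (u - x) `^ (al - 2)) /\
  ointble (x + e) t (fun u => (g u - c) * (u - x) `^ (al - 2)).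
Proof.
move=> e0 xte.
have xet : x + e <= t by lra.
have n1 : al - 2 + 1 != 0 by rewrite lt_eqF//; move: al1; lra.
have xxe : x < x + e by lra.
have [I1 _] := oint_powl_gen (ltW xxe) xet n1 (introT orP (or_introl xxe)).
split => //.
pose C := G * (t - (x + e)) `^ m + `|g t - c|.
have mh : measurable_fun setT (fun u => (g u - c) * (u - x) `^ (al - 2)).
  by apply: measurable_funM; [exact: measurable_funB|exact: measurable_powl].
apply: (ointble_dom mh (ointbleZ C I1)) => u /andP[xu ut].
rewrite normrM (ger0_norm (powR_ge0 _ _)) ler_wpM2r ?powR_ge0//.
rewrite (_ : g u - c = (g u - g t) + (g t - c)); last by ring.
apply: le_trans (ler_normD _ _) _; rewrite lerD2r.
apply: le_trans (hoelder_le gG (ltW ut)) _.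
by rewrite ler_wpM2l// powR_le ?lerB ?subr_ge0 ?(ltW m0)// ltW.
Qed.

(** The difference is the integral over [u - x < e], of size [O(e^eta)] by the
    Hoelder bound. *)
Lemma dright_trunc t e x : 0 < e -> x < t - e ->
  `|dright al t g x - ((g x - g t) * e `^ (al - 1) - (1 - al) * tail_incr t e x)| <=
  (1 - al) * G / eta * e `^ eta.
Proof.
move=> e0 xte.
have xxe : x <= x + e by lra.
have xet : x + e <= t by lra.
have xt : x <= t by lra.
have [ki _] := inner_right al01 al_m gG xt.
have [_ le1] := inner_right al01 al_m gG xxe.
have n1 : al - 2 + 1 != 0 by rewrite lt_eqF//; move: al1; lra.
have xxe' : x < x + e by lra.
have [I1 I1E] := oint_powl_gen xxe xet n1 (introT orP (or_introl xxe')).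
have [_ I2] := ointble_tail_incr (g t) e0 xte.
have E : oint (x + e) t (fun u => (g x - g u) / (u - x) `^ (2 - al)) =
    (g x - g t) * oint (x + e) t (fun u => (u - x) `^ (al - 2)) - tail_incr t e x.
  rewrite -ointZ// /tail_incr -ointB//; last exact: ointbleZ.
  by apply: eq_oint => u _; rewrite -powRN opprB; ring.
rewrite /dright (oint_split xxe xet ki) E I1E.
rewrite -powRN opprB (_ : al - 2 + 1 = al - 1); last by ring.
rewrite (_ : x + e - x = e); last by ring.
set A := oint x (x + e) _ in le1 *.
rewrite (_ : _ - _ = (1 - al) * A); last first.
  by field; rewrite subr_eq0 lt_eqF.
have al1' : 0 <= 1 - al by rewrite subr_ge0 ltW.
rewrite normrM ger0_norm//; apply: le_trans (ler_wpM2l al1' le1) _.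
rewrite (_ : x + e - x = e); last by ring.
by rewrite -/eta le_eqVlt; apply/orP; left; apply/eqP; ring.
Qed.

Lemma measurable_tail_incr t e : measurable_fun setT (tail_incr t e).
Proof.
rewrite /tail_incr.
apply: (@measurable_oint _ (fun x => x + e) (fun=> t) (fun z =>
  (g z.2 - g t) * (z.2 - z.1) `^ (al - 2))) => //.
  exact: measurable_shift.
apply: measurable_funM; last exact: measurable_pow_snd_fst.
by apply: measurable_funB => //; exact: measurableT_comp.
Qed.

Definition gls1_trunc s t e := oint s (t - e)
  (fun x => (x - s) `^ (- al) * ((g x - g t) * e `^ (al - 1) - (1 - al) * tail_incr t e x)).

(** The integral with the truncated right derivative differs from the true one
    by [O(e^eta)]: on [[s, t - e]] by the truncation, and on [[t - e, t]] because
    the right derivative itself is [O(e^eta)] there. *)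
Let gls1_trunc_close s t e : 0 < e -> s < t - e ->
  ointble s (t - e) (fun x => (x - s) `^ (- al) *
    ((g x - g t) * e `^ (al - 1) - (1 - al) * tail_incr t e x)) /\
  `|gls1 al g s t - gls1_trunc s t e| <=
  ((1 - al) * G / eta + G * right_cst al m) * ((t - s) `^ (1 - al) / (1 - al)) * e `^ eta.
Proof.
move=> e0 ste.
have st : s < t by lra.
have p1 : -1 < - al by rewrite ltrN2.
have ste' := ltW ste; have tet : t - e <= t by lra.
have [W WE] := oint_powl (ltW st) p1.
have [W1 W1E] := oint_powl ste' p1.
have W2 := ointbleS ste' (lexx t) W.
have [D1 _] := gls1_bound al01 al_m gG (ltW st).
have D2 := ointbleS (lexx s) tet D1.
have D3 := ointbleS ste' (lexx t) D1.
pose c1 := (1 - al) * G / eta * e `^ eta.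
pose dd x := (x - s) `^ (- al) * (dright al t g x -
    ((g x - g t) * e `^ (al - 1) - (1 - al) * tail_incr t e x)).
have mdr : measurable_fun setT (dright al t g) by exact: measurable_dright.
have mdd : measurable_fun setT dd.
  apply: measurable_funM; first exact: measurable_powl.
  apply: measurable_funB => //; apply: measurable_funB.
    by apply: measurable_funM => //; exact: measurable_funB.
  by apply: measurable_funM => //; exact: measurable_tail_incr.
have ddle x : s < x < t - e -> `|dd x| <= c1 * (x - s) `^ (- al).
  move=> /andP[sx xte]; rewrite normrM mulrC (ger0_norm (powR_ge0 _ _)).
  by rewrite ler_wpM2r ?powR_ge0//; exact: dright_trunc.
have ddi := ointble_dom mdd (ointbleZ c1 W1) ddle.
have ddI := oint_dom mdd (ointbleZ c1 W1) ddle.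
have Ni : ointble s (t - e) (fun x => (x - s) `^ (- al) *
    ((g x - g t) * e `^ (al - 1) - (1 - al) * tail_incr t e x)).
  by apply: eq_ointble (ointbleB D2 ddi) => x _; rewrite /dd; ring.
split => //.
rewrite gls1E (oint_split ste' tet D1) /gls1_trunc addrAC -ointB//.
rewrite (eq_oint (g := dd)); last by move=> x _; rewrite /dd; ring.
pose c2 := G * right_cst al m * e `^ eta.
have mw : measurable_fun setT (fun x => (x - s) `^ (- al) * dright al t g x).
  by apply: measurable_funM => //; exact: measurable_powl.
have le2 x : t - e < x < t -> `|(x - s) `^ (- al) * dright al t g x| <= c2 * (x - s) `^ (- al).
  move=> /andP[tex xt]; rewrite normrM mulrC (ger0_norm (powR_ge0 _ _)).
  rewrite ler_wpM2r ?powR_ge0//.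
  apply: le_trans (dright_bound al01 al_m gG xt) _.
  rewrite ler_wpM2l ?mulr_ge0 ?right_cst_ge0//.
  by apply: powR_le; [rewrite subr_ge0 ltW|lra|exact: ltW eta0].
have I2 := oint_dom mw (ointbleZ c2 W2) le2.
apply: le_trans (ler_normD _ _) _; apply: le_trans (lerD ddI I2) _.
rewrite !ointZ//.
have S := oint_split ste' tet W.
have w1 : 0 <= oint s (t - e) (fun x => (x - s) `^ (- al)).
  by apply: oint_ge0 => x _; exact: powR_ge0.
have w2 : 0 <= oint (t - e) t (fun x => (x - s) `^ (- al)).
  by apply: oint_ge0 => x _; exact: powR_ge0.
have c10 : 0 <= c1.
  apply: mulr_ge0; last exact: powR_ge0.
  by apply: divr_ge0; [apply: mulr_ge0 => //; rewrite subr_ge0 ltW|exact: ltW eta0].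
have c20 : 0 <= c2 by rewrite !mulr_ge0 ?powR_ge0 ?right_cst_ge0.
rewrite (_ : _ * e `^ eta = (c1 + c2) * oint s t (fun x => (x - s) `^ (- al))); last first.
  by rewrite WE (addrC (- al)) /c1 /c2; ring.
rewrite S mulrDl !mulrDr; apply: lerD.
  by rewrite lerDl mulr_ge0.
by rewrite lerDr mulr_ge0.
Qed.

(** Once the singularity is cut off the order of integration may be exchanged, and
    the inner integral is the elementary [oint_kernel]. *)
Let fubini_tail_incr s t e : 0 < e -> s < t - e ->
  oint s (t - e) (fun x => (x - s) `^ (- al) * ((1 - al) * tail_incr t e x)) =
  oint (s + e) t (fun u => e `^ (al - 1) * ((g u - g t) * ((u - e - s) `^ (1 - al) / (u - s)))).
Proof.
move=> e0 ste.
have p1 : -1 < - al by rewrite ltrN2.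
have [W1 W1E] := oint_powl (ltW ste) p1.
pose K (z : R * R) := if z.1 + e < z.2 then
  (z.1 - s) `^ (- al) * ((1 - al) * ((g z.2 - g t) * (z.2 - z.1) `^ (al - 2))) else 0.
pose c := (1 - al) * (G * (t - s) `^ m * e `^ (al - 2)).
have mK : measurable_fun setT K.
  apply: measurable_fun_ifT => //.
    by apply: measurable_fun_ltr => //; apply: measurable_funD => //.
  apply: measurable_funM.
    apply: (measurableT_comp (measurable_powR (- al))).
    by apply: measurable_funB.
  apply: measurable_funM => //; apply: measurable_funM.
    by apply: measurable_funB => //; exact: measurableT_comp.
  exact: measurable_pow_snd_fst.
have Kle x u : s < x < t - e -> s + e < u < t -> `|K (x, u)| <= (x - s) `^ (- al) * c.
  move=> /andP[sx xte] /andP[su ut]; rewrite /K /=.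
  have c0 : 0 <= c.
    by rewrite !mulr_ge0 ?powR_ge0// subr_ge0 ltW.
  case: ifPn => [xeu|_]; last by rewrite normr0 mulr_ge0 ?powR_ge0.
  rewrite normrM (ger0_norm (powR_ge0 _ _)) ler_wpM2l ?powR_ge0//.
  rewrite /c !normrM (ger0_norm (powR_ge0 _ _)) (ger0_norm (_ :
    0 <= 1 - al)) ?subr_ge0 ?(ltW al1)//.
  rewrite ler_wpM2l ?subr_ge0 ?(ltW al1)//; apply: ler_pM; rewrite ?powR_ge0//.
    apply: le_trans (hoelder_le gG (ltW ut)) _.
    by rewrite ler_wpM2l// powR_le ?subr_ge0 ?(ltW m0) ?(ltW ut)//; lra.
  rewrite (_ : al - 2 = - (2 - al)); last by ring.
  by apply: powRN_ge => //; lra.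
have := oint_fubini mK W1 (ointble_cst (s + e) t c) Kle.
move=> FE; transitivity (oint s (t - e) (fun x => oint (s + e) t (fun u => K (x, u)))).
  apply: eq_oint => x /andP[sx xte]; rewrite /K /=.
  have [_ I2] := ointble_tail_incr (g t) e0 xte.
  rewrite oint_if_gt; last by rewrite lerD2r ltW.
  by rewrite /tail_incr (ointZ _ (ointbleZ (1 - al) I2)) (ointZ _ I2).
rewrite FE; apply: eq_oint => u /andP[su ut].
have [k1 k1E] := oint_kernel al01 e0 su.
transitivity (oint s (t - e) (fun x => if x < u - e then
   ((1 - al) * (g u - g t)) * ((x - s) `^ (- al) * (u - x) `^ (al - 2)) else 0)).
  apply: eq_oint => x _; rewrite /K /=.
  have -> : (x < u - e) = (x + e < u) by rewrite ltrBrDr.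
  case: (x + e < u); last by [].
  by rewrite [LHS]mulrCA -mulrA; congr (_ * _); rewrite mulrCA.
rewrite oint_if_lt; last by apply: lerB; [exact: ltW|exact: lexx].
rewrite (ointZ _ k1) mulrAC k1E; set z := (u - e - s) `^ _; set w := e `^ _.
by ring.
Qed.

(** The substitution [x = s + e y] gives the integral of [y^(- al) / (1 + y)] over
    [[0, (t - s) / e - 1]], which tends to a value of the Beta function.  Its
    translation invariance and its weak dependence on [t] give the additivity of
    [gls1]. *)
Definition beta_trunc s t e := oint s (t - e) (fun x =>
  (x - s) `^ (- al) * (e `^ al / (x - s + e))).

Lemma measurable_beta_kernel s e :
  measurable_fun setT (fun x => (x - s) `^ (- al) * (e `^ al / (x - s + e))).
Proof.
apply: measurable_funM; first exact: measurable_powl.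
apply: measurable_funM => //; apply: (measurableT_comp measurable_invr).
by apply: measurable_funD => //; exact: measurable_funB.
Qed.

Lemma ointble_beta_kernel s t e : 0 < e -> s < t - e ->
  ointble s (t - e) (fun x => (x - s) `^ (- al) * (e `^ al / (x - s + e))).
Proof.
move=> e0 ste; have p1 : -1 < - al by rewrite ltrN2.
have [W1 _] := oint_powl (ltW ste) p1.
apply: (ointble_dom (measurable_beta_kernel s e) (ointbleZ (e `^ al / e) W1)).
move=> x /andP[sx xte]; rewrite normrM mulrC (ger0_norm (powR_ge0 _ _)) ler_wpM2r ?powR_ge0//.
rewrite ger0_norm ?divr_ge0 ?powR_ge0//; last lra.
by rewrite ler_wpM2l ?powR_ge0// lef_pV2 ?posrE//; lra.
Qed.

(** After the exchange of integrals, the shift [u = x + e] makes both parts of the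
    truncated integral integrals over [[s, t - e]].  Their integrands combine to
    [(x - s)^(- al) * e^(al - 1)] times
    [(g x - g (x + e)) + e (g (x + e) - g t) / (x - s + e)], and replacing
    [g (x + e)] by [g s] changes the last quotient by [O((x - s + e)^(m - 1))]. *)
Let gls1_trunc_beta s t e : 0 < e -> s < t - e ->
  `|gls1_trunc s t e - (g s - g t) * beta_trunc s t e| <=
  G * ((t - s) `^ (1 - al) / (1 - al)) * e `^ eta + G * ((t - s) `^ (m - al) / (m - al)) *
    e `^ al.
Proof.
move=> e0 ste.
have st : s < t by lra.
have p1 : -1 < - al by rewrite ltrN2.
have p2 : -1 < m - 1 - al by move: al_m'; lra.
have ste' := ltW ste; have tet : t - e <= t by lra.
have [W WE] := oint_powl (ltW st) p1.
have [V VE] := oint_powl (ltW st) p2.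
have W1 := ointbleS (lexx s) tet W.
have V1 := ointbleS (lexx s) tet V.
have mw : measurable_fun setT (fun x : R => (x - s) `^ (- al)) by exact: measurable_powl.
pose h x := g x - g t.
have mh : measurable_fun setT h by exact: measurable_funB.
have hle x : s < x -> x <= t -> `|h x| <= G * (t - s) `^ m.
  move=> sx xt; apply: le_trans (hoelder_le gG xt) _.
  by rewrite ler_wpM2l// powR_le ?subr_ge0 ?(ltW m0)// lerB// ltW.
have ea : e `^ al = e `^ (al - 1) * e.
  by rewrite -[X in _ * X](powRr1 (ltW e0)) -powRDp// subrK.
have [Ni _] := gls1_trunc_close e0 ste.
have i1 : ointble s (t - e) (fun x => (x - s) `^ (- al) * (h x * e `^ (al - 1))).
  apply: (ointble_dom _ (ointbleZ (G * (t - s) `^ m * e `^ (al - 1)) W1)).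
    by apply: measurable_funM => //; exact: measurable_funM.
  move=> x /andP[sx xte]; rewrite normrM mulrC (ger0_norm (powR_ge0 _ _)) ler_wpM2r ?powR_ge0//.
  rewrite normrM (ger0_norm (powR_ge0 _ _)) ler_wpM2r ?powR_ge0// hle//; lra.
have i2 : ointble s (t - e) (fun x => (x - s) `^ (- al) * ((1 - al) * tail_incr t e x)).
  by apply: eq_ointble (ointbleB i1 Ni) => x _; rewrite /h; ring.
pose F u := e `^ (al - 1) * (h u * ((u - e - s) `^ (1 - al) / (u - s))).
have mF : measurable_fun setT F.
  apply: measurable_funM => //; apply: measurable_funM => //.
  apply: measurable_funM.
    rewrite (_ : (fun u => _) = (fun u => (u - (e + s)) `^ (1 - al))).
      exact: measurable_powl.
    by apply/funext => u; rewrite opprD addrA.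
  by apply: (measurableT_comp measurable_invr); exact: measurable_funB.
have FE x : s < x -> F (x + e) = (x - s) `^ (- al) * (e `^ (al - 1) * (h (x +
  e) * ((x - s) / (x - s + e)))).
  move=> sx; rewrite /F (_ : x + e - e - s = x - s); last by ring.
  rewrite (@powRDp _ (x - s) 1) ?subr_gt0// powRr1 ?subr_ge0 ?ltW//.
  by rewrite (_ : x + e - s = x - s + e); ring.
have ratio x : s < x -> 0 <= (x - s) / (x - s + e) <= 1.
  move=> sx; have xs0 : 0 <= x - s by rewrite subr_ge0 ltW.
  have xse0 : 0 < x - s + e by rewrite ltr_wpDl.
  by rewrite divr_ge0 ?(ltW xse0)//= ler_pdivrMr// mul1r lerDl ltW.
have i3 : ointble s (t - e) (fun x => F (x + e)).
  apply: (ointble_dom _ (ointbleZ (e `^ (al - 1) * (G * (t - s) `^ m)) W1)).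
    by apply: measurableT_comp => //; exact: measurable_shift.
  move=> x /andP[sx xte]; rewrite FE// normrM mulrC (ger0_norm (powR_ge0 _ _)) ler_wpM2r
    ?powR_ge0//.
  rewrite normrM (ger0_norm (powR_ge0 _ _)) ler_wpM2l ?powR_ge0// normrM.
  have /andP[r0 r1] := ratio x sx; rewrite (ger0_norm r0).
  by apply: le_trans (ler_piMr _ r1) _ => //; apply: hle; lra.
have i4 := ointble_beta_kernel e0 ste.
have NE : gls1_trunc s t e = oint s (t - e) (fun x => (x - s) `^ (- al) * (h x *
  e `^ (al - 1)) - F (x + e)).
  rewrite (ointB i1 i3) -oint_shift// subrK /F /h.
  rewrite -fubini_tail_incr// -ointB//.
  by apply: eq_oint => x _; ring.
rewrite NE /beta_trunc -ointZ// -ointB//; [|exact: ointbleB|exact: ointbleZ].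
pose Ps x := G * e `^ eta * (x - s) `^ (- al) + G * e `^ al * (x - s) `^ (m - 1 - al).
have Pi : ointble s (t - e) Ps by apply: ointbleD; exact: ointbleZ.
have PiT : ointble s t Ps by apply: ointbleD; exact: ointbleZ.
apply: (@le_trans _ _ (oint s (t - e) Ps)).
  apply: oint_dom => //.
    apply: measurable_funB; last by apply: measurable_funM => //; exact: measurable_beta_kernel.
    apply: measurable_funB.
      by apply: measurable_funM => //; exact: measurable_funM.
    by apply: measurableT_comp => //; exact: measurable_shift.
  move=> x /andP[sx xte]; rewrite FE//.
  have xs0 : 0 < x - s by lra.
  rewrite (_ : _ - _ = (x - s) `^ (- al) * (e `^ (al - 1) * ((g x - g (x + e)) +
     e * ((g (x + e) - g s) / (x - s + e))))); last first.
    by rewrite ea /h; field; lra.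
  rewrite normrM (ger0_norm (powR_ge0 _ _)) normrM (ger0_norm (powR_ge0 _ _)).
  have b1 : `|g x - g (x + e)| <= G * e `^ m.
    have := hoelder_le gG (_ : x <= x + e); rewrite lerDl ltW// => /(_ isT).
    by rewrite (_ : x + e - x = e)//; ring.
  have b2 : `|(g (x + e) - g s) / (x - s + e)| <= G * (x - s) `^ (m - 1).
    have xse : 0 < x - s + e by lra.
    rewrite normrM normfV (gtr0_norm xse) ler_pdivrMr// distrC.
    have := hoelder_le gG (_ : s <= x + e); have -> : s <= x + e by lra.
    move=> /(_ isT) /le_trans; apply; rewrite (_ : x + e - s = x - s + e); last by ring.
    rewrite -mulrA ler_wpM2l//.
    have -> : (x - s + e) `^ m = (x - s + e) `^ (m - 1) * (x - s + e).
      by rewrite -[X in _ = _ * X](powRr1 (ltW xse)) -powRDp// subrK.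
    rewrite ler_wpM2r ?(ltW xse)// (_ : m - 1 = - (1 - m)); last by ring.
    by apply: powRN_ge; [exact: xs0|rewrite lerDl ltW|rewrite subr_ge0].
  apply: (@le_trans _ _ ((x - s) `^ (- al) * (e `^ (al - 1) * (G * e `^ m +
    e * (G * (x - s) `^ (m - 1)))))).
    rewrite ler_wpM2l ?powR_ge0// ler_wpM2l ?powR_ge0//.
    apply: le_trans (ler_normD _ _) _; apply: lerD => //.
    by rewrite normrM gtr0_norm// ler_wpM2l// ltW.
  rewrite /Ps ea (_ : eta = (al - 1) + m); last by rewrite /eta; ring.
  rewrite (powRDp (al - 1) m e0) (powRDp (m - 1) (- al) xs0).
  by rewrite le_eqVlt; apply/orP; left; apply/eqP; ring.
apply: (@le_trans _ _ (oint s t Ps)).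
  rewrite (oint_split ste' tet PiT) lerDl; apply: oint_ge0 => x _.
  by rewrite addr_ge0// !mulr_ge0 ?powR_ge0.
rewrite ointD; [|exact: ointbleZ|exact: ointbleZ].
rewrite !ointZ// WE VE (addrC (- al)) (_ : m - 1 - al + 1 = m - al); last by ring.
by rewrite le_eqVlt; apply/orP; left; apply/eqP; ring.
Qed.

Lemma gls1_beta s t : s < t -> exists2 C, 0 <= C & forall e, 0 < e -> s < t - e ->
  `|gls1 al g s t - (g s - g t) * beta_trunc s t e| <= C * (e `^ eta + e `^ al).
Proof.
move=> st.
pose A := ((1 - al) * G / eta + G * right_cst al m) * ((t - s) `^ (1 - al) / (1 - al)).
pose B := G * ((t - s) `^ (1 - al) / (1 - al)).
pose D := G * ((t - s) `^ (m - al) / (m - al)).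
have a0 : 0 <= (t - s) `^ (1 - al) / (1 - al) by rewrite divr_ge0 ?powR_ge0// subr_ge0 ltW.
have A0 : 0 <= A.
  apply: mulr_ge0 => //; apply: addr_ge0; last by rewrite mulr_ge0 ?right_cst_ge0.
  by apply: divr_ge0; [apply: mulr_ge0 => //; rewrite subr_ge0 ltW|exact: ltW eta0].
have B0 : 0 <= B by rewrite mulr_ge0.
have D0 : 0 <= D by rewrite mulr_ge0// divr_ge0 ?powR_ge0// subr_ge0 ltW.
exists (A + B + D); first by rewrite !addr_ge0.
move=> e e0 ste; have [_ h1] := gls1_trunc_close e0 ste; have h2 := gls1_trunc_beta e0 ste.
rewrite -/A in h1; rewrite -/B -/D in h2.
have x0 := powR_ge0 e eta; have y0 := powR_ge0 e al.
rewrite (_ : _ - _ = (gls1 al g s t - gls1_trunc s t e) +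
  (gls1_trunc s t e - (g s - g t) * beta_trunc s t e)); last by ring.
apply: le_trans (ler_normD _ _) _; apply: le_trans (lerD h1 h2) _.
exact: le_sum3_mul.
Qed.

(** On [[t - e, t' - e]] the kernel is bounded by a multiple of [e^al], as
    [x - s] stays away from 0. *)
Lemma beta_trunc_diff s t t' e : s < t -> t <= t' -> 0 < e -> e < (t - s) / 2 ->
  `|beta_trunc s t' e - beta_trunc s t e| <= ((t - s) / 2) `^ (- al) / (t - s) * (t' - t) *
    e `^ al.
Proof.
move=> st tt' e0 ets.
have ste : s < t - e by lra.
have ste' : s < t' - e by lra.
have tte : t - e <= t' - e by rewrite lerB.
have I1 := ointble_beta_kernel e0 ste'.
rewrite /beta_trunc (oint_split (ltW ste) tte I1) addrAC subrr add0r.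
pose c := ((t - s) / 2) `^ (- al) * (e `^ al / (t - s)).
apply: (@le_trans _ _ (oint (t - e) (t' - e) (fun=> c))); last first.
  rewrite oint_cst// le_eqVlt; apply/orP; left; apply/eqP.
  rewrite (_ : t' - e - (t - e) = t' - t); last by ring.
  by rewrite /c; field; lra.
apply: oint_dom; [exact: measurable_beta_kernel|exact: ointble_cst|].
move=> x /andP[tx xt].
rewrite normrM (ger0_norm (powR_ge0 _ _)) ger0_norm ?divr_ge0 ?powR_ge0//; last lra.
apply: ler_pM; rewrite ?powR_ge0 ?divr_ge0 ?powR_ge0//.
- lra.
- by apply: powRN_ge; [lra|lra|exact: ltW].
- by rewrite ler_wpM2l ?powR_ge0// lef_pV2 ?posrE//; lra.
Qed.

Lemma beta_trunc_shift s t e c : 0 < e -> s < t - e ->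
  beta_trunc (s + c) (t + c) e = beta_trunc s t e.
Proof.
move=> e0 ste; rewrite /beta_trunc.
rewrite (_ : t + c - e = (t - e) + c); last by ring.
rewrite oint_shift.
- apply: eq_oint => x _.
  by rewrite (_ : x + c - (s + c) = x - s)//; ring.
- exact: measurable_beta_kernel.
- apply: eq_ointble (ointble_beta_kernel e0 ste) => x _.
  by rewrite (_ : x + c - (s + c) = x - s)//; ring.
Qed.

Lemma gls1_nil s : gls1 al g s s = 0.
Proof. by rewrite /gls1 /gls oint_nil. Qed.

(** The constants [beta_trunc] of [[s, r]], [[s, t]] and [[t, r]] differ by
    [O(e^al)], after the translation of [[t, r]] to [[s, t3]]; hence the defect of
    additivity is the defect of [g s - g r = (g s - g t) + (g t - g r)], up to
    terms that vanish with [e]. *)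
Lemma gls1_add s t r : s <= t -> t <= r -> gls1 al g s r = gls1 al g s t + gls1 al g t r.
Proof.
rewrite le_eqVlt => /predU1P[-> _|st]; first by rewrite gls1_nil add0r.
rewrite le_eqVlt => /predU1P[->|tr]; first by rewrite gls1_nil addr0.
have sr : s < r by exact: lt_trans tr.
apply/eqP; rewrite -subr_eq0 -normr_le0.
have [C1 C10 H1] := gls1_beta sr.
have [C2 C20 H2] := gls1_beta st.
have [C3 C30 H3] := gls1_beta tr.
(* [[s, t3]] is the translate of [[t, r]] with left end point [s]. *)
pose t3 := s + (r - t).
have st3 : s < t3 by rewrite /t3; lra.
have t3r : t3 <= r by rewrite /t3; lra.
pose K1 := ((t - s) / 2) `^ (- al) / (t - s) * (r - t).
pose K2 := ((t3 - s) / 2) `^ (- al) / (t3 - s) * (r - t3).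
have K10 : 0 <= K1.
  by apply: mulr_ge0; [apply: mulr_ge0; [exact: powR_ge0|rewrite invr_ge0; lra]|lra].
have K20 : 0 <= K2.
  by apply: mulr_ge0; [apply: mulr_ge0; [exact: powR_ge0|rewrite invr_ge0; lra]|lra].
pose N1 := `|g s - g t|; pose N2 := `|g t - g r|.
have N10 : 0 <= N1 by exact: normr_ge0.
have N20 : 0 <= N2 by exact: normr_ge0.
apply: (@le0_of_powR_bound _ (C1 + C2 + C3 + N1 * K1 + N2 * K2)
  (Num.min ((t - s) / 2) ((r - t) / 2)) eta al) => //.
  by rewrite lt_min; apply/andP; split; lra.
move=> e e0; rewrite lt_min => /andP[e1 e2].
have h1 := H1 e e0 (_ : s < r - e); have s1 : s < r - e by lra.
have s2 : s < t - e by lra.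
have s3 : t < r - e by lra.
move: (H1 e e0 s1) (H2 e e0 s2) (H3 e e0 s3) => {}h1 h2 h3.
have k1 := beta_trunc_diff st (ltW tr) e0 e1.
have e3 : e < (t3 - s) / 2 by rewrite /t3; lra.
have k2 := beta_trunc_diff st3 t3r e0 e3.
have s4 : s < t3 - e by lra.
have E3 : beta_trunc t r e = beta_trunc s t3 e.
  have Et : s + (t - s) = t by ring.
  have Er : t3 + (t - s) = r by rewrite /t3; ring.
  by have := beta_trunc_shift (t - s) e0 s4; rewrite Et Er.
rewrite E3 in h3; rewrite -/K1 in k1; rewrite -/K2 in k2.
have k1' : `|(g s - g t) * (beta_trunc s r e - beta_trunc s t e)| <= N1 * K1 * e `^ al.
  by rewrite normrM -mulrA; apply: ler_wpM2l.
have k2' : `|(g t - g r) * (beta_trunc s r e - beta_trunc s t3 e)| <= N2 * K2 * e `^ al.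
  by rewrite normrM -mulrA; apply: ler_wpM2l.
have x0 := powR_ge0 e eta; have y0 := powR_ge0 e al.
have l1 : N1 * K1 * e `^ al <= N1 * K1 * (e `^ eta + e `^ al).
  by apply: ler_wpM2l; [exact: mulr_ge0|rewrite lerDr].
have l2 : N2 * K2 * e `^ al <= N2 * K2 * (e `^ eta + e `^ al).
  by apply: ler_wpM2l; [exact: mulr_ge0|rewrite lerDr].
move: h1 h2 h3 k1' k2' l1 l2; clear.
set a1 := gls1 al g s r; set a2 := gls1 al g s t; set a3 := gls1 al g t r.
set kk1 := beta_trunc s r e; set kk2 := beta_trunc s t e; set kk3 := beta_trunc s t3 e.
set xy := e `^ eta + e `^ al; set y := e `^ al => h1 h2 h3 k1 k2 l1 l2.
rewrite (_ : a1 - (a2 + a3) = (a1 - (g s - g r) * kk1) - (a2 - (g s - g t) * kk2)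
  - (a3 - (g t - g r) * kk3) + (g s - g t) * (kk1 - kk2) + (g t - g r) * (kk1 - kk3));
    last by ring.
rewrite [leRHS](_ : _ = C1 * xy + C2 * xy + C3 * xy + N1 * K1 * xy + N2 * K2 * xy); last by ring.
apply: le_trans (ler_normD _ _) _; apply: lerD; last exact: le_trans k2 l2.
apply: le_trans (ler_normD _ _) _; apply: lerD; last exact: le_trans k1 l1.
apply: le_trans (ler_normB _ _) _; apply: lerD => //.
by apply: le_trans (ler_normB _ _) _; apply: lerD.
Qed.

End ConstantIntegrand.

(** * Additivity for a Hoelder integrand *)

Section Additivity.
Context {R : realType}.
Implicit Types (a b c k s t x y p q M lam : R) (f g F : R -> R).
Variable al : R.
Hypothesis al01 : 0 < al < 1.
Let al0 : 0 < al. Proof. by case/andP : al01. Qed.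
Let al1 : al < 1. Proof. by case/andP : al01. Qed.

Lemma gls_nil s f g : gls al s s f g = 0.
Proof. by rewrite /gls oint_nil. Qed.

#[local] Opaque gls gls1.

(** The defect, as a function [D] of the lower end point, has increments of order
    [|y - x|^(1 + (lam - al))] by [gls_step]: the terms of first order cancel by
    the additivity for constant integrands. *)
Lemma gls_add G m M lam f g s t r : 1 - al < m -> al < m -> m <= 1 -> al < lam ->
  is_hoelder M lam f -> is_hoelder G m g -> s <= t -> t <= r ->
  gls al s r f g = gls al s t f g + gls al t r f g.
Proof.
move=> al_m al_m' m1 al_lam fM gG st tr.
pose D y := gls al y r f g - gls al y t f g.
have AD (p q z : R) : p - q = z - 0 -> p = q + z.
  by rewrite subr0 => <-; rewrite addrC subrK.
suff DE : D s = D t by apply: AD; rewrite -[in RHS](gls_nil t f g); exact: DE.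
have sr : s <= r by exact: le_trans tr.
have G0 := hoelder_ge0 gG; have M0 := hoelder_ge0 fM.
have Cs0 : 0 <= step_cst al M lam.
  apply: mulr_ge0 => //; apply: addr_ge0; last by rewrite invr_ge0 subr_ge0 ltW.
  apply: divr_ge0; first exact: left_cst_ge0.
  by move: al_lam; lra.
have DD0 r' : 0 <= dright_sup al G m s r' by apply: mulr_ge0; [apply: mulr_ge0 => //;
  exact: right_cst_ge0|exact: powR_ge0].
have Dmono x r' : s <= x -> x <= r' -> dright_sup al G m x r' <= dright_sup al G m s r'.
  move=> sx xr'; apply: ler_wpM2l; first by apply: mulr_ge0 => //; exact: right_cst_ge0.
  apply: powR_le; [by rewrite subr_ge0|exact: lerB|by move: al_m; lra].
apply: (@superlinear_cst _ D s t ((dright_sup al G m s r +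
  dright_sup al G m s t) * step_cst al M lam) (lam - al)) => //.
- by apply: mulr_ge0 => //; exact: addr_ge0.
- by rewrite subr_gt0.
move=> x y sx xy yt.
have yr : y <= r by exact: le_trans tr.
have xt : x <= t by exact: le_trans (ltW xy) yt.
have xr : x <= r by exact: le_trans (ltW xy) yr.
have h1 := gls_step al01 al_m gG al_lam fM xy yr.
have h2 := gls_step al01 al_m gG al_lam fM xy yt.
have a1 := gls1_add al01 al_m al_m' m1 gG (ltW xy) yr.
have a2 := gls1_add al01 al_m al_m' m1 gG (ltW xy) yt.
rewrite (addrC 1 (lam - al)).
rewrite a1 (addrK (gls1 al g y r)) in h1; rewrite a2 (addrK (gls1 al g y t)) in h2.
rewrite /D; move: h1 h2.
set u1 := gls al x r f g; set u2 := gls al y r f g; set u3 := gls al x t f g; set u4 :=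
  gls al y t f g.
set P := (y - x) `^ _; set w := f x * _ => h1 h2.
have P0 : 0 <= step_cst al M lam * P by apply: mulr_ge0 => //; exact: powR_ge0.
rewrite (_ : u1 - u3 - (u2 - u4) = (u1 - u2 - w) - (u3 - u4 - w)); last by ring.
apply: le_trans (ler_normB _ _) _.
rewrite -mulrA mulrDl; apply: lerD.
  by apply: le_trans h1 _; apply: ler_wpM2r => //; exact: Dmono.
by apply: le_trans h2 _; apply: ler_wpM2r => //; exact: Dmono.
Qed.

End Additivity.

(** * Functions that are Hoelder on an interval *)

Section Clamp.
Context {R : realType}.
Implicit Types (u v y z M mu : R) (f g : R -> R).

Definition hoelder_on u v M mu f := forall y z, u <= y <= v -> u <= z <= v ->
  `|f y - f z| <= M * `|y - z| `^ mu.

(** Composition with [clamp u v] extends a function that is Hoelder on [[u, v]] to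
    the whole line, with the same constant, so that the estimates for functions
    Hoelder on the line apply on intervals. *)
Definition clamp u v y : R := Num.max u (Num.min y v).

Lemma clamp_itv u v y : u <= v -> u <= clamp u v y <= v.
Proof. by move=> uv; rewrite /clamp le_max lexx ge_max uv ge_min lexx orbT. Qed.

Lemma clamp_id u v y : u <= y <= v -> clamp u v y = y.
Proof. by move=> /andP[uy yv]; rewrite /clamp min_l// max_r. Qed.

Lemma clamp_lip u v y z : `|clamp u v y - clamp u v z| <= `|y - z|.
Proof.
wlog yz : y z / y <= z.
  move=> H; have [|/ltW zy] := leP y z; first exact: H.
  by rewrite distrC (distrC y); exact: H.
have c1 : clamp u v y <= clamp u v z.
  rewrite /clamp ge_max !le_max lexx/=; apply/orP; right.
  by rewrite le_min !ge_min yz lexx orbT.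
rewrite distrC ger0_norm ?subr_ge0// distrC ger0_norm ?subr_ge0//.
have u1 : u <= clamp u v y by rewrite /clamp le_max lexx.
have m1 : Num.min y v <= clamp u v y by rewrite /clamp le_max lexx orbT.
have m2 : Num.min z v - (z - y) <= Num.min y v.
  rewrite le_min; have : Num.min z v <= z by rewrite ge_min lexx.
  have : Num.min z v <= v by rewrite ge_min lexx orbT.
  by move=> ? ?; apply/andP; split; lra.
rewrite lerBlDr [leLHS]/clamp ge_max; apply/andP; split; lra.
Qed.

Lemma is_hoelder_clamp u v M mu f : u <= v -> 0 < mu -> 0 <= M -> hoelder_on u v M mu f ->
  is_hoelder M mu (fun y => f (clamp u v y)).
Proof.
move=> uv mu0 M0 fM y z; apply: le_trans (fM _ _ (clamp_itv y uv) (clamp_itv z uv)) _.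
by apply: ler_wpM2l => //; apply: powR_le; [exact: normr_ge0|exact: clamp_lip|exact: ltW].
Qed.

Lemma hoelder_onS u v u' v' M mu f : u <= u' -> v' <= v -> hoelder_on u v M mu f ->
  hoelder_on u' v' M mu f.
Proof.
move=> uu' v'v fM y z /andP[y1 y2] /andP[z1 z2]; apply: fM.
  by rewrite (le_trans uu')// (le_trans y2).
by rewrite (le_trans uu')// (le_trans z2).
Qed.

Lemma hoelder_on_comp u v M mu L f (b : R -> R) : 0 <= L ->
  (forall y z, `|b y - b z| <= L * `|y - z|) -> hoelder_on u v M mu f ->
  hoelder_on u v (L * M) mu (fun y => b (f y)).
Proof.
move=> L0 bL fM y z yi zi; apply: le_trans (bL _ _) _.
by rewrite -mulrA; apply: ler_wpM2l => //; exact: fM.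
Qed.

Lemma hoelder_on_ge u v M M' mu f : M <= M' -> hoelder_on u v M mu f -> hoelder_on u v M' mu f.
Proof.
move=> MM' fM y z yi zi; apply: le_trans (fM _ _ yi zi) _.
by apply: ler_wpM2r => //; exact: powR_ge0.
Qed.

End Clamp.

(** * Estimates for one short step of the equation *)

Section PathEstimate.
Context {R : realType}.
Variables (al mu : R).
Hypotheses (al01 : 0 < al < 1) (al_mu : 1 - al < mu) (al_mu' : al < mu) (mu1 : mu < 1).
Let al0 : 0 < al. Proof. by case/andP : al01. Qed.
Let al1 : al < 1. Proof. by case/andP : al01. Qed.
Let mu0 : 0 < mu. Proof. exact: lt_trans al_mu'. Qed.

Lemma gls_add_on G M f g S s t r : 0 <= G -> 0 <= M ->
  hoelder_on 0 S M mu f -> hoelder_on 0 S G mu g ->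
  0 <= s -> s <= t -> t <= r -> r <= S ->
  gls al s r f g = gls al s t f g + gls al t r f g.
Proof.
move=> G0 M0 fM gG s0 st tr rS.
have S0 : 0 <= S by rewrite (le_trans s0)// (le_trans st)// (le_trans tr).
have E u v : 0 <= u -> v <= S -> gls al u v f g =
   gls al u v (fun y => f (clamp 0 S y)) (fun y => g (clamp 0 S y)).
  move=> u0 vS; apply: eq_gls => y /andP[uy yv]; rewrite clamp_id//.
    by rewrite (le_trans u0 uy) (le_trans yv vS).
  by rewrite (le_trans u0 uy) (le_trans yv vS).
have t0 : 0 <= t by exact: le_trans st.
have tS : t <= S by exact: le_trans rS.
rewrite !E//; apply: (@gls_add _ al al01 G mu M mu) => //; first exact: ltW.
  exact: is_hoelder_clamp.
exact: is_hoelder_clamp.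
Qed.

(** The term with [A] has the exponent [2 mu], which makes it small against
    [(t - s)^mu] on short intervals. *)
Lemma gls_bound_on K M G f g s t : 0 <= M -> 0 <= G -> s <= t -> (forall y, `|f y| <= K) ->
  hoelder_on s t M mu f -> hoelder_on s t G mu g ->
  `|gls al s t f g| <= G * right_cst al mu * (K / (1 - al) * (t - s) `^ mu +
     M * left_cst al mu / (mu - al + 1) * ((t - s) `^ mu * (t - s) `^ mu)).
Proof.
move=> M0 G0 st fK fM gG.
have [->|st'] := eqVneq s t.
  rewrite gls_nil normr0 subrr powR0 ?gt_eqF// !mulr0 addr0 mulr0; exact: lexx.
have {}st' : 0 < t - s by rewrite subr_gt0 lt_neqAle st' st.
rewrite (@eq_gls _ al s t f (fun y => f (clamp s t y)) g (fun y => g (clamp s t y)));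
  last 2 first.
- by move=> y yi; rewrite clamp_id.
- by move=> y yi; rewrite clamp_id.
have fM' := is_hoelder_clamp st mu0 M0 fM.
have gG' := is_hoelder_clamp st mu0 G0 gG.
apply: le_trans (gls_bound al01 al_mu gG' al_mu' fM' st) _.
rewrite /dright_sup -mulrA; apply: ler_wpM2l.
  by apply: mulr_ge0 => //; exact: right_cst_ge0.
have e1 : (t - s) `^ mu = (t - s) `^ (mu + al - 1) * (t - s) `^ (1 - al).
  by rewrite -powRDp//; congr (_ `^ _); ring.
have e2 : (t - s) `^ mu * (t - s) `^ mu = (t - s) `^ (mu + al - 1) * (t - s) `^ (mu - al + 1).
  by rewrite -!powRDp//; congr (_ `^ _); ring.
rewrite e2 {1}e1.
set P := (t - s) `^ (mu + al - 1); set Q := (t - s) `^ (1 - al); set W := (t - s) `^ _.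
set C := left_cst al mu.
rewrite mulrDr; apply: lerD; last first.
  by rewrite le_eqVlt; apply/orP; left; apply/eqP; ring.
rewrite [leRHS](_ : _ = P * (K * (Q / (1 - al)))); last by ring.
apply: ler_wpM2l; first exact: powR_ge0.
by apply: ler_wpM2r => //; rewrite divr_ge0 ?powR_ge0// subr_ge0 ltW.
Qed.

(** [path_cst1] and [path_cst2] are the coefficients of [G] and of
    [G A (t - s)^mu] in [path_increment_bound]. *)
Definition path_cst1 (c K : R) : R := K + `|c| * right_cst al mu * (K / (1 - al)).
Definition path_cst2 (c L : R) : R :=
  `|c| * right_cst al mu * (L * left_cst al mu / (mu - al + 1)).
Definition path_cst (c K L : R) : R :=
  4 * path_cst1 c K * (2 * path_cst2 c L + 1) `^ ((1 - mu) / mu).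

Variables (c K L : R) (a b x g : R -> R) (x0 S : R).
Hypotheses (K0 : 0 <= K) (L0 : 0 <= L).
Hypotheses (aK : forall y, `|a y| <= K) (bK : forall y, `|b y| <= K).
Hypotheses (aL : forall y z, `|a y - a z| <= L * `|y - z|)
  (bL : forall y z, `|b y - b z| <= L * `|y - z|).
Variables (Mx Mg : R).
Hypotheses (Mx0 : 0 <= Mx) (Mg0 : 0 <= Mg).
Hypotheses (xM : hoelder_on 0 S Mx mu x) (gM : hoelder_on 0 S Mg mu g).
Hypothesis xE : forall t, 0 <= t -> t <= S ->
  x t = x0 + oint 0 t (fun s => a (x s)) + c * gls al 0 t (fun s => b (x s)) g.

Lemma ointble_a s t : 0 <= s -> t <= S -> ointble s t (fun y => a (x y)).
Proof.
move=> s0 tS; have [st|ts] := ltP s t; last first.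
  apply: eq_ointble (ointble0 _ _) => y /andP[sy yt].
  by have := lt_le_trans (lt_trans sy yt) ts; rewrite ltxx.
have S0 : 0 <= S by rewrite (le_trans s0)// (le_trans (ltW st)).
have h := is_hoelder_clamp S0 mu0 Mx0 xM.
have h2 : hoelder_on 0 S (L * Mx) mu (fun y => a (x y)) by exact: hoelder_on_comp.
have h3 := is_hoelder_clamp S0 mu0 (mulr_ge0 L0 Mx0) h2.
have m3 := measurable_hoelder mu0 h3.
have i3 : ointble s t (fun y => a (x (clamp 0 S y))).
  by apply: (ointble_dom m3 (ointble_cst s t K)) => y _; exact: aK.
apply: eq_ointble i3 => y /andP[sy yt]; rewrite clamp_id//.
by rewrite (le_trans s0 (ltW sy)) (le_trans (ltW yt) tS).
Qed.

Lemma path_increment s t : 0 <= s -> s <= t -> t <= S ->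
  x t - x s = oint s t (fun y => a (x y)) + c * gls al s t (fun y => b (x y)) g.
Proof.
move=> s0 st tS; have t0 : 0 <= t by exact: le_trans st.
have sS : s <= S by exact: le_trans tS.
have bx : hoelder_on 0 S (L * Mx) mu (fun y => b (x y)) by exact: hoelder_on_comp.
rewrite (xE t0 tS) (xE s0 sS) (oint_split s0 st (ointble_a (lexx 0) tS)).
rewrite (gls_add_on Mg0 (mulr_ge0 L0 Mx0) bx gM (lexx 0) s0 st tS).
set u1 := oint 0 s _; set u2 := oint s t _; set u3 := gls _ _ _ _ _; set u4 := gls _ _ _ _ _.
by ring.
Qed.

Lemma path_cst1_ge : K <= path_cst1 c K.
Proof.
rewrite lerDl; apply: mulr_ge0; last by rewrite divr_ge0// subr_ge0 ltW.
by apply: mulr_ge0; [exact: normr_ge0|exact: right_cst_ge0].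
Qed.

Lemma path_cst2_ge0 : 0 <= path_cst2 c L.
Proof.
apply: mulr_ge0; first by apply: mulr_ge0; [exact: normr_ge0|exact: right_cst_ge0].
apply: divr_ge0; last by move: al_mu'; lra.
by apply: mulr_ge0 => //; exact: left_cst_ge0.
Qed.

(** The drift contributes at most [K (t - s) <= K G (t - s)^mu]; the integral is
    bounded by [gls_bound_on], as [b] composed with the solution has the Hoelder
    constant [L A]. *)
Lemma path_increment_bound A G s t : 0 <= s -> s <= t -> t <= S -> t <= s + 1 ->
  0 <= A -> 1 <= G -> hoelder_on s t A mu x -> hoelder_on s t G mu g ->
  `|x t - x s| <= (path_cst1 c K * G + path_cst2 c L * G * A * (t - s) `^ mu) * (t - s) `^ mu.
Proof.
move=> s0 st tS ts1 A0 G1 xA gG.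
have G0 : 0 <= G by exact: le_trans G1.
have bx : hoelder_on s t (L * A) mu (fun y => b (x y)) by exact: hoelder_on_comp.
rewrite path_increment//.
apply: le_trans (ler_normD _ _) _; rewrite normrM.
have h1 : `|oint s t (fun y => a (x y))| <= K * (t - s) `^ mu.
  have i := ointble_a s0 tS.
  have : `|oint s t (fun y => a (x y))| <= oint s t (fun=> K).
    apply: le_trans (le_normr_Rintegral _ i) _; first exact: measurable_itv.
    apply: le_oint; [exact: integrable_norm|exact: ointble_cst|by move=> y _; exact: aK].
  rewrite oint_cst// => /le_trans; apply; apply: ler_wpM2l => //.
  have [->|st'] := eqVneq s t; first by rewrite subrr powR_ge0.
  by apply: ger1_powR; [rewrite subr_gt0 lt_neqAle st' st /=; lra|exact: ltW].
have h2 := gls_bound_on (mulr_ge0 L0 A0) G0 st (fun y => bK (x y)) bx gG.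
have h3 := ler_wpM2l (normr_ge0 c) h2.
apply: le_trans (lerD h1 h3) _.
set P := (t - s) `^ mu.
have P0 : 0 <= P by exact: powR_ge0.
rewrite /path_cst1 /path_cst2.
set Cr := right_cst al mu; set Cl := left_cst al mu.
have KG : K * P <= K * G * P.
  by apply: ler_wpM2r => //; rewrite ler_peMr.
apply: le_trans (lerD KG (lexx _)) _.
by rewrite le_eqVlt; apply/orP; left; apply/eqP; ring.
Qed.

End PathEstimate.

(** * From short steps to unit intervals *)

Section LocalToGlobal.
Context {R : realType}.
Variables (mu C1 C2 Mx S : R) (x g : R -> R).
Hypotheses (mu0 : 0 < mu) (mu1 : mu < 1) (C10 : 0 <= C1) (C20 : 0 <= C2) (Mx0 : 0 <= Mx).
Hypothesis xM : hoelder_on 0 S Mx mu x.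
Hypothesis step : forall A G s t, 0 <= s -> s <= t -> t <= S -> t <= s + 1 ->
  0 <= A -> 1 <= G -> hoelder_on s t A mu x -> hoelder_on s t G mu g ->
  `|x t - x s| <= (C1 * G + C2 * G * A * (t - s) `^ mu) * (t - s) `^ mu.

Let eps (n : nat) : R := 2^-1 ^+ n.

Variables (G : R).
Hypothesis G1 : 1 <= G.
Let G0 : 0 < G. Proof. exact: lt_le_trans G1. Qed.
Let k : R := (2 * C2 + 1) * G.
Let k0 : 0 < k. Proof. by apply: mulr_gt0 => //; move: C20; lra. Qed.
Let k1 : 1 <= k.
Proof. by rewrite -[leLHS]mulr1; apply: ler_pM => //; move: C20; lra. Qed.

(** Chosen so that [(2 C2 + 1) G step_length^mu = 1]; on intervals of at most this
    length the term of the estimate that contains [A] is at most [A / 2]. *)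
Definition step_length : R := k `^ (- mu^-1).
Let step_length_gt0 : 0 < step_length. Proof. exact: powR_gt0. Qed.
Let step_lengthX : step_length `^ mu = k^-1.
Proof. by rewrite /step_length -powRrM mulNr mulVf ?gt_eqF// powR_inv1// ltW. Qed.

(** Starting from the constant [Mx], the [n]-fold application of the hypothesis
    gives the constant [2 C1 G + Mx / 2^n] on the interval and on all its
    subintervals. *)
Lemma short_estimate s t : 0 <= s -> s <= t -> t <= S -> t <= s + 1 -> t - s <= step_length ->
  hoelder_on s t G mu g -> `|x t - x s| <= 2 * (C1 * G) * (t - s) `^ mu.
Proof.
move=> s0 st tS ts1 tsd gG.
pose B := C1 * G.
have B0 : 0 <= B by apply: mulr_ge0 => //; exact: ltW.
have H n : hoelder_on s t (2 * B + Mx * eps n) mu x.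
  elim: n => [|n IH].
    rewrite /eps expr0 mulr1; apply: (hoelder_on_ge (M := Mx)).
      by rewrite lerDr mulr_ge0.
    exact: hoelder_onS xM.
  move=> y z.
  wlog yz : y z / y <= z.
    move=> W yi zi; have [yz|/ltW zy] := leP y z; first exact: W.
    by rewrite distrC (distrC y); exact: W.
  move=> /andP[sy yt] /andP[sz zt].
  rewrite distrC (distrC y) [`|z - y|]ger0_norm ?subr_ge0//.
  have en0 : 0 <= eps n by apply: exprn_ge0; rewrite invr_ge0.
  have A0 : 0 <= 2 * B + Mx * eps n by apply: addr_ge0; exact: mulr_ge0.
  have h := step (le_trans s0 sy) yz (le_trans zt tS) (_ : z <= y + 1) A0 G1
    (hoelder_onS sy zt IH) (hoelder_onS sy zt gG).
  have zy1 : z <= y + 1 by lra.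
  apply: le_trans (h zy1) _; apply: ler_wpM2r; first exact: powR_ge0.
  rewrite -/B.
  set A := 2 * B + _ in h A0 *.
  have e : C2 * G * (z - y) `^ mu <= 2^-1.
    have : (z - y) `^ mu <= k^-1.
      by rewrite -step_lengthX; apply: powR_le; [rewrite subr_ge0|lra|exact: ltW].
    move=> /(ler_wpM2l (mulr_ge0 C20 (ltW G0))) /le_trans; apply.
    rewrite ler_pdivrMr// /k mulrA; apply: ler_wpM2r; first exact: ltW.
    by move: C20; lra.
  have -> : C2 * G * A * (z - y) `^ mu = A * (C2 * G * (z - y) `^ mu).
    by set P := (z - y) `^ mu; ring.
  apply: (@le_trans _ _ (B + A * 2^-1)); first by rewrite lerD2l; exact: ler_wpM2l.
  rewrite /A /eps exprS le_eqVlt; apply/orP; left; apply/eqP.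
  by field.
have [-> |ts] := eqVneq s t; first by rewrite subrr normr0 mulr_ge0 ?powR_ge0// mulr_ge0.
apply: (@le_of_geometric _ _ _ (Mx * (t - s) `^ mu) 2^-1) => [||n].
- by rewrite invr_ge0.
- by rewrite invf_lt1// ltr1n.
rewrite -/(eps n); have := H n t s; rewrite st !lexx => /(_ isT isT).
rewrite [`|t - s|]ger0_norm ?subr_ge0// => /le_trans; apply.
rewrite le_eqVlt; apply/orP; left; apply/eqP; rewrite /B.
by set P := (t - s) `^ mu; set E := eps n; ring.
Qed.

Lemma chain_estimate (N : nat) s t : 0 <= s -> s <= t -> t <= S -> t <= s + 1 ->
  t - s <= N%:R * step_length -> hoelder_on s t G mu g ->
  `|x t - x s| <= N%:R * (2 * (C1 * G) * step_length `^ mu).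
Proof.
elim: N s t => [|N IH] s t s0 st tS ts1 tsN gG.
  rewrite mul0r in tsN; have -> : s = t by lra.
  by rewrite subrr normr0 mul0r.
have B0 : 0 <= 2 * (C1 * G) by rewrite !mulr_ge0// ltW.
have d0 : 0 <= step_length `^ mu by exact: powR_ge0.
have [tsd|dts] := leP (t - s) step_length.
  apply: le_trans (short_estimate s0 st tS ts1 tsd gG) _.
  apply: (@le_trans _ _ (2 * (C1 * G) * step_length `^ mu)).
    by apply: ler_wpM2l => //; apply: powR_le; [rewrite subr_ge0|exact: tsd|exact: ltW].
  by apply: ler_peMl; [exact: mulr_ge0|rewrite ler1n].
have d1 := ltW step_length_gt0.
have sc : s <= t - step_length by lra.
have ct : t - step_length <= t by lra.
have c0 : 0 <= t - step_length by lra.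
have cS : t - step_length <= S by lra.
have c1 : t - step_length <= s + 1 by lra.
have tc1 : t <= t - step_length + 1 by move: st ts1 dts; lra.
have cN : t - step_length - s <= N%:R * step_length.
  by move: tsN; rewrite -natr1 mulrDl mul1r; lra.
have h1 := IH s (t - step_length) s0 sc cS c1 cN (hoelder_onS (lexx s) ct gG).
have tcd : t - (t - step_length) <= step_length by lra.
have h2 := short_estimate c0 ct tS tc1 tcd (hoelder_onS sc (lexx t) gG).
have E : t - (t - step_length) = step_length by ring.
rewrite E in h2.
have -> : x t - x s = (x t - x (t - step_length)) + (x (t - step_length) - x s) by ring.
apply: le_trans (ler_normD _ _) _; apply: le_trans (lerD h2 h1) _.
by rewrite -[N.+1%:R]natr1 [leRHS]mulrDl mul1r [leRHS]addrC; exact: lexx.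
Qed.

(** The number of steps is at most [2 (t - s) / step_length], and
    [step_length^(mu - 1)] is of the order [G^((1 - mu) / mu)], which together with
    the factor [G] of one step makes [G^(1 / mu)]. *)
Lemma global_estimate s t : 0 <= s -> s <= t -> t <= S -> t <= s + 1 ->
  hoelder_on s t G mu g ->
  `|x t - x s| <= 4 * C1 * (2 * C2 + 1) `^ ((1 - mu) / mu) * G `^ mu^-1 * (t - s) `^ mu.
Proof.
move=> s0 st tS ts1 gG.
have im : 1 <= mu^-1 by rewrite invf_ge1// ltW.
have em : 0 <= (1 - mu) / mu by rewrite divr_ge0// ?subr_ge0 ltW.
set Q := (2 * C2 + 1) `^ ((1 - mu) / mu).
have Q1 : 1 <= Q.
  rewrite -[leLHS](powRr0 (2 * C2 + 1)); apply: ler_powR => //; first by move: C20; lra.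
have GG : G <= G `^ mu^-1 by exact: le1r_powR.
have P0 : 0 <= (t - s) `^ mu by exact: powR_ge0.
have [tsd|dts] := leP (t - s) step_length.
  apply: le_trans (short_estimate s0 st tS ts1 tsd gG) _; apply: ler_wpM2r => //.
  rewrite -[leLHS]mulr1 -mulrA -mulrA.
  rewrite (_ : 4 * C1 * Q * _ = 2 * (2 * C1 * Q * G `^ mu^-1)); last by ring.
  apply: ler_wpM2l => //; rewrite mulr1.
  have a1 : C1 * G <= C1 * G `^ mu^-1 by exact: ler_wpM2l.
  apply: le_trans a1 _.
  have cg : 0 <= C1 * G `^ mu^-1 by apply: mulr_ge0 => //; exact: powR_ge0.
  rewrite (_ : 2 * C1 * Q * _ = (2 * Q) * (C1 * G `^ mu^-1)); last by ring.
  by rewrite ler_peMl//; lra.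
have ts0 : 0 < t - s by exact: lt_trans dts.
pose q := (t - s) / step_length.
have q1 : 1 < q by rewrite ltr_pdivlMr// mul1r.
have q0 : 0 <= q by lra.
pose N := (Num.truncn q).+1.
have /andP[N1 N2] : (Num.truncn q)%:R <= q < N%:R by exact: truncn_itv.
have Nq : N%:R <= 2 * q by rewrite /N -natr1; move: N1 q1; lra.
have tsN : t - s <= N%:R * step_length.
  by have := ltW N2; rewrite /q ler_pdivrMr.
apply: le_trans (chain_estimate s0 st tS ts1 tsN gG) _.
have B0 : 0 <= 2 * (C1 * G) * step_length `^ mu by rewrite !mulr_ge0 ?powR_ge0// ltW.
apply: le_trans (ler_wpM2r B0 Nq) _.
have tsP : t - s <= (t - s) `^ mu by apply: ger1_powR; [rewrite ts0 /=; lra|exact: ltW].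
have dd : step_length `^ mu / step_length = Q * G `^ ((1 - mu) / mu).
  rewrite step_lengthX /step_length powRN invrK.
  rewrite -(powRM _ _ (ltW G0)); last by move: C20; lra.
  rewrite -/k -{1}(powR_inv1 (ltW k0)) -powRDp//; congr (_ `^ _).
  by rewrite mulrBl divff ?gt_eqF// mul1r addrC.
have GE : G * G `^ ((1 - mu) / mu) = G `^ mu^-1.
  rewrite -{1}(powRr1 (ltW G0)) -powRDp//; congr (_ `^ _).
  by rewrite mulrBl divff ?gt_eqF// mul1r addrC subrK.
rewrite (_ : 2 * q * _ = 4 * C1 * G * (step_length `^ mu / step_length) * (t - s)); last first.
  by rewrite /q; set dm := step_length `^ mu; ring.
rewrite dd -GE.
rewrite [leRHS](_ : _ = 4 * C1 * G * (Q * G `^ ((1 - mu) / mu)) * (t - s) `^ mu); last first.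
  by set P := (t - s) `^ mu; set W := G `^ _; ring.
apply: ler_wpM2l => //.
by rewrite !mulr_ge0 ?powR_ge0// ltW.
Qed.

End LocalToGlobal.

(** * The complex-valued integral in terms of its real density *)

Section ComplexIntegral.
Context {R : realType}.
Implicit Types (al s t x c : R) (f g : R -> R).
Local Open Scope complex_scope.

Lemma normcM_expi (th r : R) : Normc.normc (expi th * r%:C) = `|r|.
Proof.
rewrite Normc.normcM /expi /= expr0n /= addr0 sqrtr_sqr.
by rewrite cos2Dsin2 sqrtr1 mul1r.
Qed.

Lemma frac_rightE al t g x :
  frac_right al t (shift_end t g) x =
  expi (- (pi * al)) * ((Gamma al)^-1 * dright al t g x)%:C.
Proof.
rewrite /frac_right /dright /shift_end; congr (_ * (_ * (_ + _ * _))%:C).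
by apply: eq_oint => u _; rewrite opprB addrA subrK.
Qed.

Lemma frac_leftE al s f x : frac_left al s f x = (Gamma (1 - al))^-1 * dleft al s f x.
Proof. by []. Qed.

Lemma normc_Zfun al g u v : Normc.normc (Zfun al g u v) = `|(Gamma al)^-1 * dright al v g u|.
Proof. by rewrite /Zfun frac_rightE normcM_expi. Qed.

Definition gls_const al : R := (Gamma (1 - al))^-1 * (Gamma al)^-1.

(** The phases [exp (i pi al)] and [exp (- i pi al)] cancel; the imaginary part of
    the product is [cos * sin - sin * cos = 0]. *)
Lemma gls_integralE al s t f g :
  ointble s t (fun x => dleft al s f x * dright al t g x) ->
  gls_integral al s t f g = (gls_const al * gls al s t f g)%:C.
Proof.
move=> i.
pose h x := gls_const al * (dleft al s f x * dright al t g x).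
have hi : ointble s t h by exact: ointbleZ.
have hE : oint s t h = gls_const al * gls al s t f g by rewrite ointZ.
have eqc (D : set R) (u v : R -> R) : u = v ->
   \int[lebesgue_measure]_(x in D) u x = \int[lebesgue_measure]_(x in D) v x by move=> ->.
rewrite /gls_integral /cintegral.
rewrite (eqc _ _ (fun x => cos (- (pi * al)) * h x)); last first.
  apply/funext => x; rewrite frac_rightE frac_leftE /h /gls_const /expi /=.
  by generalize (dleft al s f x) (dright al t g x) (Gamma (1 - al))^-1 (Gamma al)^-1; intros;
    ring.
rewrite (eqc _ (fun x => complex.Im _) (fun x => sin (- (pi * al)) * h x)); last first.
  apply/funext => x; rewrite frac_rightE frac_leftE /h /gls_const /expi /=.
  by generalize (dleft al s f x) (dright al t g x) (Gamma (1 - al))^-1 (Gamma al)^-1; intros;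
    ring.
rewrite !oint_closed; [|exact: ointbleZ|exact: ointbleZ].
rewrite !ointZ// -hE cosN sinN.
have := cos2Dsin2 (pi * al); set I := oint _ _ _; set c := cos _; set s1 := sin _ => cs.
apply/eqP; rewrite eq_complex /expi /= -/c -/s1; apply/andP; split; apply/eqP.
  by rewrite -[RHS]mul1r -cs; ring.
by ring.
Qed.

End ComplexIntegral.

(** * Square-exponential moments of Gaussian variables *)

Section GaussianMoments.
Context {R : realType}.
Notation mu := (@lebesgue_measure R).
Implicit Types (m s x c v : R).

Lemma ge0_integral_normal_prob m s (F : R -> \bar R) :
  measurable_fun setT F -> (forall x, 0 <= F x)%E ->
  (\int[normal_prob m s]_x F x = \int[mu]_x (F x * (normal_pdf m s x)%:E))%E.
Proof.
move=> mF F0.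
have dom : normal_prob m s `<< mu by exact: normal_prob_dominates.
rewrite -(Radon_Nikodym_SigmaFinite.change_of_variables dom)//.
apply: ae_eq_integral => //.
- apply: emeasurable_funM => //; apply: (measurable_int mu).
  exact: Radon_Nikodym_SigmaFinite.f_integrable.
- apply: emeasurable_funM => //; apply/measurable_EFinP.
  exact: measurable_normal_pdf.
- apply: ae_eqe_mul2l; apply: integral_ae_eq => //.
  + exact: Radon_Nikodym_SigmaFinite.f_integrable.
  + by apply/measurable_EFinP; exact: measurable_normal_pdf.
  + by move=> E _ mE; rewrite -Radon_Nikodym_SigmaFinite.f_integral.
Qed.

(** Small enough for every Gaussian [Y] with [E Y^2 > 0], centred or not, to satisfy
    [E exp (gauss_rate * Y^2 / E Y^2) <= gauss_bound]. *)
Definition gauss_rate : R := (64 * expR 2)^-1.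
Definition gauss_bound : R := expR 1 * Num.sqrt 2 + expR 1.

Lemma gauss_rate_gt0 : 0 < gauss_rate.
Proof. by rewrite invr_gt0 mulr_gt0// expR_gt0. Qed.

(** On an interval of length [s] at distance at most [2 s] from the mean, the
    density is at least [exp (- 2) / (s sqrt (2 pi))]. *)
Lemma normal_prob_lb m s a b : 0 < s -> b - a = s ->
  (forall x, a <= x <= b -> `|x - m| <= 2 * s) ->
  ((expR 2 * Num.sqrt (2 * pi))^-1%:E <= normal_prob m s `[a, b]%classic)%E.
Proof.
move=> s0 bas H.
have sn0 : s != 0 by rewrite gt_eqF.
pose k : R := normal_peak s * expR (- 2).
have -> : (expR 2 * Num.sqrt (2 * pi))^-1 = k * s.
  rewrite /k /normal_peak expRN.
  rewrite (_ : s ^+ 2 * pi *+ 2 = s ^+ 2 * (2 * pi)); last by rewrite -mulr_natl; ring.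
  rewrite (sqrtrM _ (sqr_ge0 s)) sqrtr_sqr gtr0_norm//.
  have e0 : expR 2 != 0 :> R by rewrite gt_eqF ?expR_gt0.
  have p0 : Num.sqrt (2 * pi) != 0 :> R by rewrite gt_eqF// sqrtr_gt0 mulr_gt0 ?pi_gt0.
  by field; rewrite sn0 e0 p0.
have -> : ((k * s)%:E = \int[mu]_(x in `[a, b]) (cst k%:E x))%E.
  rewrite integral_cst//=.
  have -> : mu `[a, b]%classic = (b - a)%:E.
    by rewrite lebesgue_measure_itv/= lte_fin ifT ?EFinB//; lra.
  by rewrite bas.
rewrite /normal_prob; apply: ge0_le_integral => //.
- by move=> x _; rewrite lee_fin mulr_ge0 ?normal_peak_ge0 ?expR_ge0.
- by apply/measurable_EFinP/measurable_funTS; exact: measurable_normal_pdf.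
move=> x /=; rewrite in_itv/= => /H xm; rewrite lee_fin normal_pdfE// /k.
apply: ler_wpM2l; first exact: normal_peak_ge0.
rewrite /normal_fun ler_expR mulNr lerN2 ler_pdivrMr; last by rewrite pmulrn_lgt0// exprn_gt0.
have : (x - m) ^+ 2 <= (2 * s) ^+ 2.
  by rewrite -[leLHS]real_normK ?num_real// lerXn2r// nnegrE mulr_ge0// ltW.
rewrite -mulr_natl; lra.
Qed.

(** By [x^2 <= 2 (x - m)^2 + 2 m^2], the factor [exp (c x^2 / v)] at most doubles
    the variance in the exponent of the density, up to the factor [e]. *)
Lemma normal_exp_sq m s v : 0 < s -> 0 < v -> m ^+ 2 + s ^+ 2 <= 8 * expR 2 * v ->
  (\int[normal_prob m s]_x (expR (gauss_rate * x ^+ 2 / v))%:E <= gauss_bound%:E)%E.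
Proof.
move=> s0 v0 H.
have sn0 : s != 0 by rewrite gt_eqF.
have e2 : 0 < expR 2 :> R by exact: expR_gt0.
have s2 : 0 < s ^+ 2 by exact: exprn_gt0.
have m2 : 0 <= m ^+ 2 by exact: sqr_ge0.
pose r := Num.sqrt 2 * s.
have r0 : 0 < r by rewrite mulr_gt0// sqrtr_gt0.
have r2 : r ^+ 2 = 2 * s ^+ 2 by rewrite exprMn sqr_sqrtr.
rewrite ge0_integral_normal_prob; last 2 first.
- by apply/measurable_EFinP; apply: measurableT_comp => //; do 2 apply: measurable_funM => //.
- by move=> x; rewrite lee_fin expR_ge0.
apply: (@le_trans _ _ (\int[mu]_x ((expR 1 * Num.sqrt 2)%:E * (normal_pdf m r x)%:E)))%E;
  last first.
  have mp : measurable_fun setT (fun x => (normal_pdf m r x)%:E).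
    by apply/measurable_EFinP; exact: measurable_normal_pdf.
  have k0 : (0 <= (expR 1 * Num.sqrt 2)%:E :> \bar R)%E.
    by rewrite lee_fin mulr_ge0 ?expR_ge0.
  have p0 x : setT x -> (0 <= (normal_pdf m r x)%:E)%E.
    by move=> _; rewrite lee_fin normal_pdf_ge0.
  rewrite (ge0_integralZl mu measurableT mp p0 k0).
  by rewrite integral_normal_pdf mule1 lee_fin lerDl expR_ge0.
apply: ge0_le_integral => //.
- by move=> x _; rewrite mule_ge0// lee_fin ?expR_ge0 ?normal_pdf_ge0.
- apply: emeasurable_funM; apply/measurable_EFinP; last exact: measurable_normal_pdf.
  by apply: measurableT_comp => //; do 2 apply: measurable_funM => //.
- by apply: emeasurable_funM => //; apply/measurable_EFinP; exact: measurable_normal_pdf.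
move=> x _; rewrite -!EFinM lee_fin !normal_pdfE ?(gt_eqF r0)//.
have pk : normal_peak s = Num.sqrt 2 * normal_peak r.
  rewrite /normal_peak r2.
  rewrite (_ : 2 * s ^+ 2 * pi *+ 2 = 2 * (s ^+ 2 * pi *+ 2)); last by rewrite -mulrA -mulrnAr.
  by rewrite (@sqrtrM _ 2)// invfM mulrA divff ?mul1r// gt_eqF// sqrtr_gt0.
rewrite /= pk.
set E1 := expR (gauss_rate * x ^+ 2 / v); set E2 := normal_fun m s x.
set E3 := normal_fun m r x; set E4 := normal_peak r; set E5 := Num.sqrt 2.
have -> : E1 * (E5 * E4 * E2) = E4 * (E5 * (E1 * E2)) by ring.
have -> : expR 1 * E5 * (E4 * E3) = E4 * (E5 * (expR 1 * E3)) by ring.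
rewrite /E1 /E2 /E3 /E4 /E5.
apply: ler_wpM2l; first exact: normal_peak_ge0.
apply: ler_wpM2l; first exact: sqrtr_ge0.
rewrite /normal_fun -!expRD ler_expR r2 /gauss_rate.
have x2 : x ^+ 2 <= 2 * (x - m) ^+ 2 + 2 * m ^+ 2.
  have := sqr_ge0 (x - m - m); nra.
have iv : (64 * expR 2)^-1 / v <= (8 * (m ^+ 2 + s ^+ 2))^-1.
  rewrite -invfM lef_pV2 ?posrE; last 2 first.
  - by rewrite !mulr_gt0.
  - by rewrite mulr_gt0// ltr_wpDl.
  nra.
have iv2 : (8 * (m ^+ 2 + s ^+ 2))^-1 * m ^+ 2 <= 8^-1.
  rewrite invfM -mulrA ler_piMr ?invr_ge0// mulrC ler_pdivrMr; last by rewrite ltr_wpDl.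
  by rewrite mul1r lerDl ltW.
have iv3 : (8 * (m ^+ 2 + s ^+ 2))^-1 <= (8 * s ^+ 2)^-1.
  by rewrite lef_pV2 ?posrE ?mulr_gt0// ?ler_pM2l// ?lerDr// ltr_wpDl.
have w0 : 0 <= (x - m) ^+ 2 by exact: sqr_ge0.
have q0 : 0 <= (8 * (m ^+ 2 + s ^+ 2))^-1 by rewrite invr_ge0 mulr_ge0// addr_ge0// ltW.
have step1 : (64 * expR 2)^-1 * x ^+ 2 / v <= (8 * (m ^+ 2 + s ^+ 2))^-1 * (2 * (x - m) ^+ 2 +
  2 * m ^+ 2).
  rewrite mulrAC; apply: ler_pM => //; last exact: sqr_ge0.
  by rewrite divr_ge0 ?invr_ge0 ?mulr_ge0 ?ltW.
have step2 : (8 * (m ^+ 2 + s ^+ 2))^-1 * (2 * (x - m) ^+ 2 + 2 * m ^+ 2) <=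
   (4 * s ^+ 2)^-1 * (x - m) ^+ 2 + 4^-1.
  rewrite mulrDr; apply: lerD.
    rewrite mulrA; apply: ler_wpM2r => //.
    have : (8 * (m ^+ 2 + s ^+ 2))^-1 * 2 <= (8 * s ^+ 2)^-1 * 2 by exact: ler_wpM2r.
    move=> /le_trans; apply; rewrite le_eqVlt; apply/orP; left; apply/eqP.
    by field; rewrite sn0.
  by rewrite mulrCA; move: iv2; lra.
have f1 : - (x - m) ^+ 2 / (s ^+ 2 *+ 2) = - (2 * ((4 * s ^+ 2)^-1 * (x - m) ^+ 2)).
  by rewrite -mulr_natl; field; rewrite sn0.
have f2 : - (x - m) ^+ 2 / (2 * s ^+ 2 *+ 2) = - ((4 * s ^+ 2)^-1 * (x - m) ^+ 2).
  by rewrite -mulr_natl; field; rewrite sn0.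
rewrite f1 f2; move: (le_trans step1 step2); lra.
Qed.

Lemma integral_law d (T : measurableType d) (P : probability T R) (Y : T -> R)
    (nu : {measure set (measurableTypeR R) -> \bar R}) :
  measurable_fun setT Y ->
  (forall A : set R, measurable A -> pushforward P Y A = nu A) ->
  forall F : R -> \bar R, measurable_fun setT F -> (forall x, (0 <= F x)%E) ->
  (\int[P]_w F (Y w) = \int[nu]_x F x)%E.
Proof.
move=> mY HY F mF F0.
pose Z : T -> measurableTypeR R := Y.
have mZ : measurable_fun setT Z by exact: mY.
have := @ge0_integral_pushforward _ _ T (measurableTypeR R) R Z mZ P setT F measurableT mF.
rewrite preimage_setT => <-; last by [].
apply: eq_measure_integral => A mA _; exact: HY.
Qed.

(** The second moment [v] dominates [m^2 + s^2] up to a constant: the interval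
    [[m + s, m + 2 s]], or its mirror image if [m < 0], carries a fixed mass, and
    there [x^2 >= m^2 + s^2]. *)
Lemma gauss_sq_exp d (T : measurableType d) (P : probability T R) (Y : T -> R) v :
  measurable_fun setT Y -> gaussian P Y -> 0 < v -> (\int[P]_w ((Y w) ^+ 2)%:E = v%:E)%E ->
  (\int[P]_w (expR (gauss_rate * (Y w) ^+ 2 / v))%:E <= gauss_bound%:E)%E.
Proof.
move=> mY gY v0 EY.
have e2 : 0 < expR 2 :> R by exact: expR_gt0.
have mF : measurable_fun setT (fun x : R => (expR (gauss_rate * x ^+ 2 / v))%:E).
  by apply/measurable_EFinP; apply: measurableT_comp => //; do 2 apply: measurable_funM => //.
have mS : measurable_fun setT (fun x : R => (x ^+ 2)%:E).
  by apply/measurable_EFinP.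
have F0 x : (0 <= (expR (gauss_rate * x ^+ 2 / v))%:E)%E by rewrite lee_fin expR_ge0.
have S0 x : (0 <= (x ^+ 2)%:E :> \bar R)%E by rewrite lee_fin sqr_ge0.
case: gY => [[m [s [s0 HY]]]|[m HY]].
- have EYn : (\int[normal_prob m s]_x (x ^+ 2)%:E = v%:E)%E.
    by rewrite -EY; apply/esym; exact: (integral_law mY HY mS S0).
  rewrite (integral_law mY HY mF F0).
  apply: normal_exp_sq => //.
  pose mass : R := (expR 2 * Num.sqrt (2 * pi))^-1.
  have mass0 : 0 < mass by rewrite invr_gt0 mulr_gt0// sqrtr_gt0 mulr_gt0 ?pi_gt0.
  have key a b : b - a = s -> (forall x, a <= x <= b -> `|x - m| <= 2 * s) ->
      (forall x, a <= x <= b -> m ^+ 2 + s ^+ 2 <= x ^+ 2) -> (m ^+ 2 + s ^+ 2) * mass <= v.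
    move=> ba H1 H2; have lb := normal_prob_lb s0 ba H1.
    rewrite -lee_fin -EYn EFinM.
    apply: (@le_trans _ _ (\int[normal_prob m s]_(x in `[a, b]) (cst (m ^+ 2 + s ^+ 2)%:E x))%E).
      rewrite integral_cst//=; apply: lee_wpmul2l => //.
      by rewrite lee_fin addr_ge0 ?sqr_ge0.
    apply: (@le_trans _ _ (\int[normal_prob m s]_(x in `[a, b]) (x ^+ 2)%:E)%E).
      apply: ge0_le_integral => //.
      + by move=> x _; rewrite lee_fin addr_ge0 ?sqr_ge0.
      + exact: measurable_funTS.
    exact: ge0_subset_integral.
  have kk : (m ^+ 2 + s ^+ 2) * mass <= v.
    have [m0|m0] := leP 0 m.
      apply: (key (m + s) (m + 2 * s)); first by ring.
        by move=> x /andP[x1 x2]; rewrite ger0_norm; lra.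
      by move=> x /andP[x1 x2]; nra.
    apply: (key (m - 2 * s) (m - s)); first by ring.
      by move=> x /andP[x1 x2]; rewrite ler0_norm; lra.
    by move=> x /andP[x1 x2]; nra.
  have pi8 : Num.sqrt (2 * pi) <= 8 :> R.
    have -> : 8 = Num.sqrt (8 ^+ 2) :> R by rewrite sqrtr_sqr ger0_norm.
    rewrite ler_wsqrtr//.
    by have := pihalf_lt2 R; lra.
  have : (m ^+ 2 + s ^+ 2) <= v * (expR 2 * Num.sqrt (2 * pi)).
    rewrite -ler_pdivrMr ?mulr_gt0 ?sqrtr_gt0 ?mulr_gt0 ?pi_gt0//.
  move=> /le_trans; apply.
  rewrite (mulrC v) (mulrC 8); apply: ler_wpM2r; first exact: ltW.
  by apply: ler_wpM2l; [exact: ltW|].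
- have EYn : (\int[\d_(m : measurableTypeR R)]_x (x ^+ 2)%:E = v%:E)%E.
    by rewrite -EY; apply/esym; exact: (@integral_law _ _ _ _ (\d_(m :
      measurableTypeR R)) mY HY _ mS S0).
  rewrite integral_dirac// diracE mem_set// mul1e in EYn.
  rewrite (@integral_law _ _ _ _ (\d_(m : measurableTypeR R)) mY HY _ mF F0).
  rewrite integral_dirac// diracE mem_set// mul1e lee_fin.
  move: EYn => [->]; rewrite mulfK ?gt_eqF//.
  apply: (@le_trans _ _ (expR 1)); last by rewrite /gauss_bound lerDr mulr_ge0 ?expR_ge0
    ?sqrtr_ge0.
  rewrite ler_expR /gauss_rate invf_le1 ?mulr_gt0//.
  have := @expR_ge1Dx R 2; lra.
Qed.

End GaussianMoments.

(** * Dyadic chaining *)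

Section Chaining.
Context {R : realType}.
Implicit Types (s t mu A : R) (n k j : nat).

Definition dyadic_point k j : R := j%:R / 2 ^+ k.

Definition dyadic_floor k t : R := dyadic_point k (Num.truncn (t * 2 ^+ k)).

Let two k : (0 : R) < 2 ^+ k. Proof. exact: exprn_gt0. Qed.

Lemma dyadic_floor_itv k t : 0 <= t ->
  dyadic_floor k t <= t /\ t < dyadic_floor k t + 2^-1 ^+ k.
Proof.
move=> t0; have t2 : 0 <= t * 2 ^+ k by rewrite mulr_ge0// ltW.
have /andP[h1 h2] := truncn_itv t2.
rewrite /dyadic_floor /dyadic_point; split.
  by rewrite ler_pdivrMr.
by rewrite exprVn -[X in _ < _ + X]mul1r -mulrDl ltr_pdivlMr// natr1.
Qed.

Lemma powR_half_expn mu k : (2^-1 ^+ k : R) `^ mu = ((2 : R) `^ (- mu)) ^+ k.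
Proof.
rewrite -powR_mulrn ?invr_ge0// -powRrM -powR_mulrn ?powR_ge0// -powRrM.
rewrite -[X in X `^ (k%:R * mu)]powR_inv1// -powRrM; congr (_ `^ _); ring.
Qed.

Definition chain_cst (mu : R) : R := 2 * (1 + 2 / (1 - 2 `^ (- mu))).

Lemma chain_cst_ge0 mu : 0 < mu -> 0 <= chain_cst mu.
Proof.
move=> /powR2N_itv /andP[_ q1].
by rewrite mulr_ge0// addr_ge0// divr_ge0// subr_ge0 ltW.
Qed.

(** The increment over [[s, t]] is split at the dyadic floors of [s] and [t] on the
    scale of [t - s]; from there each point is the limit of its dyadic floors, and
    the increments between successive scales form a geometric series.  The Hoelder
    continuity with the uncontrolled constant [C] serves only to pass to the limit. *)
Lemma dyadic_chaining (g : R -> R) (T0 A mu C lam : R) : 0 < mu -> mu <= 1 -> 0 < lam -> 0 <= A ->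
  (forall k j, dyadic_point k j.+1 <= T0 ->
     `|g (dyadic_point k j.+1) - g (dyadic_point k j)| <= A * (2^-1 ^+ k) `^ mu) ->
  hoelder_on 0 T0 C lam g ->
  forall s t, 0 <= s -> s <= t -> t <= T0 -> t <= s + 1 ->
    `|g t - g s| <= chain_cst mu * A * (t - s) `^ mu.
Proof.
move=> mu0 mu1 lam0 A0 HA gC s t s0 st tT ts1.
pose q : R := 2 `^ (- mu).
have /andP[q0 q1] : 0 <= q < 1 by exact: powR2N_itv.
have q10 : 0 < 1 - q by rewrite subr_gt0.
have HAq k j : dyadic_point k j.+1 <= T0 ->
    `|g (dyadic_point k j.+1) - g (dyadic_point k j)| <= A * q ^+ k.
  by move=> /HA; rewrite powR_half_expn.
(* The floors of [u] at the levels [k] and [k + 1] coincide or are neighbours at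
   the level [k + 1]. *)
have refine1 u k : 0 <= u -> u <= T0 -> `|g (dyadic_floor k.+1 u) - g (dyadic_floor k u)| <=
  A * q ^+ k.+1.
  move=> u0 uT; rewrite /dyadic_floor.
  set j := Num.truncn (u * 2 ^+ k).
  have /andP[h1 h2] : j%:R <= u * 2 ^+ k < j.+1%:R by apply: truncn_itv; rewrite mulr_ge0// ltW.
  have u2 : 0 <= u * 2 ^+ k.+1 by rewrite mulr_ge0// ltW.
  set i := Num.truncn (u * 2 ^+ k.+1).
  have /andP[h3 h4] : i%:R <= u * 2 ^+ k.+1 < i.+1%:R by exact: truncn_itv.
  have E : u * 2 ^+ k.+1 = 2 * (u * 2 ^+ k) by rewrite exprS; ring.
  rewrite E in h3 h4.
  have i1 : (j.*2 <= i)%N.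
    rewrite -ltnS -(ltr_nat R); apply: le_lt_trans h4.
    by rewrite -mul2n natrM ler_pM2l.
  have i2 : (i < j.*2.+2)%N.
    rewrite -(ltr_nat R); apply: le_lt_trans h3 _.
    by rewrite (_ : j.*2.+2 = 2 * j.+1)%N ?natrM ?ltr_pM2l// mul2n doubleS.
  have P2 : dyadic_point k j = dyadic_point k.+1 j.*2.
    rewrite /dyadic_point -mul2n natrM exprS invfM mulrACA divff ?mul1r//.
  have [ie|io] : i = j.*2 \/ i = j.*2.+1.
    by move: i1 i2; rewrite !ltnS leq_eqVlt => /orP[/eqP->|a1 a2]; [left|right; apply/eqP;
      rewrite eqn_leq a2].
    by rewrite ie P2 subrr normr0 mulr_ge0// exprn_ge0.
  rewrite io P2; apply: HAq; rewrite -io.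
  apply: le_trans uT; rewrite /dyadic_point ler_pdivrMr// E; exact: h3.
have refine u k p : 0 <= u -> u <= T0 ->
    `|g (dyadic_floor (k + p) u) - g (dyadic_floor k u)| <=
      A * ((q ^+ k - q ^+ (k + p)) / (1 - q)).
  move=> u0 uT; elim: p => [|p IH]; first by rewrite addn0 !subrr normr0 mul0r mulr0.
  rewrite addnS.
  rewrite (_ : g _ - _ = (g (dyadic_floor (k + p).+1 u) - g (dyadic_floor (k + p) u)) +
    (g (dyadic_floor (k + p) u) - g (dyadic_floor k u))); last by ring.
  apply: le_trans (ler_normD _ _) _; apply: le_trans (lerD (refine1 u (k + p)%N u0 uT) IH) _.
  rewrite -mulrDr; apply: ler_wpM2l => //.
  rewrite ler_pdivlMr// mulrDl divfK ?gt_eqF//.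
  set Q := q ^+ (k + p); set Q0 := q ^+ k.
  have Q00 : 0 <= Q by exact: exprn_ge0.
  rewrite exprS -/Q; have := mulr_ge0 Q00 (sqr_ge0 (1 - q)); lra.
have limit u k : 0 <= u -> u <= T0 -> `|g u - g (dyadic_floor k u)| <= A * (q ^+ k / (1 - q)).
  move=> u0 uT.
  have /andP[r0 r1] := powR2N_itv lam0.
  apply: (@le_of_geometric _ _ _ (`|C| * (2 `^ (- lam)) ^+ k) (2 `^ (- lam))) => // p.
  rewrite (_ : g u - _ = (g (dyadic_floor (k + p) u) - g (dyadic_floor k u)) +
    (g u - g (dyadic_floor (k + p) u))); last by ring.
  apply: le_trans (ler_normD _ _) _; apply: lerD.
    apply: le_trans (refine u k p u0 uT) _; apply: ler_wpM2l => //.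
    by apply: ler_wpM2r; [rewrite invr_ge0 ltW|rewrite gerBl exprn_ge0].
  have [f1 f2] := dyadic_floor_itv (k + p) u0.
  have f0 : 0 <= dyadic_floor (k + p) u by rewrite divr_ge0// ltW.
  have := gC u (dyadic_floor (k + p) u); rewrite u0 uT f0 (le_trans f1 uT) => /(_ isT isT).
  move=> /le_trans; apply.
  rewrite -mulrA -exprD -powR_half_expn [`|u - _|]ger0_norm ?subr_ge0//.
  apply: (@le_trans _ _ (`|C| * (u - dyadic_floor (k + p) u) `^ lam)).
    by apply: ler_wpM2r; [exact: powR_ge0|exact: ler_norm].
  apply: ler_wpM2l => //.
  by apply: powR_le; [rewrite subr_ge0|rewrite lerBlDl ltW|exact: ltW].
have [->|st'] := eqVneq s t.
  rewrite !subrr normr0 powR0 ?gt_eqF// mulr0; exact: lexx.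
have ts0 : 0 < t - s by rewrite subr_gt0 lt_neqAle st' st.
(* The scale [n] with [2^-(n + 1) < t - s <= 2^-n]; at this scale the floors of
   [s] and [t] coincide or are neighbours. *)
have [n n1 n2] : exists2 n, 2^-1 ^+ n.+1 < t - s & t - s <= 2^-1 ^+ n.
  have cv : (fun n => 2^-1 ^+ n : R) @ \oo --> (0 : R).
    by apply: cvg_expr; rewrite ger0_norm ?invr_ge0// invf_lt1// ltr1n.
  have [N _ HN] : \forall n \near \oo, 2^-1 ^+ n < t - s.
    near=> n; near: n; exact: (cvgr_lt _ cv).
  have ex : exists n, 2^-1 ^+ n < t - s by exists N; apply: HN => /=.
  case: (ex_minnP ex) => [[|n]] Hn Hmin.
    by move: Hn; rewrite expr0; lra.
  exists n => //; rewrite leNgt; apply/negP => /Hmin; by rewrite ltnn.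
have sT : s <= T0 by exact: le_trans tT.
have t0 : 0 <= t by exact: le_trans st.
have h1 := limit t n t0 tT; have h2 := limit s n s0 sT.
have h3 : `|g (dyadic_floor n t) - g (dyadic_floor n s)| <= A * q ^+ n.
  rewrite /dyadic_floor.
  have t2 : 0 <= t * 2 ^+ n by rewrite mulr_ge0// ltW.
  have s2 : 0 <= s * 2 ^+ n by rewrite mulr_ge0// ltW.
  set j := Num.truncn (s * 2 ^+ n); set i := Num.truncn (t * 2 ^+ n).
  have /andP[a1 a2] : j%:R <= s * 2 ^+ n < j.+1%:R by exact: truncn_itv.
  have /andP[a3 a4] : i%:R <= t * 2 ^+ n < i.+1%:R by exact: truncn_itv.
  have i1 : (j <= i)%N.
    rewrite -ltnS -(ltr_nat R); apply: le_lt_trans a4; apply: le_trans a1 _.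
    by rewrite ler_pM2r.
  have i2 : (i < j.+2)%N.
    rewrite -(ltr_nat R); apply: le_lt_trans a3 _.
    have : t * 2 ^+ n <= s * 2 ^+ n + 1.
      by rewrite -lerBlDl -mulrBl -ler_pdivlMr// mul1r -exprVn.
    move=> /le_lt_trans; apply; rewrite -[j.+2%:R]natr1; lra.
  have [->|io] : i = j \/ i = j.+1.
    by move: i1 i2; rewrite !ltnS leq_eqVlt => /orP[/eqP->|b1 b2]; [left|right; apply/eqP;
      rewrite eqn_leq b2].
    by rewrite subrr normr0 mulr_ge0// exprn_ge0.
  rewrite io; apply: HAq; rewrite -io.
  by apply: le_trans tT; rewrite /dyadic_point ler_pdivrMr.
rewrite (_ : g t - g s = (g t - g (dyadic_floor n t)) +
  (g (dyadic_floor n t) - g (dyadic_floor n s))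
  - (g s - g (dyadic_floor n s))); last by ring.
apply: le_trans (ler_normB _ _) _; apply: le_trans (lerD (ler_normD _ _) h2) _.
apply: le_trans (lerD (lerD h1 h3) (lexx _)) _.
have qn : q ^+ n <= 2 * (t - s) `^ mu.
  rewrite -powR_half_expn (_ : 2^-1 ^+ n = 2 * 2^-1 ^+ n.+1);
    last by rewrite exprS mulrA divff ?mul1r.
  rewrite powRM ?exprn_ge0 ?invr_ge0//; apply: ler_pM; rewrite ?powR_ge0//.
    by rewrite -[leRHS]powRr1//; apply: ler_powR => //; rewrite ler1n.
  by apply: powR_le; [exact: exprn_ge0|exact: ltW|exact: ltW].
rewrite (_ : _ + _ = A * (1 + 2 / (1 - q)) * q ^+ n); last by ring.
rewrite [leRHS](_ : _ = A * (1 + 2 / (1 - q)) * (2 * (t - s) `^ mu));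
  last by rewrite /chain_cst -/q; ring.
apply: ler_wpM2l => //; apply: mulr_ge0 => //; apply: addr_ge0 => //.
by rewrite divr_ge0// ltW.
Unshelve. all: by end_near.
Qed.

End Chaining.

(** * A random variable dominating all dyadic increments *)

Section ExpSum.
Context d {T : measurableType d} {R : realType} (P : probability T R).

Let wt (n : nat) : R := (n.+1%:R * n.+2%:R)^-1.
Let wt_gt0 n : 0 < wt n. Proof. by rewrite invr_gt0 mulr_gt0. Qed.

Let sum_wt n : \sum_(0 <= i < n) wt i = 1 - n.+1%:R^-1.
Proof.
elim: n => [|n IH]; first by rewrite big_nil invr1 subrr.
rewrite big_nat_recr//= IH /wt.
have h1 : (n.+1%:R : R) != 0 by rewrite pnatr_eq0.
have h2 : (n.+2%:R : R) = n.+1%:R + 1 by rewrite -natr1.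
have h3 : (n.+1%:R + 1 : R) != 0 by rewrite -h2 pnatr_eq0.
rewrite h2; move: h1 h3; move: (n.+1%:R : R) => y h1 h3.
by field; rewrite h1 h3.
Qed.

(** [S = sum_n exp (V n) / ((n + 1) (n + 2))] has finite expectation, and
    [Z^2 = ln (e + S)] satisfies [exp (Z^2) = e + S]; comparing one term with the
    sum gives [V n <= Z^2 + ln ((n + 1) (n + 2))]. *)
Lemma exp_moment_sup (V : nat -> T -> R) (C : R) :
  (forall n, measurable_fun setT (V n)) ->
  (forall n, (\int[P]_w (expR (V n w))%:E <= C%:E)%E) ->
  exists Z : T -> R, [/\ measurable_fun setT Z, forall w, 1 <= Z w,
    (\int[P]_w (expR (Z w ^+ 2))%:E < +oo)%E &
    \forall w \ae P, forall n, V n w <= Z w ^+ 2 + 2 * ln n.+2%:R].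
Proof.
move=> mV EV.
pose f n w : \bar R := (wt n * expR (V n w))%:E.
have f0 n w : (0 <= f n w)%E by rewrite lee_fin mulr_ge0 ?expR_ge0// ltW.
have mf n : measurable_fun setT (f n).
  by apply/measurable_EFinP; apply: measurable_funM => //; exact: measurableT_comp.
pose S w : \bar R := (\sum_(n <oo) f n w)%E.
have S0 w : (0 <= S w)%E by apply: nneseries_ge0 => n _ _; exact: f0.
have mS : measurable_fun setT S.
  by apply: (@ge0_emeasurable_sum _ _ _ setT f xpredT) => // k x _ _; exact: f0.
have C0 : 0 <= C.
  by rewrite -lee_fin; apply: le_trans (EV 0%N); apply: integral_ge0 => w _;
    rewrite lee_fin expR_ge0.
have IS : (\int[P]_w S w <= C%:E)%E.
  rewrite integral_nneseries//.
  apply: lime_le.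
    by apply: is_cvg_nneseries => n _ _; apply: integral_ge0 => w _; exact: f0.
  apply: nearW => N.
  apply: (@le_trans _ _ (\sum_(0 <= i < N) (wt i * C)%:E)%E).
    apply: lee_sum => i _.
    under eq_integral do rewrite /f EFinM.
    have mi : measurable_fun setT (fun w => (expR (V i w))%:E).
      by apply/measurable_EFinP; exact: measurableT_comp.
    have k0 : (0 <= (wt i)%:E)%E by rewrite lee_fin ltW.
    have p0 w : setT w -> (0 <= (expR (V i w))%:E)%E by move=> _; rewrite lee_fin expR_ge0.
    rewrite (ge0_integralZl P measurableT mi p0 k0).
    by rewrite EFinM; apply: lee_wpmul2l => //; rewrite lee_fin ltW.
  rewrite sumEFin lee_fin -mulr_suml sum_wt ler_piMl// gerBl invr_ge0//.
have Si : P.-integrable setT S.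
  apply/integrableP; split => //.
  rewrite (eq_integral S); first by apply: le_lt_trans IS _; rewrite ltry.
  by move=> w _; rewrite gee0_abs.
pose Z w := (ln (expR 1 + fine (S w))) `^ 2^-1.
have mZ : measurable_fun setT Z.
  apply: (measurableT_comp (measurable_powR _)).
  apply: measurableT_comp; first exact: measurable_ln.
  by apply: measurable_funD => //; exact: measurableT_comp.
have fS0 w : 0 <= fine (S w) by exact: fine_ge0.
have e0 : 0 < expR 1 :> R by exact: expR_gt0.
have eS0 w : 0 < expR 1 + fine (S w) by rewrite ltr_wpDr.
have ln1 w : 1 <= ln (expR 1 + fine (S w)).
  by rewrite -[leLHS](expRK 1) ler_ln ?posrE// lerDl.
have ZX w : Z w ^+ 2 = ln (expR 1 + fine (S w)).
  have l0 : 0 <= ln (expR 1 + fine (S w)) by exact: le_trans (ln1 w).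
  by rewrite /Z powR12_sqrt// sqr_sqrtr.
exists Z; split.
- exact: mZ.
- move=> w; rewrite (_ : (1 <= Z w) = ((1 : R) `^ 2^-1 <= Z w)); last by rewrite powR1.
  rewrite /Z; apply: ge0_ler_powR; rewrite ?nnegrE//.
  by rewrite (le_trans _ (ln1 w)).
- apply: (@le_lt_trans _ _ (\int[P]_w ((expR 1)%:E + S w))%E).
    apply: ge0_le_integral => //.
    + by apply/measurable_EFinP; apply: measurableT_comp => //; exact: measurable_funX.
    + exact: emeasurable_funD.
    + move=> w _; rewrite ZX lnK ?posrE// EFinD leeD2l//.
      by move: (S0 w); case: (S w) => [r| |] //=; rewrite lee_fin.
  rewrite ge0_integralD//.
  have I1 : (\int[P]_w (expR 1)%:E = (expR 1)%:E)%E.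
    by have := expectation_cst P (expR 1); rewrite unlock.
  rewrite I1.
  by rewrite lte_add_pinfty ?ltry//; apply: le_lt_trans IS _; rewrite ltry.
- have := integrable_ae measurableT Si; apply: filterS => w /(_ I) Sfin n.
  have le1 : (f n w <= S w)%E.
    have h := @nneseries_lim_ge R (f^~ w) xpredT 0%N n.+1 (fun k _ _ => f0 k w).
    apply: le_trans h; rewrite big_nat_recr//= leeDr//.
    by apply: sume_ge0 => k _; exact: f0.
  have le2 : wt n * expR (V n w) <= expR 1 + fine (S w).
    have : wt n * expR (V n w) <= fine (S w) by rewrite -lee_fin fineK.
    by move=> /le_trans; apply; rewrite lerDr ltW.
  have l1 : 0 < (n.+1%:R : R) by [].
  have l2 : 0 < (n.+2%:R : R) by [].
  have le3 : expR (V n w) <= (expR 1 + fine (S w)) * (n.+1%:R * n.+2%:R).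
    by move: le2; rewrite /wt mulrC ler_pdivrMr ?mulr_gt0.
  rewrite ZX -[leLHS]expRK.
  apply: (@le_trans _ _ (ln ((expR 1 + fine (S w)) * (n.+1%:R * n.+2%:R)))).
    by rewrite ler_ln ?posrE ?expR_gt0// !mulr_gt0.
  rewrite !lnM ?posrE ?mulr_gt0// lerD2l (_ : 2 * _ = ln n.+2%:R + ln n.+2%:R); last by ring.
  by rewrite lerD2r ler_ln ?posrE// ler_nat.
Qed.

End ExpSum.

Section FBmIncrements.
Context d {T : measurableType d} {R : realType} (P : probability T R).
Variables (H : R) (B : R -> {RV P >-> R}).
Hypotheses (H0 : 0 < H) (B_fBm : fBm H B).

(** The increment is a linear combination of two values of the process, and its
    second moment follows from the covariance. *)
Lemma fBm_increment s t : 0 <= s -> s < t ->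
  gaussian P (fun w => B t w - B s w) /\
  (\int[P]_w ((B t w - B s w) ^+ 2)%:E = ((t - s) `^ (2 * H))%:E)%E.
Proof.
move=> s0 st; have [gB mB cB _] := B_fBm.
have t0 : 0 <= t by exact: le_trans (ltW st).
split.
  pose tt (i : 'I_2) := if i == ord0 then t else s.
  pose cc (i : 'I_2) : R := if i == ord0 then 1 else -1.
  have := gB 2%N tt cc; rewrite (_ : (fun w => _) = (fun w => B t w - B s w)).
    by apply => i; rewrite /tt; case: ifP.
  apply/funext => w; rewrite big_ord_recl big_ord1 /tt /cc /= mul1r mulN1r.
  by [].
have HH : 2 * H != 0 by rewrite mulf_neq0// gt_eqF.
have EBB u : 0 <= u -> (\int[P]_w (B u w * B u w)%:E = (u `^ (2 * H))%:E)%E.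
  move=> u0; have := cB u u u0 u0; rewrite unlock /= => ->.
  by rewrite subrr normr0 powR0// subr0; congr (_%:E); field.
have ETS : (\int[P]_w (B t w * B s w)%:E =
   (2^-1 * (s `^ (2 * H) + t `^ (2 * H) - (t - s) `^ (2 * H)))%:E)%E.
  have := cB s t s0 t0; rewrite unlock /= => ->.
  by rewrite gtr0_norm// subr_gt0.
have mBu u : measurable_fun setT (B u) by exact: measurable_funPT.
have mBB u v : measurable_fun setT (fun w => B u w * B v w) by exact: measurable_funM.
have Bi u : 0 <= u -> P.-integrable setT (EFin \o (fun w => B u w * B u w)).
  move=> u0; apply/integrableP; split; first exact/measurable_EFinP.
  rewrite (eq_integral (fun w => (B u w * B u w)%:E)); first by rewrite EBB// ltry.
  by move=> w _; rewrite /= ger0_norm// -expr2 sqr_ge0.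
have Bts : P.-integrable setT (EFin \o (fun w => B t w * B s w)).
  apply: (le_integrable measurableT _ _ (integrableD measurableT (Bi t t0) (Bi s s0))).
    exact/measurable_EFinP.
  move=> w _; rewrite /= lee_fin normrM [leRHS]ger0_norm; last first.
    by rewrite -!expr2 addr_ge0 ?sqr_ge0.
  have sqE (y : R) : y * y = `|y| * `|y| by rewrite -normrM ger0_norm// -expr2 sqr_ge0.
  rewrite (sqE (B t w)) (sqE (B s w)).
  by have := sqr_ge0 (`|B t w| - `|B s w|); nra.
have R1 : \int[P]_w (B t w * B t w) = t `^ (2 * H) by rewrite /Rintegral EBB.
have R2 : \int[P]_w (B s w * B s w) = s `^ (2 * H) by rewrite /Rintegral EBB.
have R3 : \int[P]_w (B t w * B s w) = 2^-1 * (s `^ (2 * H) + t `^ (2 * H) - (t - s) `^ (2 * H)).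
  by rewrite /Rintegral ETS.
have Bi2 : P.-integrable setT (EFin \o (fun w => 2 * (B t w * B s w))).
  have := integrableZl measurableT 2 Bts; exact: eq_integrable.
have Ii : P.-integrable setT (EFin \o (fun w => B t w * B t w - 2 * (B t w * B s w))).
  by have := integrableB measurableT (Bi t t0) Bi2; apply: eq_integrable.
have Iii : P.-integrable setT (EFin \o (fun w => B t w * B t w - 2 * (B t w * B s w) +
  B s w * B s w)).
  by have := integrableD measurableT Ii (Bi s s0); apply: eq_integrable.
have E (w : T) : (B t w - B s w) ^+ 2 = B t w * B t w - 2 * (B t w * B s w) +
  B s w * B s w by ring.
under eq_integral do rewrite E.
rewrite -[LHS]fineK; last exact: integrable_fin_num.
congr (_%:E); rewrite -/(Rintegral P setT (fun w => B t w * B t w - 2 * (B t w * B s w) +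
  B s w * B s w)).
rewrite (RintegralD measurableT Ii (Bi s s0)) (RintegralB measurableT (Bi t t0) Bi2).
by rewrite (RintegralZl 2 measurableT Bts) R1 R2 R3; field.
Qed.

(** The pairs [(k, j)] of a dyadic scale and an index are enumerated by
    [n + 1 = 2^k (2 j + 1)]. *)
Definition dyad_exp (n : nat) : nat := logn 2 n.+1.
Definition dyad_idx (n : nat) : nat := (n.+1 %/ 2 ^ dyad_exp n)./2.

Lemma dyad_code k j : dyad_exp (2 ^ k * j.*2.+1).-1 = k /\ dyad_idx (2 ^ k * j.*2.+1).-1 = j.
Proof.
have m0 : (0 < 2 ^ k * j.*2.+1)%N by rewrite muln_gt0 expn_gt0.
have E : dyad_exp (2 ^ k * j.*2.+1).-1 = k.
  rewrite /dyad_exp prednK// lognM ?expn_gt0// pfactorK//.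
  by rewrite [X in (_ + X)%N]lognE /= dvdn2 /= odd_double /= addn0.
by split => //; rewrite /dyad_idx E prednK// mulKn ?expn_gt0// /= uphalf_double.
Qed.

Lemma dyadic_point_lt k j : (dyadic_point k j : R) < dyadic_point k j.+1.
Proof. by rewrite /dyadic_point ltr_pM2r ?invr_gt0 ?exprn_gt0// ltr_nat. Qed.

Lemma dyadic_point_ge0 k j : 0 <= (dyadic_point k j : R).
Proof. by rewrite divr_ge0// exprn_ge0. Qed.

Lemma dyadic_pointB k j : dyadic_point k j.+1 - dyadic_point k j = 2^-1 ^+ k :> R.
Proof. by rewrite /dyadic_point -mulrBl -natr1 addrC addKr mul1r exprVn. Qed.

Lemma fBm_dyadic_control : exists Z : T -> R, [/\ measurable_fun setT Z, forall w, 1 <= Z w,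
    (\int[P]_w (expR (Z w ^+ 2))%:E < +oo)%E &
    \forall w \ae P, forall k j,
      gauss_rate * (B (dyadic_point k j.+1) w - B (dyadic_point k j) w) ^+ 2 / (2^-1 ^+ k) `^ (2
        * H)
      <= Z w ^+ 2 + 2 * ln (2 ^ k * j.*2.+1).+1%:R].
Proof.
pose V k j w := gauss_rate * (B (dyadic_point k j.+1) w - B (dyadic_point k j) w) ^+ 2 / (2^-1
  ^+ k) `^ (2 * H).
pose W n w := V (dyad_exp n) (dyad_idx n) w.
have mD k j : measurable_fun setT (fun w => B (dyadic_point k j.+1) w - B (dyadic_point k j) w).
  by apply: measurable_funB; exact: measurable_funPT.
have mW n : measurable_fun setT (W n).
  by apply: measurable_funM => //; apply: measurable_funM => //; apply: measurable_funX;
    exact: mD.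
have EW n : (\int[P]_w (expR (W n w))%:E <= gauss_bound%:E)%E.
  have [g1 g2] := fBm_increment (dyadic_point_ge0 (dyad_exp n) (dyad_idx n)) (dyadic_point_lt _
    _).
  rewrite dyadic_pointB in g2.
  by apply: (gauss_sq_exp (mD _ _) g1 _ g2); rewrite powR_gt0// exprn_gt0// invr_gt0.
have [Z [mZ Z1 EZ HZ]] := exp_moment_sup mW EW.
exists Z; split => //; apply: filterS HZ => w Hw k j.
have := Hw (2 ^ k * j.*2.+1).-1; have [e1 e2] := dyad_code k j.
rewrite /W e1 e2 /V prednK//; by rewrite muln_gt0 expn_gt0.
Qed.

End FBmIncrements.

(** * Logarithmic modulus of continuity of the paths *)

Section LogBounds.
Context {R : realType}.
Implicit Types (x y p q : R).

Lemma ln2_ge : 2^-1 <= ln (2 : R).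
Proof.
have h : -1 < - (2^-1 : R) by lra.
have := le_ln1Dx h; have -> : 1 - (2^-1 : R) = 2^-1 by lra.
by rewrite lnV ?posrE//; lra.
Qed.

Lemma ln2_le : ln (2 : R) <= 1.
Proof.
have h : -1 < (1 : R) by lra.
by have := le_ln1Dx h; rewrite (_ : 1 + 1 = 2 :> R).
Qed.

Lemma ln_shift_ge x : 0 <= x -> 2^-1 <= ln (x + 2).
Proof.
move=> x0; apply: le_trans ln2_ge _; rewrite ler_ln ?posrE//; lra.
Qed.

(** [2 x >= 1] makes the power increasing in the exponent. *)
Lemma powR_change_exponent x p q : 2^-1 <= x -> p <= q -> x `^ p <= 2 `^ (q - p) * x `^ q.
Proof.
move=> x2 pq; have x0 : 0 <= x by lra.
have h : (2 * x) `^ p <= (2 * x) `^ q by apply: ler_powR => //; lra.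
rewrite !powRM// in h.
have p0 : 0 < (2 : R) `^ p by exact: powR_gt0.
by rewrite powRDp// powRN mulrAC ler_pdivlMr// mulrC.
Qed.

(** From [exp (x / (n + 1)) >= x / (n + 1)], raised to the power [n + 1]. *)
Lemma expn_le_expR x n : 1 <= x -> x ^+ n <= n.+1%:R ^+ n.+1 * expR x.
Proof.
move=> x1; have x0 : 0 <= x by exact: le_trans x1.
apply: (@le_trans _ _ (x ^+ n.+1)); first by rewrite ler_weXn2l.
have n0 : 0 < (n.+1%:R : R) by [].
have h : x / n.+1%:R <= expR (x / n.+1%:R).
  by apply: le_trans (expR_ge1Dx _); rewrite lerDr.
have -> : expR x = expR (x / n.+1%:R) ^+ n.+1.
  by rewrite -expRM_natl -mulr_natl mulrCA divff ?mulr1// gt_eqF.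
rewrite -exprMn; apply: lerXn2r; rewrite ?nnegrE ?mulr_ge0 ?expR_ge0//.
by rewrite -ler_pdivrMl// mulrC.
Qed.

End LogBounds.

Section FBmHoelder.
Context d {T : measurableType d} {R : realType} (P : probability T R).
Variables (H mu : R) (B : R -> {RV P >-> R}).
Hypotheses (mu0 : 0 < mu) (muH : mu < H) (H1 : H < 1) (B_fBm : fBm H B).

(** The power of the scale absorbs the linear growth in [k] that comes from the
    logarithm of the dyadic index. *)
Lemma scale_bound (k : nat) (e : R) : 0 < e -> e <= 1 ->
  k.+1%:R * (2^-1 ^+ k) `^ (2 * e) <= e^-1.
Proof.
move=> e0 e1.
have E : (2^-1 ^+ k : R) `^ (2 * e) = expR (- (2 * e * (k%:R * ln 2))).
  rewrite exprVn /powR gt_eqF ?invr_gt0 ?exprn_gt0// lnV ?posrE ?exprn_gt0//.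
  by rewrite lnXn// mulrN (mulr_natl (ln 2)).
rewrite E expRN ler_pdivrMr ?expR_gt0// -ler_pdivrMl ?invr_gt0// invrK.
apply: le_trans (expR_ge1Dx _).
have k0 : 0 <= (k%:R : R) by [].
have kl : k%:R * 2^-1 <= k%:R * ln 2 :> R by rewrite ler_wpM2l// ln2_ge.
rewrite -natr1; nra.
Qed.

Definition fBm_cst : R := chain_cst mu * Num.sqrt (8 / (gauss_rate * (H - mu))).

Lemma fBm_cst_ge0 : 0 <= fBm_cst.
Proof. by apply: mulr_ge0; [exact: chain_cst_ge0|exact: sqrtr_ge0]. Qed.

(** The index of the dyadic increment [(k, j)] before time [S] is at most
    [2^(2 k + 1) (S + 2)], and its logarithm splits into a multiple of [k], absorbed
    by the margin [H - mu] through [scale_bound], and [ln (S + 2)]. *)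
Lemma fBm_path_hoelder : exists Z : T -> R, [/\ measurable_fun setT Z, forall w, 1 <= Z w,
    (\int[P]_w (expR (Z w ^+ 2))%:E < +oo)%E &
    \forall w \ae P, forall S s t, 0 <= s -> s <= t -> t <= S -> t <= s + 1 ->
      `|B t w - B s w| <= fBm_cst * (Z w * ln (S + 2) `^ 2^-1) * (t - s) `^ mu].
Proof.
have H0 : 0 < H by exact: lt_trans muH.
have [Z [mZ Z1 EZ HZ]] := fBm_dyadic_control H0 B_fBm.
have [_ _ _ Bh] := B_fBm.
exists Z; split => //.
apply: filterS2 HZ Bh => w HZ Bh S s t s0 st tS ts1.
pose e := H - mu; have e0 : 0 < e by rewrite subr_gt0.
have e1 : e <= 1 by rewrite /e; move: mu0 muH H1; lra.
have S0 : 0 <= S by lra.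
have c0 : 0 < gauss_rate :> R by exact: gauss_rate_gt0.
pose l := ln (S + 2); have l2 : 2^-1 <= l by exact: ln_shift_ge.
have l0 : 0 <= l by lra.
pose A := Num.sqrt (8 / (gauss_rate * e)) * (Z w * l `^ 2^-1).
have z1 := Z1 w; have Z0 : 0 <= Z w by lra.
have A0 : 0 <= A by rewrite mulr_ge0 ?sqrtr_ge0// mulr_ge0// powR_ge0.
have A2 : A ^+ 2 = 8 / (gauss_rate * e) * (Z w ^+ 2 * l).
  rewrite exprMn sqr_sqrtr; last by rewrite divr_ge0// mulr_ge0// ltW.
  by rewrite exprMn powR12_sqrt// sqr_sqrtr.
have HA k j : dyadic_point k j.+1 <= S ->
    `|B (dyadic_point k j.+1) w - B (dyadic_point k j) w| <= A * (2^-1 ^+ k) `^ mu.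
  move=> jS; have := HZ k j.
  set D := B (dyadic_point k j.+1) w - B (dyadic_point k j) w.
  set p := 2^-1 ^+ k => hD.
  have p0 : 0 < p by rewrite exprn_gt0// invr_gt0.
  have N0 : 0 < ((2 ^ k * j.*2.+1).+1%:R : R) by [].
  have lnN : ln (2 ^ k * j.*2.+1).+1%:R <= (2 * k%:R + 1) + l.
    have jS' : j.+1%:R <= S * 2 ^+ k by move: jS; rewrite /dyadic_point ler_pdivrMr ?exprn_gt0.
    have le1 : ((2 ^ k * j.*2.+1).+1%:R : R) <= 2 ^+ (2 * k).+1 * (S + 2).
      apply: (@le_trans _ _ (2 ^+ k.+1 * j.+1%:R)).
        rewrite -natrX -natrM ler_nat.
        have k1 : (0 < 2 ^ k)%N by rewrite expn_gt0.
        have -> : (2 ^ k.+1 * j.+1 = 2 ^ k * j.*2.+1 + 2 ^ k)%N.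
          by rewrite expnS -mulnA mulnCA mul2n doubleS mulnSr.
        by rewrite -addn1 leq_add2l.
      have -> : 2 ^+ (2 * k).+1 * (S + 2) = 2 ^+ k.+1 * ((S + 2) * 2 ^+ k) :> R.
        by rewrite mul2n -addnn -addSn exprD; ring.
      apply: ler_wpM2l; first exact: exprn_ge0.
      apply: le_trans jS' _; apply: ler_wpM2r; first exact: exprn_ge0.
      by rewrite lerDl.
    apply: (@le_trans _ _ (ln (2 ^+ (2 * k).+1 * (S + 2)))).
      by rewrite ler_ln ?posrE// mulr_gt0 ?exprn_gt0//; lra.
    rewrite lnM ?posrE ?exprn_gt0//; last lra.
    rewrite lerD2r lnXn// -(mulr_natl (ln 2)) -natr1 natrM.
    rewrite -[leRHS]mulr1; apply: ler_wpM2l; first by rewrite addr_ge0.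
    exact: ln2_le.
  have zz : 1 <= Z w ^+ 2 by rewrite -[leLHS](expr1n _ 2) lerXn2r// nnegrE.
  have k0 : 0 <= (k%:R : R) by [].
  have b1 : Z w ^+ 2 + 2 * ln (2 ^ k * j.*2.+1).+1%:R <= 8 * k.+1%:R * (Z w ^+ 2 * l).
    rewrite -natr1; set zw := Z w ^+ 2 in zz *.
    have q1 : zw <= 2 * (zw * l) by nra.
    have q2 : l <= zw * l by nra.
    have q3 : 1 <= 2 * (zw * l) by lra.
    have q4 : k%:R <= 2 * (zw * l) * k%:R by rewrite ler_peMl.
    lra.
  have D2 : D ^+ 2 <= A ^+ 2 * p `^ (2 * mu).
    have pH : p `^ (2 * H) = p `^ (2 * mu) * p `^ (2 * e).
      by rewrite -powRDp//; congr (_ `^ _); rewrite /e; ring.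
    have pm0 : 0 <= p `^ (2 * mu) by exact: powR_ge0.
    have sb := scale_bound k e0 e1; rewrite -/p in sb.
    have h := le_trans hD b1.
    rewrite ler_pdivrMr ?powR_gt0// pH in h.
    rewrite A2 -ler_pdivlMl// in h *.
    apply: le_trans h _.
    have zl : 0 <= 8 * (Z w ^+ 2 * l) / gauss_rate * p `^ (2 * mu).
      by rewrite !mulr_ge0 ?invr_ge0 ?sqr_ge0// ltW.
    have := ler_wpM2l zl sb.
    rewrite (_ : _ * (k.+1%:R * _) = gauss_rate^-1 * (8 * k.+1%:R * (Z w ^+ 2 * l) * (p `^ (2 *
      mu) * p `^ (2 * e)))); last by ring.
    move=> /le_trans; apply; rewrite le_eqVlt; apply/orP; left; apply/eqP.
    by field; rewrite !gt_eqF.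
  rewrite -(@ler_pXn2r _ 2)// ?nnegrE ?mulr_ge0 ?powR_ge0//.
  rewrite real_normK ?num_real// exprMn -(powR_mulrn 2 (powR_ge0 _ _)) -powRrM.
  by rewrite (mulrC mu).
have [S00|S0'] := eqVneq S 0.
  have -> : t = s by lra.
  rewrite subrr normr0; apply: mulr_ge0; last exact: powR_ge0.
  by apply: mulr_ge0; [exact: fBm_cst_ge0|apply: mulr_ge0 => //; exact: powR_ge0].
have {}S0' : 0 < S by rewrite lt_neqAle eq_sym S0' S0.
have [C HC] := Bh mu (introT andP (conj mu0 muH)) S S0'.
have hC : hoelder_on 0 S C mu (fun t => B t w).
  by move=> y z yi zi; exact: HC.
have mu1 : mu <= 1 by move: mu0 muH H1; lra.
have := dyadic_chaining mu0 mu1 mu0 A0 HA hC s0 st tS ts1.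
by rewrite /A /fBm_cst -/e /l !mulrA.
Qed.

End FBmHoelder.

(** * Pathwise bounds for the solution and for the fractional derivative *)

Section PathBounds.
Context {R : realType}.
Variables (al mu be : R).
Hypotheses (al01 : 0 < al < 1) (al_mu : 1 - al < mu) (al_mu' : al < mu) (mu1 : mu < 1).
Hypotheses (be0 : 0 < be) (be_mu : be <= mu).
Let mu0 : 0 < mu. Proof. by move: al01 => /andP[a0 _]; exact: lt_trans a0 al_mu'. Qed.

Lemma ointble_gls_on M G f g S t : 0 <= M -> 0 <= G ->
  hoelder_on 0 S M mu f -> hoelder_on 0 S G mu g -> 0 <= t -> t <= S ->
  ointble 0 t (fun x => dleft al 0 f x * dright al t g x).
Proof.
move=> M0 G0 fM gG t0 tS; have S0 : 0 <= S by exact: le_trans tS.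
have fM' := is_hoelder_clamp S0 mu0 M0 fM.
have gG' := is_hoelder_clamp S0 mu0 G0 gG.
have := ointble_gls al01 al_mu gG' al_mu' fM' 0 t0.
apply: eq_ointble => x /andP[x0 xt]; congr (_ * _).
  rewrite (_ : (fun y => f (clamp 0 S y) - 0) = (fun y => f (clamp 0 S y))).
    apply: eq_dleft (ltW x0) _ => y /andP[y0 yx]; rewrite clamp_id// y0.
    by rewrite (le_trans yx)// (le_trans (ltW xt)).
  by apply/funext => y; rewrite subr0.
apply: eq_dright (ltW xt) _ => y /andP[xy yt]; rewrite clamp_id//.
by rewrite (le_trans (ltW x0) xy) (le_trans yt tS).
Qed.

(** The complex equation reduces to its real part, in which all Gamma factors are
    collected in [gls_const]. *)
Lemma sde_path_eq (a b x B : R -> R) (x0 K L Mx Mg S t : R) : 0 <= K -> 0 <= L -> 0 <= Mx ->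
  0 <= Mg ->
  (forall y, `|a y| <= K) -> (forall y z, `|a y - a z| <= L * `|y - z|) ->
  (forall y z, `|b y - b z| <= L * `|y - z|) ->
  hoelder_on 0 S Mx mu x -> hoelder_on 0 S Mg mu B -> 0 <= t -> t <= S ->
  (x t)%:C%C = (x0 + \int[lebesgue_measure]_(s in `[0, t]) a (x s))%:C%C +
       gls_integral al 0 t (fun s => b (x s)) B ->
  x t = x0 + oint 0 t (fun s => a (x s)) + gls_const al * gls al 0 t (fun s => b (x s)) B.
Proof.
move=> K0 L0 Mx0 Mg0 aK aL bL xM BM t0 tS.
have bx : hoelder_on 0 S (L * Mx) mu (fun y => b (x y)) by exact: hoelder_on_comp.
have i1 := ointble_gls_on (mulr_ge0 L0 Mx0) Mg0 bx BM t0 tS.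
have i2 := ointble_a al01 al_mu' L0 aK aL Mx0 xM (lexx 0) tS.
rewrite (gls_integralE i1) (oint_closed i2).
by move=> E; exact: (congr1 (@complex.Re R) E).
Qed.

(** The exponents [1 / mu] of [G] and [mu] of the length are weakened to [1 / beta]
    and [beta], using [G >= 1] and [t - s <= 1]. *)
Lemma sde_path_increment (a b x B : R -> R) (x0 K L Mx Mg S G s t : R) :
  0 <= K -> 0 <= L -> 0 <= Mx -> 0 <= Mg ->
  (forall y, `|a y| <= K) -> (forall y, `|b y| <= K) ->
  (forall y z, `|a y - a z| <= L * `|y - z|) -> (forall y z, `|b y - b z| <= L * `|y - z|) ->
  hoelder_on 0 S Mx mu x -> hoelder_on 0 S Mg mu B ->
  (forall t, 0 <= t -> t <= S ->
    (x t)%:C%C = (x0 + \int[lebesgue_measure]_(s in `[0, t]) a (x s))%:C%C +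
       gls_integral al 0 t (fun s => b (x s)) B) ->
  1 <= G -> 0 <= s -> s < t -> t <= S -> t <= s + 1 -> hoelder_on s t G mu B ->
  `|x t - x s| <= path_cst al mu (gls_const al) K L * G `^ be^-1 * (t - s) `^ be.
Proof.
move=> K0 L0 Mx0 Mg0 aK bK aL bL xM BM xE G1 s0 st tS ts1 gG.
have xE' u : 0 <= u -> u <= S -> x u = x0 + oint 0 u (fun s => a (x s)) +
    gls_const al * gls al 0 u (fun s => b (x s)) B.
  move=> u0 uS; apply: (sde_path_eq K0 L0 Mx0 Mg0 aK aL bL xM BM u0 uS).
  exact: xE.
have C10 : 0 <= path_cst1 al mu (gls_const al) K.
  exact: (le_trans K0 (path_cst1_ge al01 al_mu _ K0)).
have C20 : 0 <= path_cst2 al mu (gls_const al) L by exact: path_cst2_ge0.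
have step := path_increment_bound al01 al_mu al_mu' mu1 K0 L0 aK bK aL bL Mx0 Mg0 xM BM xE'.
have := global_estimate mu0 mu1 C10 C20 Mx0 xM step G1 s0 (ltW st) tS ts1 gG.
rewrite -/(path_cst al mu (gls_const al) K L) => /le_trans; apply.
have Cp0 : 0 <= path_cst al mu (gls_const al) K L.
  by apply: mulr_ge0; [apply: mulr_ge0|exact: powR_ge0].
apply: ler_pM; rewrite ?powR_ge0//.
- by apply: mulr_ge0 => //; exact: powR_ge0.
- apply: ler_wpM2l => //; apply: ler_powR => //.
  by rewrite lef_pV2 ?posrE.
- by apply: ger_powR => //; rewrite subr_gt0 st /=; lra.
Qed.

Definition Lambda_cst : R := `|(Gamma al)^-1| * right_cst al mu.

(** [dright_bound] bounds [Z(u, v)] by a multiple of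
    [(v - u)^(mu + alpha - 1)], which is at most [(v - u)^(beta + alpha - 1)]. *)
Lemma Lambda_bound (B : R -> R) (G s t : R) : 0 <= G -> s < t -> t <= s + 1 ->
  hoelder_on s t G mu B -> (Lambda al be B s t <= (Num.max 1 (Lambda_cst * G))%:E)%E.
Proof.
move=> G0 st ts1 gG.
rewrite /Lambda EFin_max ge_max le_max lexx /= le_max; apply/orP; right.
apply: ge_ereal_sup => y [u [v [su uv vt yE]]].
rewrite (yE : y = (Normc.normc (Zfun al B u v) / (v - u) `^ (be + al - 1))%:E).
rewrite lee_fin normc_Zfun normrM.
have uv0 : 0 < v - u by rewrite subr_gt0.
rewrite ler_pdivrMr ?powR_gt0// /Lambda_cst -mulrA -mulrA.
apply: ler_wpM2l => //.
have gG' := is_hoelder_clamp (ltW st) mu0 G0 gG.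
have E : dright al v B u = dright al v (fun z => B (clamp s t z)) u.
  apply: eq_dright (ltW uv) _ => z /andP[uz zv]; rewrite clamp_id//.
  by rewrite (le_trans su uz) (le_trans zv vt).
rewrite E; apply: le_trans (dright_bound al01 al_mu gG' uv) _.
rewrite mulrA (mulrC (right_cst _ _)); apply: ler_wpM2l.
  by apply: mulr_ge0 => //; exact: right_cst_ge0.
apply: ger_powR; first by rewrite uv0 /=; lra.
by rewrite lerD2r lerD2r.
Qed.

End PathBounds.

(** * Moments of the random constants and the theorem *)

Section Moments.
Context d {T : measurableType d} {R : realType} (P : probability T R).
Variable Z : T -> R.
Hypotheses (mZ : measurable_fun setT Z) (Z1 : forall w, 1 <= Z w)
  (EZ : (\int[P]_w (expR (Z w ^+ 2))%:E < +oo)%E).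

(** All required moments are bounded by a multiple of [E exp (Z^2)]. *)
Lemma expectation_lty (f : T -> R) (D : R) : measurable_fun setT f -> 0 <= D ->
  (forall w, 0 <= f w <= D * expR (Z w ^+ 2)) -> ('E_P[f] < +oo)%E.
Proof.
move=> mf D0 fD; rewrite unlock.
have mE : measurable_fun setT (fun w => (expR (Z w ^+ 2))%:E).
  by apply/measurable_EFinP; apply: measurableT_comp => //; exact: measurable_funX.
have E0 w : setT w -> (0 <= (expR (Z w ^+ 2))%:E)%E by move=> _; rewrite lee_fin expR_ge0.
have k0 : (0 <= D%:E)%E by rewrite lee_fin.
apply: (@le_lt_trans _ _ (\int[P]_w (D%:E * (expR (Z w ^+ 2))%:E))%E).
  apply: ge0_le_integral => //.
  - by move=> w _; rewrite lee_fin; have /andP[] := fD w.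
  - exact/measurable_EFinP.
  - by apply: emeasurable_funM.
  - by move=> w _; rewrite -EFinM lee_fin; have /andP[] := fD w.
rewrite (ge0_integralZl P measurableT mE E0 k0).
by apply: lte_mul_pinfty.
Qed.

Lemma expectation_exp_sq_lty (C x : R) : 0 < C -> x < (C ^+ 2)^-1 ->
  ('E_P[fun w => (expR (x * (C * Z w) ^+ 2))%R] < +oo)%E.
Proof.
move=> C0 xC; apply: (@expectation_lty _ 1) => //.
  apply: measurableT_comp => //; apply: measurable_funM => //.
  by apply: measurable_funX; exact: measurable_funM.
move=> w; rewrite expR_ge0 mul1r ler_expR /= exprMn mulrA.
rewrite ler_piMl ?sqr_ge0// -ler_pdivlMr ?exprn_gt0// mul1r.
exact: ltW.
Qed.

Lemma expectation_expn_lty (f : T -> R) (C : R) (n : nat) : measurable_fun setT f -> 0 <= C ->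
  (forall w, `|f w| <= C * Z w ^+ 2) -> ('E_P[fun w => (`|f w| ^+ n)%R] < +oo)%E.
Proof.
move=> mf C0 fC; apply: (@expectation_lty _ (C ^+ n * n.+1%:R ^+ n.+1)).
- by apply: measurable_funX; exact: measurableT_comp.
- by rewrite mulr_ge0 ?exprn_ge0.
move=> w; rewrite exprn_ge0//=.
have z2 : 1 <= Z w ^+ 2 by rewrite -[leLHS](expr1n _ 2) lerXn2r// nnegrE// (le_trans _ (Z1 w)).
have CZ0 : 0 <= C * Z w ^+ 2 by rewrite mulr_ge0// sqr_ge0.
apply: (@le_trans _ _ ((C * Z w ^+ 2) ^+ n)); first by apply: lerXn2r; rewrite ?nnegrE.
rewrite exprMn -mulrA; apply: ler_wpM2l; first exact: exprn_ge0.
exact: expn_le_expR.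
Qed.

End Moments.

Theorem corollary1 (d : measure_display) (T : measurableType d) (R : realType)
    (P : probability T R) (P_complete : measure_is_complete P)
    (H alpha beta : R)
    (H_range : 2^-1 < H < 1)
    (alpha_range : 1 - H < alpha < 2^-1)
    (beta_range : 2^-1 < beta < H)
    (B : R -> {RV P >-> R}) (B_fBm : fBm H B)
    (a b : R -> R) (ab_coef : coef_assumptions H a b)
    (x0 : R) (X : R -> {RV P >-> R})
    (X_sol : sde_solution H alpha B a b x0 X)
    (gamma : R) (gamma_gt : 2^-1 < gamma) :
  let kappa := gamma / beta in
  exists xi zeta : {RV P >-> R},
    [/\ (\forall w \ae P, forall t1 t2 : R,
           0 <= t1 -> t1 < t2 <= t1 + 1 ->
           `|X t2 w - X t1 w|
             <= zeta w * (t2 - t1) `^ beta * ln (t2 + 2) `^ kappa /\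
           (Lambda alpha beta (fun t => B t w) t1 t2
             <= (xi w * ln (t2 + 2) `^ (kappa * beta))%:E)%E),
        (exists c : R, 0 < c /\ forall x : R, x < c ->
           ('E_P[fun w => (expR (x * xi w ^+ 2))%R] < +oo)%E /\
           ('E_P[fun w => (expR (x * zeta w `^ (2 * beta)))%R] < +oo)%E)
      & (forall n : nat,
           ('E_P[fun w => (`|xi w| ^+ n)%R] < +oo)%E /\
           ('E_P[fun w => (`|zeta w| ^+ n)%R] < +oo)%E)].
Proof.
move=> kappa.
have [/andP[H12 H1] /andP[Hal al2] /andP[be2 beH]] := And3 H_range alpha_range beta_range.
have al01 : 0 < alpha < 1 by apply/andP; split; lra.
(* The midpoint between the lower bounds for the exponent and [H]. *)
pose mu := (Num.max beta (1 - alpha) + H) / 2.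
have [be_max al_max maxH] : [/\ beta <= Num.max beta (1 - alpha),
    1 - alpha <= Num.max beta (1 - alpha) & Num.max beta (1 - alpha) < H].
  by rewrite !le_max !lexx orbT gt_max beH; split => //; lra.
have [be_mu al_mu muH] : [/\ beta < mu, 1 - alpha < mu & mu < H].
  by rewrite /mu; split; lra.
have al_mu' : alpha < mu by lra.
have mu1 : mu < 1 by lra.
have mu0 : 0 < mu by lra.
have be0 : 0 < beta by lra.
have [_ [K [L [RN [[_ K0 L0 _] [abK abL _ _]]]]]] := ab_coef.
have aK y : `|a y| <= K by apply: le_trans (abK y); rewrite lerDl.
have bK y : `|b y| <= K by apply: le_trans (abK y); rewrite lerDr.
have aL y z : `|a y - a z| <= L * `|y - z| by apply: le_trans (abL y z); rewrite lerDl.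
have bL y z : `|b y - b z| <= L * `|y - z| by apply: le_trans (abL y z); rewrite lerDr.
have [Z [mZ Z1 EZ HZ]] := fBm_path_hoelder mu0 muH H1 B_fBm.
have [_ _ _ Bh] := B_fBm.
have [Xh Xe] := X_sol.
(* The summand 2 makes the Hoelder constant [G] below at least 1, since
   [Z * sqrt (ln (t + 2))] is at least 1/2. *)
pose Cg := fBm_cst H mu + 2.
have Cf0 : 0 <= fBm_cst H mu by exact: fBm_cst_ge0.
have Cg0 : 0 < Cg by rewrite /Cg; lra.
pose Cx := (Lambda_cst alpha mu + 1) * Cg * 2 `^ (gamma - 2^-1).
have Cl0 : 0 <= Lambda_cst alpha mu by rewrite mulr_ge0// right_cst_ge0.
have Cx0 : 0 < Cx by rewrite /Cx mulr_gt0 ?powR_gt0// mulr_gt0//; lra.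
pose Cp := path_cst alpha mu (gls_const alpha) K L.
have Cp0 : 0 <= Cp.
  apply: mulr_ge0; last exact: powR_ge0.
  apply: mulr_ge0 => //; apply: le_trans (ltW K0) _.
  exact: (path_cst1_ge al01 al_mu _ (ltW K0)).
pose Cz := (Cp + 1) * Cg `^ beta^-1 * 2 `^ (kappa - 2^-1 / beta).
have Cz0 : 0 < Cz by rewrite /Cz mulr_gt0 ?powR_gt0// mulr_gt0 ?powR_gt0//; lra.
pose xi w := Cx * Z w.
pose zeta w := Cz * Z w `^ beta^-1.
have mxi : measurable_fun setT xi by exact: measurable_funM.
have mzeta : measurable_fun setT zeta.
  by apply: measurable_funM => //; exact: (measurableT_comp (measurable_powR _)).
pose xim := isMeasurableFun.Build _ _ _ _ xi mxi.
pose xiR : {RV P >-> R} := MeasurableFun.Pack (MeasurableFun.Class xim).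
pose zem := isMeasurableFun.Build _ _ _ _ zeta mzeta.
pose zetaR : {RV P >-> R} := MeasurableFun.Pack (MeasurableFun.Class zem).
have Z0 w : 0 <= Z w by apply: le_trans (Z1 w).
have zetaX w : zeta w `^ (2 * beta) = (Cz `^ beta * Z w) ^+ 2.
  rewrite -(powR_mulrn 2); last by rewrite mulr_ge0 ?powR_ge0.
  rewrite /zeta powRM ?powR_ge0 ?(ltW Cz0)//.
  rewrite [in RHS]powRM ?powR_ge0 ?Z0//.
  rewrite -powRrM -[in RHS]powRrM; congr (_ `^ _ * _ `^ _); first by ring.
  by field; rewrite gt_eqF.
exists xiR, zetaR; split.
- apply: filterS2 HZ (filterI Bh (filterI Xh Xe)) => w HZ [Bhw [Xhw Xew]] t1 t2 t10 /andP[t12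
  t21].
  have t20 : 0 < t2 by exact: le_lt_trans t12.
  have mur : 0 < mu < H by rewrite mu0 muH.
  have [MB HMB] := Bhw mu mur t2 t20.
  have [MX HMX] := Xhw mu mur t2 t20.
  have hB : hoelder_on 0 t2 `|MB| mu (fun t => B t w).
    apply: (hoelder_on_ge (ler_norm MB)) => y z yi zi; exact: HMB.
  have hX : hoelder_on 0 t2 `|MX| mu (fun t => X t w).
    apply: (hoelder_on_ge (ler_norm MX)) => y z yi zi; exact: HMX.
  pose l := ln (t2 + 2); have l2 : 2^-1 <= l by exact: ln_shift_ge (ltW t20).
  have l0 : 0 < l by apply: lt_le_trans l2; rewrite invr_gt0.
  pose G := Cg * (Z w * l `^ 2^-1).
  have lh : 2^-1 <= l `^ 2^-1.
    have h : (2^-1 : R) `^ 2^-1 <= l `^ 2^-1 by apply: powR_le => //.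
    have h1 : (2^-1 : R) <= 1 by rewrite invf_le1// ler1n.
    by apply: le_trans h; apply: ger1_powR => //; rewrite invr_gt0 ltr0n.
  have G1 : 1 <= G.
    have z1 := Z1 w; rewrite /G /Cg.
    have h : 2^-1 <= Z w * l `^ 2^-1 by rewrite -[leLHS]mul1r; apply: ler_pM.
    rewrite -[leLHS](@divff _ (2 : R)) ?pnatr_eq0//.
    by apply: ler_pM => //; rewrite lerDr.
  have hG : hoelder_on t1 t2 G mu (fun t => B t w).
    move=> y z.
    wlog yz : y z / z <= y.
      move=> W yi zi; have [zy|/ltW yz] := leP z y; first exact: W.
      by rewrite distrC (distrC y); exact: W.
    move=> /andP[y1 y2] /andP[z1 z2]; rewrite [`|y - z|]ger0_norm ?subr_ge0//.
    have y1' : y <= z + 1 by apply: le_trans y2 (le_trans t21 _); rewrite lerD2r.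
    have := HZ t2 z y (le_trans t10 z1) yz y2 y1'; move=> /le_trans; apply.
    apply: ler_wpM2r; first exact: powR_ge0.
    apply: ler_wpM2r; first by rewrite mulr_ge0 ?powR_ge0.
    by rewrite /Cg lerDl.
  split.
    have xE t : 0 <= t -> t <= t2 -> (X t w)%:C%C =
      (x0 + \int[lebesgue_measure]_(s in `[0, t]) a (X s w))%:C%C +
      gls_integral alpha 0 t (fun s => b (X s w)) (fun s => B s w).
      by move=> t0 _; have [] := Xew t t0.
    have h := sde_path_increment al01 al_mu al_mu' mu1 be0 (ltW be_mu) (ltW K0) (ltW L0)
      (normr_ge0 MX) (normr_ge0 MB) aK bK aL bL hX hB xE G1 t10 t12 (lexx t2) t21 hG.
    apply: le_trans h _; rewrite -/Cp -/l.
    rewrite [leRHS]mulrAC; apply: ler_wpM2r; first exact: powR_ge0.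
    have GE : G `^ beta^-1 = Cg `^ beta^-1 * (Z w `^ beta^-1 * l `^ (2^-1 / beta)).
      by rewrite /G !powRM ?(ltW Cg0) ?mulr_ge0 ?powR_ge0// -powRrM.
    have ke : 2^-1 / beta <= kappa by rewrite /kappa ler_pM2r ?invr_gt0// ltW.
    have lE := powR_change_exponent l2 ke.
    rewrite GE.
    apply: (@le_trans _ _ ((Cp + 1) * (Cg `^ beta^-1 * (Z w `^ beta^-1 *
      (2 `^ (kappa - 2^-1 / beta) * l `^ kappa))))).
      apply: ler_pM => //; first by rewrite !mulr_ge0 ?powR_ge0.
        by rewrite lerDl.
      apply: ler_wpM2l; first exact: powR_ge0.
      by apply: ler_wpM2l; first exact: powR_ge0.
    rewrite /= /zeta /Cz le_eqVlt; apply/orP; left; apply/eqP.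
    set e1 := Cg `^ _; set e2 := Z w `^ _; set e3 := 2 `^ _; set e4 := l `^ _.
    by ring.
  have G0 : 0 <= G by exact: le_trans G1.
  apply: le_trans (Lambda_bound al01 al_mu al_mu' (ltW be_mu) G0 t12 t21 hG) _.
  rewrite lee_fin -/l.
  have -> : kappa * beta = gamma by rewrite /kappa divfK ?gt_eqF.
  have lE := powR_change_exponent l2 (ltW gamma_gt).
  have GG : G <= Cg * (Z w * (2 `^ (gamma - 2^-1) * l `^ gamma)).
    by apply: ler_wpM2l; [exact: ltW|exact: ler_wpM2l].
  apply: (@le_trans _ _ ((Lambda_cst alpha mu + 1) * G)).
    rewrite ge_max; apply/andP; split.
      by rewrite -[leLHS]mulr1; apply: ler_pM => //; rewrite lerDr.
    by apply: ler_wpM2r => //; rewrite lerDl.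
  have cl : 0 <= Lambda_cst alpha mu + 1 by exact: addr_ge0.
  apply: le_trans (ler_wpM2l cl GG) _.
  rewrite /= /xi /Cx le_eqVlt; apply/orP; left; apply/eqP.
  set e3 := 2 `^ _; set e4 := l `^ _.
  by ring.
- exists (Num.min (Cx ^+ 2)^-1 ((Cz `^ beta) ^+ 2)^-1); split.
    by rewrite lt_min !invr_gt0 !exprn_gt0// powR_gt0.
  move=> x; rewrite lt_min => /andP[x1 x2]; split.
    exact: (expectation_exp_sq_lty mZ EZ Cx0 x1).
  have := expectation_exp_sq_lty mZ EZ (powR_gt0 beta Cz0) x2.
  congr (_ < _)%E; congr (expectation P _); apply/funext => w /=.
  by rewrite zetaX.
- have xiB w : `|xi w| <= Cx * Z w ^+ 2.
    rewrite normrM !ger0_norm ?(ltW Cx0)//; apply: ler_wpM2l; first exact: ltW.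
    by rewrite expr2 ler_peMl.
  have zetaB w : `|zeta w| <= Cz * Z w ^+ 2.
    rewrite normrM !ger0_norm ?powR_ge0 ?(ltW Cz0)//; apply: ler_wpM2l; first exact: ltW.
    rewrite -(powR_mulrn 2 (Z0 w)); apply: ler_powR => //.
    by rewrite -[leRHS]invrK lef_pV2 ?posrE ?invr_gt0//; lra.
  move=> n; split.
    exact: (expectation_expn_lty mZ Z1 EZ n mxi (ltW Cx0) xiB).
  exact: (expectation_expn_lty mZ Z1 EZ n mzeta (ltW Cz0) zetaB).
Qed.
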